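(* Let $F\in\mathcal W(\mathbb R,\mathbb H)$. The following are equivalent: (i) the function $F$ is invertible in $\mathcal W(\mathbb R,\mathbb H)$ (with respect to the $\star$-product); (ii) for any $i\in\mathbb S$ we have $\det\omega(F)(it)\neq0$ for all $t\in\mathbb R$; (iii) there exists an $i\in\mathbb S$ such that $\det\omega(F)(it)\neq0$ for all $t\in\mathbb R$; (iv) $F(p)\neq0$ for all $p\in\mathbb R\mathbb S$.
   Context: $\mathbb H$ is the real algebra of quaternions, $\mathbb S=\{q\in\mathbb H:q^2=-1\}$, $\mathbb R\mathbb S=\{it:t\in\mathbb R,\ i\in\mathbb S\}$ (the purely imaginary quaternions). $L_1(\mathbb R,\mathbb H)$ is the space of (measurable) $f:\mathbb R\to\mathbb H$ with $\|f\|_{L_1}=\int_{\mathbb R}|f(u)|\,du<\infty$. $\mathcal W(\mathbb R,\mathbb H)$ is the set of functions $F(p)=c+\int_{\mathbb R}e^{pu}f(u)\,du$, $p\in\mathbb R\mathbb S$, with $c\in\mathbb H$ and $f\in L_1(\mathbb R,\mathbb H)$. For $F_k(p)=c_k+\int_{\mathbb R}e^{pu}f_k(u)\,du$, $k=1,2$, the product is $$(F_1\star F_2)(p)=c_1c_2+\int_{\mathbb R}e^{pu}\big(c_1f_2(u)+f_1(u)c_2+(f_1\circ f_2)(u)\big)\,du,\quad (f_1\circ f_2)(u)=\int_{\mathbb R}f_1(u-v)f_2(v)\,dv,$$ with unit the constant function $1$. For $i\in\mathbb S$ choose $j\in\mathbb S$ orthogonal to $i$ (i.e. $ij+ji=0$)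 and identify $\mathbb C_i=\{x+iy:x,y\in\mathbb R\}$ with $\mathbb C$. Every quaternion is uniquely $z+wj$ with $z,w\in\mathbb C_i$; put $\chi(z+wj)=\begin{pmatrix}z&w\\-\overline w&\overline z\end{pmatrix}$. For $F(p)=c+\int_{\mathbb R}e^{pu}f(u)\,du$, the map $\omega=\omega_{i,j}$ is defined by $\omega(F)(it)=\chi(c)+\int_{\mathbb R}e^{itu}\chi(f(u))\,du\in\mathbb C^{2\times2}$, $t\in\mathbb R$.
   Formalization: As stated this fails for c=0 (c=0, f(u)=e^{-|u|} satisfies (ii)-(iv) but not (i)). Proved instead: (ii)-(iv) are equivalent for every F; (i) implies c≠0; and if c≠0, then (i)-(iv) are all equivalent. *)

(* Defs.v *)
From HB Require Import structures.
From mathcomp Require Import all_boot all_order all_algebra.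
From mathcomp Require Import ring lra.
From mathcomp Require Import complex.
From mathcomp Require Import all_classical all_reals all_analysis.

Set Implicit Arguments.
Unset Strict Implicit.
Unset Printing Implicit Defensive.

Import Order.TTheory GRing.Theory Num.Theory.
Import numFieldNormedType.Exports.

Local Open Scope classical_set_scope.
Local Open Scope ring_scope.

Local Notation leb := (@lebesgue_measure _).

Record quat (R : Type) := Quat { q0 : R; q1 : R; q2 : R; q3 : R }.

Section QuatRing.
Context {R : realType}.
Implicit Types p q r : quat R.

Definition quat_tuple q := (q0 q, q1 q, q2 q, q3 q).
Definition tuple_quat (t : R * R * R * R) :=
  let: (a, b, c, d) := t in Quat a b c d.
Lemma quat_tupleK : cancel quat_tuple tuple_quat. Proof. by case. Qed.

HB.instance Definition _ := Choice.copy (quat R) (can_type quat_tupleK).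

Lemma quatP p q :
  q0 p = q0 q -> q1 p = q1 q -> q2 p = q2 q -> q3 p = q3 q -> p = q.
Proof. by case: p => ????; case: q => ???? /= -> -> -> ->. Qed.

Definition quat_opp q := Quat (- q0 q) (- q1 q) (- q2 q) (- q3 q).
Definition quat_add p q :=
  Quat (q0 p + q0 q) (q1 p + q1 q) (q2 p + q2 q) (q3 p + q3 q).
Definition quat_scale (a : R) q := Quat (a * q0 q) (a * q1 q) (a * q2 q) (a * q3 q).
Definition quat_mul p q := Quat
  (q0 p * q0 q - q1 p * q1 q - q2 p * q2 q - q3 p * q3 q)
  (q0 p * q1 q + q1 p * q0 q + q2 p * q3 q - q3 p * q2 q)
  (q0 p * q2 q - q1 p * q3 q + q2 p * q0 q + q3 p * q1 q)
  (q0 p * q3 q + q1 p * q2 q - q2 p * q1 q + q3 p * q0 q).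

Lemma quat_addA : associative quat_add.
Proof. by move=> p q r; apply: quatP => /=; ring. Qed.
Lemma quat_addC : commutative quat_add.
Proof. by move=> p q; apply: quatP => /=; ring. Qed.
Lemma quat_add0 : left_id (Quat 0 0 0 0) quat_add.
Proof. by move=> p; apply: quatP => /=; ring. Qed.
Lemma quat_addN : left_inverse (Quat 0 0 0 0) quat_opp quat_add.
Proof. by move=> p; apply: quatP => /=; ring. Qed.
HB.instance Definition _ := GRing.isZmodule.Build (quat R)
  quat_addA quat_addC quat_add0 quat_addN.

Lemma quat_mulA : associative quat_mul.
Proof. by move=> p q r; apply: quatP => /=; ring. Qed.
Lemma quat_mul1 : left_id (Quat 1 0 0 0) quat_mul.
Proof. by move=> p; apply: quatP => /=; ring. Qed.
Lemma quat_mulr1 : right_id (Quat 1 0 0 0) quat_mul.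
Proof. by move=> p; apply: quatP => /=; ring. Qed.
Lemma quat_mulDl : left_distributive quat_mul +%R.
Proof. by move=> p q r; apply: quatP => /=; ring. Qed.
Lemma quat_mulDr : right_distributive quat_mul +%R.
Proof. by move=> p q r; apply: quatP => /=; ring. Qed.
Lemma quat_one_neq0 : Quat 1 0 0 0 != 0 :> quat R.
Proof. by apply/eqP => -[] /eqP; rewrite oner_eq0. Qed.
HB.instance Definition _ := GRing.Zmodule_isNzRing.Build (quat R)
  quat_mulA quat_mul1 quat_mulr1 quat_mulDl quat_mulDr quat_one_neq0.

Lemma quat_scaleA a b q : quat_scale a (quat_scale b q) = quat_scale (a * b) q.
Proof. by apply: quatP => /=; ring. Qed.
Lemma quat_scale1 : left_id 1 quat_scale.
Proof. by move=> q; apply: quatP => /=; ring. Qed.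
Lemma quat_scaleDr : right_distributive quat_scale +%R.
Proof. by move=> a p q; apply: quatP => /=; ring. Qed.
Lemma quat_scaleDl q : {morph quat_scale^~ q : a b / a + b}.
Proof. by move=> a b; apply: quatP => /=; ring. Qed.
HB.instance Definition _ := GRing.Zmodule_isLmodule.Build R (quat R)
  quat_scaleA quat_scale1 quat_scaleDr quat_scaleDl.

Lemma quat_scaleAl a p q : a *: (p * q) = (a *: p) * q.
Proof. by apply: quatP => /=; ring. Qed.
HB.instance Definition _ := GRing.Lmodule_isLalgebra.Build R (quat R) quat_scaleAl.
Lemma quat_scaleAr a p q : a *: (p * q) = p * (a *: q).
Proof. by apply: quatP => /=; ring. Qed.
HB.instance Definition _ := GRing.Lalgebra_isAlgebra.Build R (quat R) quat_scaleAr.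

Definition qnorm q : R :=
  Num.sqrt (q0 q ^+ 2 + q1 q ^+ 2 + q2 q ^+ 2 + q3 q ^+ 2).

Definition qsphere : set (quat R) := [set i | i ^+ 2 = -1].

Definition qimag : set (quat R) :=
  [set p | exists t : R, exists2 i, qsphere i & p = t *: i].

(* The exponential series; its limit is taken in each real coordinate. *)
Definition qexp_sum q (n : nat) : quat R := \sum_(k < n) (k`!%:R^-1 : R) *: q ^+ k.
Definition qexp q : quat R := Quat
  (lim ((fun n => q0 (qexp_sum q n)) @ \oo)) (lim ((fun n => q1 (qexp_sum q n)) @ \oo))
  (lim ((fun n => q2 (qexp_sum q n)) @ \oo)) (lim ((fun n => q3 (qexp_sum q n)) @ \oo)).

Definition qint (f : R -> quat R) : quat R := Quat
  (Rintegral leb setT (fun u => q0 (f u))) (Rintegral leb setT (fun u => q1 (f u)))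
  (Rintegral leb setT (fun u => q2 (f u))) (Rintegral leb setT (fun u => q3 (f u))).

Definition qmeasurable (f : R -> quat R) : Prop :=
  [/\ measurable_fun setT (fun u => q0 (f u)), measurable_fun setT (fun u => q1 (f u)),
      measurable_fun setT (fun u => q2 (f u)) & measurable_fun setT (fun u => q3 (f u))].

Definition qL1 (f : R -> quat R) : Prop :=
  qmeasurable f /\ (\int[leb]_(u in setT) (qnorm (f u))%:E < +oo)%E.

End QuatRing.

Arguments qsphere R : clear implicits.
Arguments qimag R : clear implicits.

(* An element of W(R,H), given by its data (c, f); the function it denotes on
   the purely imaginary quaternions is the coercion [wfun] below. *)
Record wiener (R : realType) := Wiener {
  wcst : quat R;
  wdens : R -> quat R;
  wdens_L1 : qL1 wdens }.

Section Wiener.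
Context {R : realType}.

Definition qlaplace (c : quat R) (f : R -> quat R) (p : quat R) : quat R :=
  c + qint (fun u => qexp (u *: p) * f u).

Definition wfun (F : wiener R) : quat R -> quat R := qlaplace (wcst F) (wdens F).

Definition qconv (f g : R -> quat R) (u : R) : quat R :=
  qint (fun v => f (u - v) * g v).

Definition wstar (F G : wiener R) : quat R -> quat R :=
  qlaplace (wcst F * wcst G)
    (fun u => wcst F * wdens G u + wdens F u * wcst G + qconv (wdens F) (wdens G) u).

(* Elements of W(R,H) are functions on the imaginary quaternions, so an identity
   between them is an identity at every imaginary p. *)
Definition winvertible (F : wiener R) : Prop :=
  exists G : wiener R,
    forall p, qimag R p -> wstar F G p = 1 /\ wstar G F p = 1.

Definition qorthogonal (i j : quat R) : Prop := i * j + j * i = 0.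

Definition qembed (i : quat R) (z : R[i]) : quat R :=
  (complex.Re z)%:A + complex.Im z *: i.

(* The components z, w in q = z + w j, read as complex numbers through
   x + i y |-> x +i* y: they are the coordinates of q in the orthonormal basis
   1, i, j, ij, and <q, e> = - Re (q e) for an imaginary unit e.
   See [qcompP] and [qcomp_uniq]. *)
Definition qcomp1 (i j q : quat R) : R[i] := Complex (q0 q) (- q0 (q * i)).
Definition qcomp2 (i j q : quat R) : R[i] :=
  Complex (- q0 (q * j)) (- q0 (q * (i * j))).

Definition chi (i j q : quat R) : 'M[R[i]]_2 :=
  let z := qcomp1 i j q in let w := qcomp2 i j q in
  \matrix_(a, b) if a == ord0 then (if b == ord0 then z else w)
                 else (if b == ord0 then - conjc w else conjc z).

(* e^{ix} for real x; see [qexp_imag] for the link with the quaternionic one. *)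
Definition expi (x : R) : R[i] := Complex (cos x) (sin x).

Definition cint (f : R -> R[i]) : R[i] := Complex
  (Rintegral leb setT (fun u => complex.Re (f u)))
  (Rintegral leb setT (fun u => complex.Im (f u))).

Definition mxint (f : R -> 'M[R[i]]_2) : 'M[R[i]]_2 :=
  \matrix_(a, b) cint (fun u => f u a b).

(* [womega i j F t] is omega_{i,j}(F)(it). *)
Definition womega (i j : quat R) (F : wiener R) (t : R) : 'M[R[i]]_2 :=
  chi i j (wcst F) + mxint (fun u => expi (t * u) *: chi i j (wdens F u)).

End Wiener.

Coercion wfun : wiener >-> Funclass.

Section Facts.
Context {R : realType}.
Implicit Types i j q : quat R.

Lemma qsphereE i : qsphere R i <->
  q0 i = 0 /\ q1 i ^+ 2 + q2 i ^+ 2 + q3 i ^+ 2 = 1.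
Proof.
rewrite /qsphere /= expr2; split=> [[h0 h1 h2 h3]|[h0 h]]; last first.
  by apply: quatP => /=; rewrite h0; try ring; rewrite -h; ring.
have e0 : q0 i = 0.
  apply/eqP; apply: contraT => ne.
  have z x : q0 i * x + x * q0 i = 0 -> x = 0.
    move=> e; have /eqP : 2 * q0 i * x = 0 by rewrite -e; ring.
    by rewrite !mulf_eq0 pnatr_eq0 (negbTE ne) /= => /eqP.
  have e1 : q1 i = 0 by apply: z; move: h1; rewrite oppr0 => <-; ring.
  have e2 : q2 i = 0 by apply: z; move: h2; rewrite oppr0 => <-; ring.
  have e3 : q3 i = 0 by apply: z; move: h3; rewrite oppr0 => <-; ring.
  move: h0; rewrite e1 e2 e3 => h0.
  by have := sqr_ge0 (q0 i); nra.
by split=> //; move: h0; rewrite e0 => h0; lra.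
Qed.

Lemma qorthogonalE i j : qsphere R i -> qsphere R j -> qorthogonal i j ->
  q1 i * q1 j + q2 i * q2 j + q3 i * q3 j = 0.
Proof.
by move=> /qsphereE[i0 _] /qsphereE[j0 _] [+ _ _ _] /=; rewrite i0 j0 => h; lra.
Qed.

Lemma qcomp_uniq i j (z w : R[i]) : qsphere R i -> qsphere R j -> qorthogonal i j ->
  let q := qembed i z + qembed i w * j in qcomp1 i j q = z /\ qcomp2 i j q = w.
Proof.
move=> Si Sj ij; have o := qorthogonalE Si Sj ij.
case/qsphereE: Si => i0; case/qsphereE: Sj => j0.
move: o i0 j0; case: i {ij} => a0 a1 a2 a3; case: j => b0 b1 b2 b3 /= o -> -> hb ha.
have k : (a2 * b3 - a3 * b2) ^+ 2 + (a3 * b1 - a1 * b3) ^+ 2 +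
         (a1 * b2 - a2 * b1) ^+ 2 = 1.
  have -> : 1 = (a1 ^+ 2 + a2 ^+ 2 + a3 ^+ 2) * (b1 ^+ 2 + b2 ^+ 2 + b3 ^+ 2)
      - (a1 * b1 + a2 * b2 + a3 * b3) ^+ 2 :> R.
    by rewrite ha hb o expr0n subr0 mulr1.
  by ring.
case: z => z1 z2; case: w => w1 w2.
split; congr Complex => /=.
- by have := congr1 ( *%R w2) o; lra.
- by have := congr1 ( *%R z2) ha; have := congr1 ( *%R w1) o; lra.
- by have := congr1 ( *%R w1) hb; have := congr1 ( *%R z2) o; lra.
- have := congr1 ( *%R w2) k; have := congr1 ( *%R z1) o.
  by have := congr1 ( *%R (w2 * (a1 * b1 + a2 * b2 + a3 * b3))) o; lra.
Qed.

Lemma qcommute i q : qsphere R i -> q * i = i * q ->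
  q = qembed i (Complex (q0 q) (- q0 (q * i))).
Proof.
case/qsphereE; case: i => a0 a1 a2 a3; case: q => x0 x1 x2 x3 /= -> ha [_ h1 h2 h3].
have e1 : x2 * a3 = x3 * a2 by lra.
have e2 : x3 * a1 = x1 * a3 by lra.
have e3 : x1 * a2 = x2 * a1 by lra.
apply: quatP => /=; first by ring.
- have := congr1 ( *%R x1) ha; have := congr1 ( *%R a2) e3; have := congr1 ( *%R a3) e2; lra.
- have := congr1 ( *%R x2) ha; have := congr1 ( *%R a1) e3; have := congr1 ( *%R a3) e1; lra.
- have := congr1 ( *%R x3) ha; have := congr1 ( *%R a1) e2; have := congr1 ( *%R a2) e1; lra.
Qed.

Lemma qcompP i j q : qsphere R i -> qsphere R j -> qorthogonal i j ->
  q = qembed i (qcomp1 i j q) + qembed i (qcomp2 i j q) * j.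
Proof.
move=> Si Sj ij.
have ii : i * i = -1 by rewrite -expr2.
have jj : j * j = -1 by rewrite -expr2.
have ji : j * i = - (i * j) by apply/eqP; rewrite -addr_eq0 addrC ij.
pose h : R := 2^-1.
pose z := h *: (q - i * q * i); pose r := h *: (q + i * q * i).
have zr : q = z + r.
  by rewrite -scalerDr addrACA addNr addr0 -mulr2n -scaler_nat scalerA mulVf ?scale1r.
have zi : z * i = i * z.
  rewrite -scalerAl -scalerAr mulrBl mulrBr !mulrA ii mulN1r -!mulrA ii.
  by rewrite !mulrN1 mulrN mulNr !opprK addrC.
have ri : r * i = - (i * r).
  rewrite -scalerAl -scalerAr -scalerN mulrDl mulrDr !mulrA ii mulN1r -!mulrA ii.
  by rewrite !mulrN1 mulrN mulNr opprB addrC.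
have si : (- (r * j)) * i = i * (- (r * j)).
  by rewrite mulNr mulrN -mulrA ji mulrN (mulrA r) ri (mulrA i) mulNr opprK.
have [e1 e2] := qcomp_uniq (Complex (q0 z) (- q0 (z * i)))
  (Complex (q0 (- (r * j))) (- q0 ((- (r * j)) * i))) Si Sj ij.
move: e1 e2; rewrite -(qcommute Si zi) -(qcommute Si si).
have -> : - (r * j) * j = r by rewrite mulNr -mulrA jj mulrN1 opprK.
rewrite -zr => -> ->; rewrite -(qcommute Si zi) -(qcommute Si si).
by rewrite mulNr -mulrA jj mulrN1 opprK.
Qed.

Lemma qexp_imag i (t : R) : qsphere R i -> qexp (t *: i) = qembed i (expi t).
Proof.
move=> Si.
have [i0 _] := (qsphereE i).1 Si.
have pw n : i ^+ n = ((~~ odd n)%:R * (-1) ^+ n./2)%:A + ((odd n)%:R * (-1) ^+ n.-1./2) *: i.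
  elim: n => [|n IH]; first by rewrite expr0 /= mulr1 scale1r mul0r scale0r addr0.
  rewrite exprSr IH mulrDl -!scalerAl mul1r -expr2 Si /=.
  case: n {IH} => [|n] /=; first by rewrite !mul0r !mul1r !scale0r !addr0 add0r.
  rewrite negbK; case: (boolP (odd n)) => on /=.
    by rewrite !mul0r !mul1r !scale0r ?addr0 ?add0r -?uphalf_half // uphalf_half on.
  rewrite !mul0r !mul1r !scale0r ?addr0 ?add0r scalerN.
  by rewrite exprS mulN1r scaleNr.
have sm n : qexp_sum (t *: i) n =
    (series (cos_coeff t) n)%:A + (series (sin_coeff t) n) *: i.
  rewrite /qexp_sum /series /= !big_mkord !scaler_suml -big_split /=.
  apply: eq_bigr => k _; rewrite exprZn pw scalerA scalerDr !scalerA.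
  by congr (_ *: _ + _ *: _); rewrite /cos_coeff /sin_coeff /=;
    rewrite mulrC [X in _ * X]mulrC !mulrA.
have L (x y : R) : (fun n => series (cos_coeff t) n * x + series (sin_coeff t) n * y) @ \oo
    --> cos t * x + sin t * y.
  apply: cvgD; apply: cvgMr_tmp.
  - by rewrite unlock; exact: is_cvg_series_cos_coeff.
  - by rewrite unlock; exact: is_cvg_series_sin_coeff.
apply: quatP => /=.
- rewrite (_ : (fun n => _) = fun n => series (cos_coeff t) n * 1
    + series (sin_coeff t) n * q0 i); first exact: (cvg_lim _ (L _ _)).
  by apply/funext => n; rewrite sm.
- rewrite (_ : (fun n => _) = fun n => series (cos_coeff t) n * 0
    + series (sin_coeff t) n * q1 i); first exact: (cvg_lim _ (L _ _)).
  by apply/funext => n; rewrite sm.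
- rewrite (_ : (fun n => _) = fun n => series (cos_coeff t) n * 0
    + series (sin_coeff t) n * q2 i); first exact: (cvg_lim _ (L _ _)).
  by apply/funext => n; rewrite sm.
- rewrite (_ : (fun n => _) = fun n => series (cos_coeff t) n * 0
    + series (sin_coeff t) n * q3 i); first exact: (cvg_lim _ (L _ _)).
  by apply/funext => n; rewrite sm.
Qed.

End Facts.

(* Main.v *)
(** Write F(it) = C(t) + i S(t), where the cosine and sine transforms C and S do not depend
    on the unit i, and let Phi_0, ..., Phi_3 be the complex Fourier transforms of the real
    components of F. Then det omega(F)(it) = sum_k Phi_k(t)^2 for every choice of i and j.
    Its real part is |C|^2 - |S|^2 and its imaginary part is 2 <C, S>, so it vanishes
    exactly when some unit i solves C + i S = 0: (ii), (iii) and (iv) are equivalent. An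
    inverse of F yields one of D = det omega(F) in the scalar Wiener algebra; conversely
    the conjugate of F times 1/D inverts F.

    What remains is Wiener's lemma for D, proved here without Gelfand theory. Functions
    with a rational transform are dense in L_1, and a proper rational function without real
    poles belongs to the algebra. Approximate D by such an F_0 with error E of norm at most
    e, where x = e / F_0 is small in the sup norm. The resolvents of x on a square are
    uniformly bounded by compactness, and averaging over square roots makes the norm of some
    power of x small. Hence some power of y = E / F_0 has norm less than 1, and a Neumann
    series inverts 1 - y = D / F_0. *)

Require Import Defs.
From HB Require Import structures.
From mathcomp Require Import all_boot all_order all_algebra.
From mathcomp Require Import ring lra.
From mathcomp Require Import complex.
From mathcomp Require Import all_classical all_reals all_analysis measurable_realfun.

Set Implicit Arguments.
Unset Strict Implicit.
Unset Printing Implicit Defensive.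

Import Order.TTheory GRing.Theory Num.Theory.
Import numFieldNormedType.Exports.

Local Open Scope classical_set_scope.
Local Open Scope ring_scope.
Local Open Scope complex_scope.

(** * Integrable functions and convolution *)

Section L1.
Context {R : realType}.
Local Notation mu := (@lebesgue_measure R).
Implicit Types (h k w : R -> R) (a b c t u v : R).

(** The usual bound on powers is the spectral radius formula, proved by integrating resolvents over
    a circle. The integral is replaced here by an identity: the values of 1 / (1 - v a) at v and - v
    average to 1 / (1 - v^2 a^2). An estimate of how 1 / (1 - v (s x)^n) varies with a scale s in
    [0, 1] thus passes from n to 2 n with the same constant, and s travels from 0, where powers
    vanish, to 1 in a number of steps independent of n. The resolvents of x must already lie in the
    algebra, which would be circular for a general element. For x = e / F_0 they are rational, with
    denominator F_0 - z e vanishing neither on the line nor at infinity; hence approximation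
    precedes inversion. The constant |c|^2 of D is its value at infinity. Together with the
    Riemann-Lebesgue lemma, itself drawn from the density, it bounds |D| below on the whole line.
    Elements of W(R,H) are handled as four complex functions of t, multiplied as in the complexified
    quaternions. Integrals being total functions, the coordinates of a quaternionic convolution are
    compared with real convolutions only almost everywhere. *)

Definition L1 h := mu.-integrable setT (EFin \o h).
Definition norm1 h := \int[mu]_u `|h u|.

Lemma L1_measurable h : L1 h -> measurable_fun setT h.
Proof. by move=> /integrableP[/measurable_EFinP]. Qed.

Lemma L1_le h k : measurable_fun setT h -> L1 k ->
  (forall u, `|h u| <= `|k u|) -> L1 h.
Proof.
move=> mh L1k hk; apply: le_integrable L1k => //; first exact/measurable_EFinP.
by move=> u _ /=; rewrite lee_fin.
Qed.

Lemma L1_abs h : L1 h -> L1 (fun u => `|h u|).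
Proof.
move=> L1h; apply: (L1_le _ L1h) => [|u]; last by rewrite normr_id.
by apply: measurableT_comp => //; exact: L1_measurable.
Qed.

Lemma L1D h k : L1 h -> L1 k -> L1 (fun u => h u + k u).
Proof. by move=> L1h L1k; exact: (integrableD measurableT L1h L1k). Qed.

Lemma L1N h : L1 h -> L1 (fun u => - h u).
Proof. by move=> L1h; exact: (integrableN L1h). Qed.

Lemma L1B h k : L1 h -> L1 k -> L1 (fun u => h u - k u).
Proof. by move=> L1h L1k; apply: L1D => //; exact: L1N. Qed.

Lemma L1Z a h : L1 h -> L1 (fun u => a * h u).
Proof. by move=> L1h; exact: (integrableZl measurableT a L1h). Qed.

Lemma L10 : L1 (fun=> 0).
Proof. exact: (integrable0 mu). Qed.

Lemma L1_bounded_mul h w : measurable_fun setT w -> (forall u, `|w u| <= 1) ->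
  L1 h -> L1 (fun u => w u * h u).
Proof.
move=> mw w1 L1h; apply: (L1_le _ L1h) => [|u].
  by apply: measurable_funM => //; exact: L1_measurable.
by rewrite normrM ler_piMl.
Qed.

Lemma norm1_ge0 h : 0 <= norm1 h.
Proof. exact: Rintegral_ge0. Qed.

Lemma EFin_norm1 h : L1 h -> (norm1 h)%:E = (\int[mu]_u `|h u|%:E)%E.
Proof.
by move=> L1h; rewrite /norm1 /Rintegral fineK//; apply: integrable_fin_num => //;
  exact: L1_abs.
Qed.

Lemma norm1D h k : L1 h -> L1 k -> norm1 (fun u => h u + k u) <= norm1 h + norm1 k.
Proof.
move=> L1h L1k; rewrite -RintegralD//; [|exact: L1_abs..].
apply: le_Rintegral => //; first exact/L1_abs/L1D.
  by apply: L1D; exact: L1_abs.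
by move=> u _; exact: ler_normD.
Qed.

Lemma norm1Z a h : L1 h -> norm1 (fun u => a * h u) = `|a| * norm1 h.
Proof.
move=> L1h; rewrite -RintegralZl//; last exact: L1_abs.
by apply: eq_Rintegral => u _; rewrite normrM.
Qed.

Lemma norm1N h : norm1 (fun u => - h u) = norm1 h.
Proof. by apply: eq_Rintegral => u _; rewrite normrN. Qed.

Lemma norm10 : norm1 (fun=> 0) = 0.
Proof.
rewrite /norm1 (_ : (fun u : R => _) = cst 0); last by apply/funext => u; rewrite normr0.
by rewrite /Rintegral integral0.
Qed.

Lemma Rintegral_bounded_mul h w : measurable_fun setT w -> (forall u, `|w u| <= 1) ->
  L1 h -> `|\int[mu]_u (w u * h u)| <= norm1 h.
Proof.
move=> mw w1 L1h; have L1wh := L1_bounded_mul mw w1 L1h.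
apply: le_trans (le_normr_Rintegral _ L1wh) _ => //.
apply: le_Rintegral => //; [exact: L1_abs..|move=> u _].
by rewrite normrM ler_piMl.
Qed.

(** Half-open intervals determine Lebesgue measure, and translation preserves their length. *)
Lemma lebesgue_measure_shift v (A : set R) : measurable A ->
  pushforward mu (fun u : measurableTypeR R => u - v : measurableTypeR R) A = mu A.
Proof.
have mshift : measurable_fun setT
    (fun u : measurableTypeR R => u - v : measurableTypeR R).
  exact: (@measurable_funB _ (measurableTypeR R) R setT id (cst v)).
pose f : {mfun measurableTypeR R >-> measurableTypeR R} :=
  HB.pack (fun u : measurableTypeR R => u - v : measurableTypeR R)
    (isMeasurableFun.Build _ _ _ _ _ mshift).
move=> mA; apply/esym.
apply: (lebesgue_measure_unique (mu := pushforward mu f)) => // _ [[a b]] _ <-.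
rewrite /pushforward [X in _ = mu X](_ : _ = `](a + v), (b + v)]%classic); last first.
  by apply/seteqP; split=> u /=; rewrite !in_itv /= ltrBrDr lerBlDr.
rewrite !lebesgue_measure_itv /= !lte_fin ltrD2r -!EFinD.
by rewrite (_ : b + v - (a + v) = b - a)%R; last by ring.
Qed.

Lemma integral_preserve (phi : measurableTypeR R -> measurableTypeR R)
    (f : measurableTypeR R -> \bar R) :
  measurable_fun setT phi ->
  (forall A, measurable A -> pushforward mu phi A = mu A) ->
  measurable_fun setT f -> (forall u, (0 <= f u)%E) ->
  (\int[mu]_u f (phi u) = \int[mu]_u f u)%E.
Proof.
move=> mphi phi_mu mf f0.
have /= <- // := @ge0_integral_pushforward _ _ _ _ _ _ mphi mu setT f measurableT mf.
by apply: eq_measure_integral => A mA _; exact: phi_mu.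
Qed.

Lemma L1_preserve (phi : measurableTypeR R -> measurableTypeR R) h : measurable_fun setT phi ->
  (forall A, measurable A -> pushforward mu phi A = mu A) ->
  L1 h -> L1 (h \o phi) /\ \int[mu]_u h (phi u) = \int[mu]_u h u.
Proof.
move=> mphi phi_mu L1h; have mh := L1_measurable L1h.
have L1hphi : L1 (h \o phi).
  apply/integrableP; split; first exact/measurable_EFinP/measurableT_comp.
  rewrite (@integral_preserve phi (fun u => `|h u|%:E)%E) //.
  + by case/integrableP: L1h.
  + by apply/measurable_EFinP; apply: measurableT_comp.
split => //; rewrite /Rintegral; congr fine.
have /= <- := @integral_pushforward _ _ _ _ _ phi mphi mu setT (EFin \o h) _ L1hphi measurableT.
  by apply: eq_measure_integral => A mA _; exact: phi_mu.
exact/measurable_EFinP.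
Qed.

Lemma measurable_shift v : measurable_fun setT (fun u : R => u - v).
Proof. exact: measurable_funB. Qed.

Lemma L1_shift v h : L1 h -> L1 (fun u => h (u - v)).
Proof.
by move=> /(L1_preserve (measurable_shift v) (@lebesgue_measure_shift v))[].
Qed.

Lemma Rintegral_shift v h : L1 h -> \int[mu]_u h (u - v) = \int[mu]_u h u.
Proof.
by move=> /(L1_preserve (measurable_shift v) (@lebesgue_measure_shift v))[].
Qed.

Lemma L1_opp h : L1 h -> L1 (fun u => h (- u)).
Proof.
by move=> /(L1_preserve (@oppr_measurable R setT) (@lebesgue_measureN R))[].
Qed.

Lemma Rintegral_opp h : L1 h -> \int[mu]_u h (- u) = \int[mu]_u h u.
Proof.
by move=> /(L1_preserve (@oppr_measurable R setT) (@lebesgue_measureN R))[].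
Qed.

End L1.

(** * Convolution of real functions through Fubini's theorem *)

Section Convolution.
Context {R : realType}.
Local Notation mu := (@lebesgue_measure R).
Implicit Types (h k w : R -> R) (a b c t u v : R).

Definition conv h k u := \int[mu]_v (h (u - v) * k v).

(** The weight [w] is 1 for norm estimates and a cosine or sine for transforms, so that one Fubini
    argument serves both. *)
Definition kernel w h k (p : R * R) : \bar R := (w p.1 * (h (p.1 - p.2) * k p.2))%:E.

Lemma measurable_kernel w h k : measurable_fun setT w -> L1 h -> L1 k ->
  measurable_fun [set: measurableTypeR R * measurableTypeR R] (kernel w h k).
Proof.
move=> mw /L1_measurable mh /L1_measurable mk.
apply/measurable_EFinP; apply: measurable_funM.
  by apply: (measurableT_comp mw); exact: measurable_fst.
apply: measurable_funM; last by apply: (measurableT_comp mk); exact: measurable_snd.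
apply: (measurableT_comp mh).
apply: (@measurable_funB _ _ R setT fst snd); [exact: measurable_fst|exact: measurable_snd].
Qed.

Lemma integral_abs_kernel h k : L1 h -> L1 k ->
  (\int[mu]_v \int[mu]_u `|kernel (fun=> 1%R) h k (u, v)| = (norm1 h * norm1 k)%:E)%E.
Proof.
move=> L1h L1k; rewrite EFinM (EFin_norm1 L1k).
rewrite -ge0_integralZl //; last 2 first.
- by apply/measurable_EFinP; apply: L1_measurable; exact: L1_abs.
- by rewrite lee_fin norm1_ge0.
apply: eq_integral => v _.
transitivity (\int[mu]_u ((`|k v|)%:E * `|h (u - v)|%:E))%E.
  by apply: eq_integral => u _; rewrite /kernel /= mul1r normrM mulrC EFinM.
rewrite ge0_integralZl //; last first.
  by apply/measurable_EFinP; apply: L1_measurable; apply: L1_abs; exact: L1_shift.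
by rewrite muleC -(EFin_norm1 (L1_shift v L1h)) /norm1 (Rintegral_shift v (L1_abs L1h)).
Qed.

Lemma measurable_fun1 : measurable_fun [set: R] (fun=> 1 : R).
Proof. by []. Qed.

Lemma integrable_kernel w h k : measurable_fun setT w -> (forall u, `|w u| <= 1) ->
  L1 h -> L1 k -> (mu \x mu)%E.-integrable setT (kernel w h k).
Proof.
move=> mw w1 L1h L1k.
have i1 : (mu \x mu)%E.-integrable setT (kernel (fun=> 1) h k).
  apply/(integrable21ltyP mu mu (measurable_kernel measurable_fun1 L1h L1k)).
  by rewrite integral_abs_kernel // ltry.
refine (le_integrable measurableT (measurable_kernel mw L1h L1k) _ i1).
by move=> p _; rewrite /kernel /= lee_fin mul1r [leLHS]normrM ler_piMl.
Qed.

Lemma normr1_le1 (u : R) : `|1 : R| <= 1.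
Proof. by rewrite normr1. Qed.

Lemma conv_fineE h k : conv h k = fine \o fubini_F mu (kernel (fun=> 1) h k).
Proof.
apply/funext => u; rewrite /conv /fubini_F /Rintegral /=; congr fine.
by apply: eq_integral => v _; rewrite /kernel /= mul1r.
Qed.

(** Pulling [w u] out of the inner integral requires the section at [u] to be integrable; by Fubini
    the exceptional [u] form a null set. *)
Lemma ae_conv_kernel w h k : measurable_fun setT w -> (forall u, `|w u| <= 1) ->
  L1 h -> L1 k -> ae_eq mu setT (fun u => (w u * conv h k u)%:E) (fubini_F mu (kernel w h k)).
Proof.
move=> mw w1 L1h L1k.
have /ae_integrable1 := integrable_kernel measurable_fun1 normr1_le1 L1h L1k.
apply: filterS => u iu _; rewrite /fubini_F /kernel /=.

have iu' : mu.-integrable setT (fun v => (h (u - v) * k v)%:E).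
  by apply: eq_integrable iu => // v _; rewrite /kernel /= mul1r.
rewrite EFinM /conv /Rintegral fineK; last exact: integrable_fin_num.
by rewrite -integralZl.
Qed.

Lemma fine_le_abs (x : \bar R) : (`|(fine x)%:E| <= `|x|)%E.
Proof. by case: x => [r| |] /=; rewrite ?normr0 ?leey ?lexx. Qed.

Lemma L1_conv h k : L1 h -> L1 k -> L1 (conv h k).
Proof.
move=> L1h L1k; rewrite /L1 conv_fineE.
have iK := integrable_kernel measurable_fun1 normr1_le1 L1h L1k.
apply: le_integrable (integrable_fubini_F iK) => //.
  apply/measurable_EFinP; apply: measurableT_comp => //.
  exact: measurable_fubini_F iK.
by move=> u _; exact: fine_le_abs.
Qed.

(** Fubini, then a translation by [v] in the inner integral. For [w] a cosine or sine, the addition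
    formula afterwards separates [u] from [v]. *)
Lemma integral_conv w h k : measurable_fun setT w -> (forall u, `|w u| <= 1) ->
  L1 h -> L1 k ->
  \int[mu]_u (w u * conv h k u) = \int[mu]_v (k v * \int[mu]_u (w (u + v) * h u)).
Proof.
move=> mw w1 L1h L1k; rewrite /Rintegral; congr fine.
have iK := integrable_kernel mw w1 L1h L1k.
transitivity (\int[mu]_u fubini_F mu (kernel w h k) u)%E.
  apply: ae_eq_integral => //.
  - apply/measurable_EFinP; apply: measurable_funM => //.
    by apply: L1_measurable; exact: L1_conv.
  - exact: measurable_fubini_F iK.
  - exact: ae_conv_kernel.
rewrite (Fubini iK); apply: eq_integral => v _.
have L1wh : L1 (fun u => w (u + v) * h u).
  apply: L1_bounded_mul => //; apply: (measurableT_comp mw).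
  exact: measurable_funD.
transitivity (\int[mu]_u (k v * (w (u - v + v) * h (u - v))))%:E.
  rewrite /Rintegral fineK; last exact/integrable_fin_num/L1Z/(L1_shift v L1wh).
  by apply: eq_integral => u _; rewrite /kernel /= subrK; congr EFin; ring.
by rewrite (Rintegral_shift v (L1Z (k v) L1wh)) (RintegralZl _ _ L1wh).
Qed.

Lemma norm1_conv h k : L1 h -> L1 k -> norm1 (conv h k) <= norm1 h * norm1 k.
Proof.
move=> L1h L1k; rewrite -lee_fin (EFin_norm1 (L1_conv L1h L1k)).
have iK := integrable_kernel measurable_fun1 normr1_le1 L1h L1k.
rewrite -(integral_abs_kernel L1h L1k).
have mK := measurable_kernel measurable_fun1 L1h L1k.
have maK := measurableT_comp (@abse_measurable R setT) mK.
have aK0 p : (0 <= (abse \o kernel (fun=> 1%R) h k) p)%E by exact: abse_ge0.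
rewrite -[leRHS](@fubini_tonelli _ _ _ _ _ mu mu _ maK aK0).
apply: ge0_le_integral => //.
- by apply/measurable_EFinP; apply: L1_measurable; apply: L1_abs; exact: L1_conv.
- exact: (@measurable_fun_fubini_tonelli_F _ _ _ _ _ mu _ maK aK0).
- move=> u _; rewrite conv_fineE.
  apply: (le_trans (fine_le_abs _)); apply: le_abse_integral => //.
  exact: measurableT_comp (pair1_measurable u).
Qed.

End Convolution.

(** * Completeness of L_1 for absolutely summable series *)

Section Completeness.
Context {R : realType}.
Local Notation mu := (@lebesgue_measure R).

Lemma L1_sum (h : nat -> R -> R) (n : nat) : (forall k, L1 (h k)) ->
  L1 (fun u => \sum_(k < n) h k u).
Proof.
move=> L1h; elim: n => [|n IH].
  by rewrite (_ : (fun=> _) = fun=> 0); [exact: L10|apply/funext => u; rewrite big_ord0].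
rewrite (_ : (fun=> _) = fun u => \sum_(k < n) h k u + h n u); first exact: L1D.
by apply/funext => u; rewrite big_ord_recr.
Qed.

Lemma norm1_sum (h : nat -> R -> R) (n : nat) : (forall k, L1 (h k)) ->
  norm1 (fun u => \sum_(k < n) h k u) <= \sum_(k < n) norm1 (h k).
Proof.
move=> L1h; elim: n => [|n IH].
  rewrite big_ord0 (_ : (fun=> _) = fun=> 0); first by rewrite norm10.
  by apply/funext => u; rewrite big_ord0.
rewrite (_ : (fun=> _) = fun u => \sum_(k < n) h k u + h n u); last first.
  by apply/funext => u; rewrite big_ord_recr.
rewrite big_ord_recr /=; apply: le_trans (norm1D _ _) _ => //; first exact: L1_sum.
by rewrite lerD2r.
Qed.

(** Riesz-Fischer: monotone convergence makes [g], the sum of the absolute values, integrable and so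
    almost everywhere finite; it then dominates all partial sums. *)
Lemma L1_complete (h : nat -> R -> R) (C : R) : (forall n, L1 (h n)) ->
  (forall n, \sum_(k < n) norm1 (h k) <= C) ->
  exists2 H, L1 H &
    norm1 (fun u => \sum_(k < n) h k u - H u) @[n --> \oo] --> (0 : R).
Proof.
move=> L1h hC.
pose S n u := \sum_(k < n) h k u.
pose g u := (\sum_(0 <= k <oo) `|(h k u)%:E|)%E.
(* An upper limit is measurable without any convergence, and equals the limit wherever the series
   converges. *)
pose H u := fine (limn_esup (fun n => (S n u)%:E)).
have mS n : measurable_fun setT (fun u => (S n u)%:E).
  by apply/measurable_EFinP; apply: L1_measurable; exact: L1_sum.
have mabs n : measurable_fun setT (fun u => `|(h n u)%:E|%E).
  by apply: measurableT_comp => //; apply/measurable_EFinP; exact: L1_measurable.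
have ig : mu.-integrable setT g.
  apply/integrableP; split.
    by apply: ge0_emeasurable_sum => [k u _ _|k _]; [exact: abse_ge0|exact: mabs].
  under eq_integral do (rewrite gee0_abs; last exact: nneseries_ge0).
  rewrite integral_nneseries; [|by []|exact: mabs|by move=> n u _; exact: abse_ge0].
  apply: (@le_lt_trans _ _ C%:E); last exact: ltry.
  apply: lime_le; first by apply: is_cvg_nneseries => n _ _; exact: integral_ge0.
  apply: nearW => n; rewrite big_mkord.
  under eq_bigr do rewrite -(EFin_norm1 (L1h _)).
  by rewrite sumEFin lee_fin.
have aecvg : {ae mu, forall u, setT u -> (S n u)%:E @[n --> \oo] --> (H u)%:E}.
  have := integrable_ae measurableT ig.
  apply: filterS => u gfin _.
  have {}gfin := gfin I.
  have cS : cvgn (series (fun k => h k u)).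
    apply: (@normed_cvg _ R^o).
    change (cvgn (series (fun k => `|h k u|))).
    apply: nondecreasing_is_cvgn.
      by apply/nondecreasing_seqP => n; rewrite seriesSr lerDl.
    exists (fine (g u)) => _ [n _ <-]; rewrite -lee_fin fineK // seriesEnat /=.
    rewrite -sumEFin; exact: nneseries_lim_ge.
  have cS' : (S n u)%:E @[n --> \oo] --> (limn (series (fun k => h k u)))%:E.
    apply: cvg_EFin; first exact: nearW.
    by rewrite [X in X @ _ --> _](_ : _ = series (fun k => h k u)) //;
      apply/funext => n; rewrite /series /= big_mkord.
  by rewrite /H (cvg_limn_einf_sup cS').
have mH : measurable_fun setT (EFin \o H).
  apply/measurable_EFinP; apply: measurableT_comp => //.
  exact: measurable_fun_limn_esup.
have dom : {ae mu, forall u n, setT u -> (`|(S n u)%:E| <= g u)%E}.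
  apply: aeW => u n _; apply: le_trans (nneseries_lim_ge n _) => //.
  by rewrite big_mkord sumEFin lee_fin; exact: ler_norm_sum.
have [iH cv _] := @dominated_convergence _ (measurableTypeR R) R mu setT
  measurableT (fun n u => (S n u)%:E) (EFin \o H) g mS mH aecvg ig dom.
exists H; first exact: iH.
exact: (fine_cvg cv).
Qed.

End Completeness.

(** * The Wiener algebra of the line *)

Section ComplexNorm.
Context {R : realType}.
Implicit Types (z w : R[i]) (a b : R).

Lemma complexP z w : complex.Re z = complex.Re w -> complex.Im z = complex.Im w -> z = w.
Proof. by case: z w => [a b] [c d] /= -> ->. Qed.

Lemma ReD z w : complex.Re (z + w) = complex.Re z + complex.Re w.
Proof. by case: z w => [a b] [c d]. Qed.
Lemma ImD z w : complex.Im (z + w) = complex.Im z + complex.Im w.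
Proof. by case: z w => [a b] [c d]. Qed.
Lemma ReN z : complex.Re (- z) = - complex.Re z.
Proof. by case: z. Qed.
Lemma ImN z : complex.Im (- z) = - complex.Im z.
Proof. by case: z. Qed.
Lemma ReM z w : complex.Re (z * w) =
  complex.Re z * complex.Re w - complex.Im z * complex.Im w.
Proof. by case: z w => [a b] [c d]. Qed.
Lemma ImM z w : complex.Im (z * w) =
  complex.Re z * complex.Im w + complex.Im z * complex.Re w.
Proof. by case: z w => [a b] [c d]. Qed.

Definition reim := (ReD, ImD, ReN, ImN, ReM, ImM).

(** The l^1 norm of the coordinates rather than the modulus: it is submultiplicative, and splits
    over real and imaginary parts exactly as the bound in [cwiener] does. *)
Definition cnorm z : R := `|complex.Re z| + `|complex.Im z|.

Lemma cnorm_ge0 z : 0 <= cnorm z.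
Proof. by rewrite addr_ge0. Qed.

Lemma cnorm0 : cnorm 0 = 0.
Proof. by rewrite /cnorm /= normr0 addr0. Qed.

Lemma cnorm1 : cnorm 1 = 1.
Proof. by rewrite /cnorm /= normr0 normr1 addr0. Qed.

Lemma cnorm_real a : cnorm a%:C = `|a|.
Proof. by rewrite /cnorm /= normr0 addr0. Qed.

Lemma cnorm0_eq0 z : cnorm z = 0 -> z = 0.
Proof.
by move/eqP; rewrite paddr_eq0 // !normr_eq0 => /andP[/eqP ? /eqP ?]; exact: complexP.
Qed.

Lemma cnormN z : cnorm (- z) = cnorm z.
Proof. by rewrite /cnorm !reim !normrN. Qed.

Lemma cnormD z w : cnorm (z + w) <= cnorm z + cnorm w.
Proof. by rewrite /cnorm !reim addrACA lerD // ler_normD. Qed.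

Lemma cnormM z w : cnorm (z * w) <= cnorm z * cnorm w.
Proof.
rewrite /cnorm !reim; apply: le_trans (lerD (ler_normB _ _) (ler_normD _ _)) _.
by rewrite !normrM le_eqVlt; apply/orP; left; apply/eqP; ring.
Qed.

Lemma cnorm_i z : cnorm ('i * z) = cnorm z.
Proof.
case: z => a b; rewrite /cnorm !reim /=.
have -> : 0 * a - 1 * b = - b by ring.
have -> : 0 * b + 1 * a = a by ring.
by rewrite normrN addrC.
Qed.

End ComplexNorm.

(** * The transform and the algebra of functions with a bounded representation *)

Section WienerAlgebra.
Context {R : realType}.
Local Notation mu := (@lebesgue_measure R).
Implicit Types (h k : R -> R) (g w : R -> R[i]) (z : R[i]) (a b c r q t u v : R).

Definition hat h t : R[i] :=
  Complex (\int[mu]_u (cos (t * u) * h u)) (\int[mu]_u (sin (t * u) * h u)).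

Lemma measurable_cosM t : measurable_fun setT (fun u : R => cos (t * u)).
Proof.
by apply: measurableT_comp; [apply: continuous_measurable_fun; exact: continuous_cos|].
Qed.

Lemma measurable_sinM t : measurable_fun setT (fun u : R => sin (t * u)).
Proof.
by apply: measurableT_comp; [apply: continuous_measurable_fun; exact: continuous_sin|].
Qed.

Lemma cosM_le1 t u : `|cos (t * u)| <= 1.
Proof. by rewrite ler_norml cos_geN1 cos_le1. Qed.

Lemma sinM_le1 t u : `|sin (t * u)| <= 1.
Proof. by rewrite ler_norml sin_geN1 sin_le1. Qed.

Lemma L1_cosM t h : L1 h -> L1 (fun u => cos (t * u) * h u).
Proof. exact: L1_bounded_mul (measurable_cosM t) (cosM_le1 t). Qed.

Lemma L1_sinM t h : L1 h -> L1 (fun u => sin (t * u) * h u).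
Proof. exact: L1_bounded_mul (measurable_sinM t) (sinM_le1 t). Qed.

Lemma hatD h k t : L1 h -> L1 k -> hat (fun u => h u + k u) t = hat h t + hat k t.
Proof.
move=> L1h L1k; apply: complexP; rewrite reim /= -RintegralD //;
  try exact: L1_cosM; try exact: L1_sinM;
  by apply: eq_Rintegral => u _; rewrite mulrDr.
Qed.

Lemma hatZ a h t : L1 h -> hat (fun u => a * h u) t = a%:C * hat h t.
Proof.
move=> L1h; apply: complexP; rewrite !reim /= mul0r ?subr0 ?addr0 -RintegralZl //;
  try exact: L1_cosM; try exact: L1_sinM;
  by apply: eq_Rintegral => u _; rewrite mulrCA.
Qed.

Lemma hatN h t : L1 h -> hat (fun u => - h u) t = - hat h t.
Proof.
move=> L1h; rewrite -[RHS]mulN1r -(rmorphN1 (real_complex R)) -hatZ //.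
by congr (hat _ t); apply/funext => u; rewrite mulN1r.
Qed.

Lemma hatB h k t : L1 h -> L1 k -> hat (fun u => h u - k u) t = hat h t - hat k t.
Proof. by move=> L1h L1k; rewrite hatD ?hatN //; exact: L1N. Qed.

Lemma hat0 t : hat (fun=> 0) t = 0.
Proof.
rewrite -[RHS](mul0r (hat (fun=> 0) t)) -(hatZ 0 t (@L10 R)).
by congr (hat _ t); apply/funext => u; rewrite mul0r.
Qed.

Lemma hat_conv h k t : L1 h -> L1 k -> hat (conv h k) t = hat h t * hat k t.
Proof.
move=> L1h L1k.
have [L1ch L1sh] := (L1_cosM t L1h, L1_sinM t L1h).
have [L1ck L1sk] := (L1_cosM t L1k, L1_sinM t L1k).
apply: complexP; rewrite reim /=.
- rewrite integral_conv //; [|exact: measurable_cosM|exact: cosM_le1].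
  rewrite -!RintegralZl // -RintegralB; try exact: L1Z; last by [].
  apply: eq_Rintegral => v _.
  have -> : \int[mu]_u (cos (t * (u + v)) * h u) =
      cos (t * v) * \int[mu]_u (cos (t * u) * h u)
      - sin (t * v) * \int[mu]_u (sin (t * u) * h u).
    rewrite -!RintegralZl // -RintegralB; [|by []|exact: L1Z..].
    by apply: eq_Rintegral => u _; rewrite mulrDr cosD; ring.
  ring.
- rewrite integral_conv //; [|exact: measurable_sinM|exact: sinM_le1].
  rewrite -!RintegralZl // -RintegralD; try exact: L1Z; last by [].
  apply: eq_Rintegral => v _.
  have -> : \int[mu]_u (sin (t * (u + v)) * h u) =
      cos (t * v) * \int[mu]_u (sin (t * u) * h u)
      + sin (t * v) * \int[mu]_u (cos (t * u) * h u).
    rewrite -!RintegralZl // -RintegralD; [|by []|exact: L1Z..].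
    by apply: eq_Rintegral => u _; rewrite mulrDr sinD; ring.
  ring.
Qed.

Lemma Re_hat_le h t : L1 h -> `|complex.Re (hat h t)| <= norm1 h.
Proof. exact: Rintegral_bounded_mul (measurable_cosM t) (cosM_le1 t). Qed.

Lemma Im_hat_le h t : L1 h -> `|complex.Im (hat h t)| <= norm1 h.
Proof. exact: Rintegral_bounded_mul (measurable_sinM t) (sinM_le1 t). Qed.

(* [rwiener g r]: [g] is represented by a real constant and a real density of total norm
   at most [r]; [cwiener] allows complex ones. Bounding the norm of some representation
   makes the algebra one of plain functions of [t], with no appeal to the injectivity of
   the Fourier transform. *)
Definition rwiener g r := exists c h,
  [/\ L1 h, forall t, g t = c%:C + hat h t & `|c| + norm1 h <= r].

Definition cwiener g r := exists g1 g2 r1 r2,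
  [/\ rwiener g1 r1, rwiener g2 r2, forall t, g t = g1 t + 'i * g2 t & r1 + r2 <= r].

Lemma rwienerD g g' r r' : rwiener g r -> rwiener g' r' ->
  rwiener (fun t => g t + g' t) (r + r').
Proof.
move=> [c [h [L1h e n]]] [c' [h' [L1h' e' n']]].
exists (c + c'), (fun u => h u + h' u); split; first exact: L1D.
  by move=> t; rewrite e e' hatD // rmorphD addrACA.
have := norm1D L1h L1h'; have := ler_normD c c'; lra.
Qed.

Lemma rwiener_cst c : rwiener (fun=> c%:C) `|c|.
Proof.
exists c, (fun=> 0); split; [exact: L10|by move=> t; rewrite hat0 addr0|].
by rewrite norm10 addr0.
Qed.

Lemma rwiener_ge0 g r : rwiener g r -> 0 <= r.
Proof. by move=> [c [h [_ _]]]; apply: le_trans; rewrite addr_ge0 // norm1_ge0. Qed.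

Lemma rwienerM g g' r r' : rwiener g r -> rwiener g' r' ->
  rwiener (fun t => g t * g' t) (r * r').
Proof.
move=> [c [h [L1h e n]]] [c' [h' [L1h' e' n']]].
have L1c := L1Z c L1h'; have L1c' := L1Z c' L1h; have L1hh := L1_conv L1h L1h'.
exists (c * c'), (fun u => c * h' u + c' * h u + conv h h' u); split.
- by do 2 apply: L1D => //.
- move=> t; rewrite e e' (hatD _ (L1D _ _)) // (hatD _ L1c) // !hatZ // hat_conv //.
  by rewrite rmorphM; ring.
- have := norm1D (L1D L1c L1c') L1hh; have := norm1D L1c L1c'.
  have := norm1_conv L1h L1h'; rewrite !norm1Z // normrM => n1 n2 n3.
  have n4 : (`|c| + norm1 h) * (`|c'| + norm1 h') <= r * r'.
    by apply: ler_pM => //; rewrite addr_ge0 // norm1_ge0.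
  by nra.
Qed.

Lemma rwienerN g r : rwiener g r -> rwiener (fun t => - g t) r.
Proof.
move=> Wg; have := rwienerM (rwiener_cst (-1)) Wg; rewrite normrN normr1 mul1r.
by congr rwiener; apply/funext => t; rewrite rmorphN mulN1r.
Qed.

Lemma rwiener_Re_le g r t : rwiener g r -> `|complex.Re (g t)| <= r.
Proof.
move=> [c [h [L1h -> n]]]; rewrite ReD /=.
have := ler_normD c (complex.Re (hat h t)); have := Re_hat_le t L1h.
by move=> /=; lra.
Qed.

Lemma rwiener_Im_le g r t : rwiener g r -> `|complex.Im (g t)| <= r.
Proof.
move=> [c [h [L1h -> n]]]; rewrite ImD /= add0r.
by have := normr_ge0 c; have := Im_hat_le t L1h; move=> /=; lra.
Qed.

Lemma rwiener_bound g r t : rwiener g r -> cnorm (g t) <= 2 * r.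
Proof.
by move=> Wg; have := rwiener_Re_le t Wg; have := rwiener_Im_le t Wg; rewrite /cnorm; lra.
Qed.

(** Completeness in the form that Neumann series need. Representing data are chosen for each term;
    the constants are summed in [R], the densities in L_1, and the transform is continuous in
    both. *)
Lemma rwiener_series (g : nat -> R -> R[i]) (r : nat -> R) C :
  (forall n, rwiener (g n) (r n)) -> (forall n, \sum_(k < n) r k <= C) ->
  exists2 G, rwiener G C &
    forall t, cnorm (\sum_(k < n) g k t - G t) @[n --> \oo] --> (0 : R).
Proof.
move=> Wg rC.
have /choice[ch chP] : forall n, exists p : R * (R -> R), [/\ L1 p.2,
    forall t, g n t = p.1%:C + hat p.2 t & `|p.1| + norm1 p.2 <= r n].
  by move=> n; have [c [h hP]] := Wg n; exists (c, h).
pose c n := (ch n).1; pose h n := (ch n).2.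
have L1h n : L1 (h n) by case: (chP n).
have chC n : \sum_(k < n) `|c k| + \sum_(k < n) norm1 (h k) <= C.
  rewrite -big_split; apply: le_trans (rC n); apply: ler_sum => k _.
  by case: (chP k).
have cC n : \sum_(k < n) `|c k| <= C.
  by apply: le_trans (chC n); rewrite lerDl sumr_ge0 // => k _; exact: norm1_ge0.
have hC n : \sum_(k < n) norm1 (h k) <= C.
  by apply: le_trans (chC n); rewrite lerDr sumr_ge0.
have [H L1H cvH] := L1_complete L1h hC.
have ccv : cvgn (series c).
  apply: (@normed_cvg _ R^o).
  change (cvgn (series (fun k : nat => `|c k|))).
  apply: nondecreasing_is_cvgn.
    by apply/nondecreasing_seqP => n; rewrite seriesSr lerDl.
  by exists C => _ [n _ <-]; rewrite seriesEord; exact: cC.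
pose c0 := limn (series c).
have cvc : `|series c n - c0| @[n --> \oo] --> (0 : R).
  by rewrite -(normr0 R); apply: cvg_norm; apply/subr_cvg0.
pose d n := norm1 (fun u => \sum_(k < n) h k u - H u).
have L1S n := L1_sum n L1h.
have d0 : (`|series c n - c0| + 2 * d n) @[n --> \oo] --> (0 : R).
  rewrite -[0 in X in _ --> X](addr0 0) -[X in 0 + X](mulr0 2).
  by apply: cvgD => //; apply: cvgMl_tmp.
exists (fun t => c0%:C + hat H t).
  (* The excess of the limiting norm over [C] is at most the vanishing error at every [n], hence not
     positive. *)
  exists c0, H; split => //; rewrite -subr_le0.
  apply: (@cvgr_to_ge _ _ _ _ _ _ _ d0); apply: nearW => n.
  have n1 : norm1 H <= norm1 (fun u => \sum_(k < n) h k u) + d n.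
    rewrite /d -(norm1N (fun u => \sum_(k < n) h k u - H u)).
    apply: le_trans (norm1D (L1S n) (L1N (L1B (L1S n) L1H))).
    rewrite le_eqVlt; apply/orP; left; apply/eqP; congr norm1.
    by apply/funext => u; ring.
  have c1 : `|c0| <= \sum_(k < n) `|c k| + `|series c n - c0|.
    have := ler_norm_sum (index_enum 'I_n) (fun k : 'I_n => c k) xpredT.
    have -> : c0 = series c n - (series c n - c0) by ring.
    have := ler_normB (series c n) (series c n - c0).
    rewrite (_ : series c n - (series c n - (series c n - c0)) = series c n - c0);
      last by ring.
    rewrite seriesEord; lra.
  by have := norm1_sum n L1h; have := chC n; have := norm1_ge0 (fun u => \sum_(k < n) h k u - H u);
    rewrite -/(d n); lra.
move=> t; apply: squeeze_cvgr d0; last exact: cvg_cst.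
apply: nearW => n; rewrite cnorm_ge0 /=.
have -> : \sum_(k < n) g k t = (series c n)%:C + hat (fun u => \sum_(k < n) h k u) t.
  rewrite (_ : series c n = \sum_(k < n) c k); last by rewrite seriesEord.
  elim: n => [|n IH].
    have -> : (fun u => \sum_(k < 0) h k u) = fun=> 0.
      by apply/funext => u; rewrite big_ord0.
    by rewrite !big_ord0 hat0 addr0.
  rewrite !big_ord_recr /= IH (_ : hat (fun u => \sum_(k < n.+1) h k u) t =
    hat (fun u => \sum_(k < n) h k u) t + hat (h n) t).
    by have [_ -> _] := chP n; rewrite rmorphD /=; ring.
  rewrite -hatD //; congr (hat _ t).
  by apply/funext => u; rewrite big_ord_recr.
have -> : (series c n)%:C + hat (fun u => \sum_(k < n) h k u) t - (c0%:C + hat H t)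
  = (series c n - c0)%:C + hat (fun u => \sum_(k < n) h k u - H u) t.
  by rewrite rmorphB /= hatB; [ring|exact: L1S|exact: L1H].
apply: le_trans (cnormD _ _) _; rewrite cnorm_real lerD2l.
have := Re_hat_le t (L1B (L1S n) L1H); have := Im_hat_le t (L1B (L1S n) L1H).
by rewrite /cnorm -/(d n); lra.
Qed.

Lemma cwiener_le g r r' : cwiener g r -> r <= r' -> cwiener g r'.
Proof.
by move=> [g1 [g2 [r1 [r2 [? ? ? /le_trans le]]]]] /le ?; exists g1, g2, r1, r2.
Qed.

Lemma cwiener_ge0 g r : cwiener g r -> 0 <= r.
Proof.
move=> [g1 [g2 [r1 [r2 [/rwiener_ge0 ? /rwiener_ge0 ? _]]]]]; apply: le_trans.
exact: addr_ge0.
Qed.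

Lemma cwienerD g g' r r' : cwiener g r -> cwiener g' r' ->
  cwiener (fun t => g t + g' t) (r + r').
Proof.
move=> [g1 [g2 [r1 [r2 [W1 W2 e n]]]]] [g1' [g2' [r1' [r2' [W1' W2' e' n']]]]].
exists (fun t => g1 t + g1' t), (fun t => g2 t + g2' t), (r1 + r1'), (r2 + r2').
split; [exact: rwienerD..| |by lra].
by move=> t; rewrite e e'; ring.
Qed.

Lemma cwienerM g g' r r' : cwiener g r -> cwiener g' r' ->
  cwiener (fun t => g t * g' t) (r * r').
Proof.
move=> [g1 [g2 [r1 [r2 [W1 W2 e n]]]]] [g1' [g2' [r1' [r2' [W1' W2' e' n']]]]].
exists (fun t => g1 t * g1' t + - (g2 t * g2' t)), (fun t => g1 t * g2' t + g2 t * g1' t).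
exists (r1 * r1' + r2 * r2'), (r1 * r2' + r2 * r1'); split.
- by apply: rwienerD; [|apply: rwienerN]; exact: rwienerM.
- by apply: rwienerD; exact: rwienerM.
- move=> t; rewrite e e'.
  have ii : 'i * 'i = -1 :> R[i] by apply: complexP; rewrite reim /=; ring.
  have -> : (g1 t + 'i * g2 t) * (g1' t + 'i * g2' t) =
    g1 t * g1' t + ('i * 'i) * (g2 t * g2' t) + 'i * (g1 t * g2' t + g2 t * g1' t) by ring.
  by rewrite ii mulN1r.
- have := rwiener_ge0 W1; have := rwiener_ge0 W2.
  have := rwiener_ge0 W1'; have := rwiener_ge0 W2' => ? ? ? ?.
  have n4 : (r1 + r2) * (r1' + r2') <= r * r' by apply: ler_pM => //; exact: addr_ge0.
  by nra.
Qed.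

Lemma cwiener_cst z : cwiener (fun=> z) (cnorm z).
Proof.
case: z => a b; exists (fun=> a%:C), (fun=> b%:C), `|a|, `|b|; split => //.
- exact: rwiener_cst.
- exact: rwiener_cst.
- by move=> t; apply: complexP; rewrite !reim /=; ring.
Qed.

Lemma cwiener_ext g g' r : cwiener g r -> g =1 g' -> cwiener g' r.
Proof. by move=> Wg /funext <-. Qed.

Lemma cwienerZ z g r : cwiener g r -> cwiener (fun t => z * g t) (cnorm z * r).
Proof. exact: cwienerM (cwiener_cst z). Qed.

Lemma cwienerN g r : cwiener g r -> cwiener (fun t => - g t) r.
Proof.
move=> /(cwienerZ (-1)); rewrite cnormN cnorm1 mul1r => /cwiener_ext; apply => t.
by rewrite mulN1r.
Qed.

Lemma cwienerX g r n : cwiener g r -> cwiener (fun t => g t ^+ n) (r ^+ n).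
Proof.
move=> Wg; elim: n => [|n IH].
  by have := cwiener_cst 1; rewrite cnorm1 expr0.
by rewrite exprS; apply: cwiener_ext (cwienerM Wg IH) _ => t; rewrite exprS.
Qed.

Lemma cwiener_bound g r t : cwiener g r -> cnorm (g t) <= 2 * r.
Proof.
move=> [g1 [g2 [r1 [r2 [/(rwiener_bound t) W1 /(rwiener_bound t) W2 -> n]]]]].
apply: le_trans (cnormD _ _) _.
by rewrite cnorm_i; lra.
Qed.

(** Bounding the two halves by [C] separately would lose a factor 2. Each is bounded by its own
    total mass, and the two masses add up to at most [C]. *)
Lemma cwiener_series (g : nat -> R -> R[i]) (r : nat -> R) C :
  (forall n, cwiener (g n) (r n)) -> (forall n, \sum_(k < n) r k <= C) ->
  exists2 G, cwiener G C &
    forall t, cnorm (\sum_(k < n) g k t - G t) @[n --> \oo] --> (0 : R).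
Proof.
move=> Wg rC.
have /choice[p pP] : forall n, exists p : (R -> R[i]) * (R -> R[i]) * (R * R),
    [/\ rwiener p.1.1 p.2.1, rwiener p.1.2 p.2.2,
        forall t, g n t = p.1.1 t + 'i * p.1.2 t & p.2.1 + p.2.2 <= r n].
  by move=> n; have [g1 [g2 [r1 [r2 P]]]] := Wg n; exists (g1, g2, (r1, r2)).
pose r1 n := (p n).2.1; pose r2 n := (p n).2.2.
have W1 n : rwiener (p n).1.1 (r1 n) by case: (pP n).
have W2 n : rwiener (p n).1.2 (r2 n) by case: (pP n).
have cvr (r' : nat -> R) : (forall n, 0 <= r' n) ->
    (forall n, \sum_(k < n) r' k <= C) -> cvgn (series r') /\
    forall n, \sum_(k < n) r' k <= limn (series r').
  move=> r0 r'C; have nd : nondecreasing_seq (series r').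
    by apply/nondecreasing_seqP => n; rewrite seriesSr lerDl.
  have cv : cvgn (series r').
    by apply: nondecreasing_is_cvgn => //; exists C => _ [n _ <-]; rewrite seriesEord; exact: r'C.
  by split=> // n; have := nondecreasing_cvgn_le nd cv n; rewrite {1}seriesEord.
have r12C n : \sum_(k < n) r1 k + \sum_(k < n) r2 k <= C.
  by rewrite -big_split; apply: le_trans (rC n); apply: ler_sum => k _; case: (pP k).
have r10 n := rwiener_ge0 (W1 n); have r20 n := rwiener_ge0 (W2 n).
have [cv1 le1] : cvgn (series r1) /\ forall n, \sum_(k < n) r1 k <= limn (series r1).
  by apply: cvr => // n; apply: le_trans (r12C n); rewrite lerDl sumr_ge0.
have [cv2 le2] : cvgn (series r2) /\ forall n, \sum_(k < n) r2 k <= limn (series r2).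
  by apply: cvr => // n; apply: le_trans (r12C n); rewrite lerDr sumr_ge0.
have [G1 WG1 cvG1] := rwiener_series W1 le1.
have [G2 WG2 cvG2] := rwiener_series W2 le2.
exists (fun t => G1 t + 'i * G2 t).
  exists G1, G2, (limn (series r1)), (limn (series r2)); split => //.
  rewrite -limD //; apply: limr_le; first exact: is_cvgD.
  by apply: nearW => n; rewrite fctE !seriesEord; exact: r12C.
move=> t.
have cv0 : cnorm (\sum_(k < n) (p k).1.1 t - G1 t) +
    cnorm (\sum_(k < n) (p k).1.2 t - G2 t) @[n --> \oo] --> (0 : R).
  by rewrite -[0 in X in _ --> X](addr0 0); apply: cvgD.
apply: squeeze_cvgr cv0; last exact: cvg_cst.
apply: nearW => n; rewrite cnorm_ge0 /=.
have -> : \sum_(k < n) g k t - (G1 t + 'i * G2 t) =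
   (\sum_(k < n) (p k).1.1 t - G1 t) + 'i * (\sum_(k < n) (p k).1.2 t - G2 t).
  have -> : \sum_(k < n) g k t =
      \sum_(k < n) (p k).1.1 t + 'i * \sum_(k < n) (p k).1.2 t.
    by rewrite mulr_sumr -big_split; apply: eq_bigr => k _; case: (pP k).
  by ring.
by apply: le_trans (cnormD _ _) _; rewrite lerD2l cnorm_i.
Qed.

End WienerAlgebra.

(** * A spectral radius bound *)

Section Spectral.
Context {R : realType}.
Implicit Types (g w x y : R -> R[i]) (z v : R[i]) (q r s t : R).

Lemma cvg0_ge (f : nat -> R) (a : R) : f n @[n --> \oo] --> (0 : R) ->
  (forall n, a <= f n) -> a <= 0.
Proof. by move=> f0 af; apply: (@cvgr_to_ge _ _ _ _ _ _ _ f0); exact: nearW. Qed.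

Lemma cvg_exprn0 q : 0 <= q < 1 -> q ^+ n @[n --> \oo] --> (0 : R).
Proof. by move=> /andP[q0 q1]; apply: cvg_expr; rewrite ger0_norm. Qed.

(** The norm controls values only up to a factor 2, so [q < 1] does not bound [w t] by 1 at once.
    Powers absorb the factor: [w t = 1] would give 1 <= 2 q^n for all n. *)
Lemma neumann_neq0 w q t : q < 1 -> cwiener w q -> 1 - w t != 0.
Proof.
move=> q1 Ww; have q01 : 0 <= q < 1 by rewrite (cwiener_ge0 Ww).
rewrite subr_eq0; apply/eqP => e.
have : (1 : R) <= 0.
  apply: (@cvg0_ge (fun n => 2 * q ^+ n)).
    by rewrite -[X in _ --> X](mulr0 2); apply: cvgMl_tmp; exact: cvg_exprn0.
  move=> n; have := cwiener_bound t (cwienerX n Ww).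
  by rewrite -e expr1n cnorm1.
by rewrite ler10.
Qed.

Lemma neumann w q : q < 1 -> cwiener w q ->
  cwiener (fun t => (1 - w t)^-1) (1 - q)^-1.
Proof.
move=> q1 Ww; have q0 := cwiener_ge0 Ww.
have q1' : 0 < 1 - q by rewrite subr_gt0.
have [n|G WG cvG] := @cwiener_series _ (fun n t => w t ^+ n) (fun n => q ^+ n)
    (1 - q)^-1 (fun n => cwienerX n Ww).
  rewrite -[leRHS]mul1r ler_pdivlMr // mulrC -opprB mulNr -subrX1 opprB gerBl.
  exact: exprn_ge0.
apply: cwiener_ext WG _ => t; apply: (mulIf (neumann_neq0 t q1 Ww)).
rewrite mulVf; last exact: neumann_neq0 q1 Ww.
apply/eqP; rewrite -subr_eq0; apply/eqP; apply: cnorm0_eq0.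
apply/eqP; rewrite eq_le cnorm_ge0 andbT.
apply: (@cvg0_ge (fun n => cnorm (\sum_(k < n) w t ^+ k - G t) * cnorm (1 - w t)
   + 2 * q ^+ n)).
  rewrite [X in _ --> X](_ : _ = 0 * cnorm (1 - w t) + 2 * 0); last by ring.
  apply: cvgD; first exact: cvgMr_tmp.
  by apply: cvgMl_tmp; apply: cvg_exprn0; rewrite q0.
move=> n; have -> : G t * (1 - w t) - 1 =
    - ((\sum_(k < n) w t ^+ k - G t) * (1 - w t)) + - (w t ^+ n).
  have := subrX1 (w t) n; set S := \sum_(k < n) _ => e.
  by rewrite -[w t ^+ n](subrK 1) e; ring.
apply: le_trans (cnormD _ _) _; rewrite !cnormN; apply: lerD; first exact: cnormM.
exact: cwiener_bound (cwienerX n Ww).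
Qed.

(** The squared modulus: exactly multiplicative, hence suited to discs and powers, where [cnorm] is
    only submultiplicative. *)
Definition sqnorm z : R := complex.Re z ^+ 2 + complex.Im z ^+ 2.

Lemma sqnormM z v : sqnorm (z * v) = sqnorm z * sqnorm v.
Proof. by rewrite /sqnorm !reim; ring. Qed.

Lemma sqnormN z : sqnorm (- z) = sqnorm z.
Proof. by rewrite /sqnorm !reim !sqrrN. Qed.

Lemma sqnorm_ge0 z : 0 <= sqnorm z.
Proof. by rewrite addr_ge0 // sqr_ge0. Qed.

Lemma sqnorm1 : sqnorm 1 = 1.
Proof. by rewrite /sqnorm /= expr0n addr0 expr1n. Qed.

Lemma sqnormX z n : sqnorm (z ^+ n) = sqnorm z ^+ n.
Proof. by elim: n => [|n IH]; rewrite ?sqnorm1 // !exprS sqnormM IH. Qed.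

Lemma sqnorm_lt1_neq z : sqnorm z < 1 -> 1 - z != 0.
Proof.
by move=> z1; rewrite subr_eq0; apply: contraTneq z1 => <-; rewrite sqnorm1 ltxx.
Qed.

Lemma sqnorm_real s : sqnorm s%:C = s ^+ 2.
Proof. by rewrite /sqnorm /= expr0n addr0. Qed.

Lemma cnorm_le2 z : sqnorm z <= 1 -> cnorm z <= 2.
Proof.
rewrite /sqnorm /cnorm => z1.
have := sqr_ge0 (complex.Re z); have := sqr_ge0 (complex.Im z) => ? ?.
have a1 : `|complex.Re z| <= 1 by rewrite -sqrtr_sqr -[leRHS]sqrtr1 ler_wsqrtr; lra.
have b1 : `|complex.Im z| <= 1 by rewrite -sqrtr_sqr -[leRHS]sqrtr1 ler_wsqrtr; lra.
lra.
Qed.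

Lemma sqr_root_disc z : sqnorm z <= 1 -> exists2 v, v ^+ 2 = z & sqnorm v <= 1.
Proof.
move=> z1; exists (sqrtc z); first exact: sqr_sqrtc.
have : sqnorm (sqrtc z) ^+ 2 <= 1 by rewrite -sqnormX sqr_sqrtc.
by rewrite expr_le1 // sqnorm_ge0.
Qed.

Lemma square_average v (a : R[i]) : 1 - v * a != 0 -> 1 + v * a != 0 ->
  (1 - v ^+ 2 * (a ^+ 2))^-1 = 2^-1 * ((1 - v * a)^-1 + (1 - (- v) * a)^-1).
Proof.
move=> n1 n2; rewrite mulNr opprK.
have -> : 1 - v ^+ 2 * a ^+ 2 = (1 - v * a) * (1 + v * a) by ring.
by field; rewrite n1 n2.
Qed.

Lemma cnorm_half : cnorm (2^-1 : R[i]) = 2^-1.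
Proof.
rewrite (_ : 2^-1 = (2^-1 : R)%:C); first by rewrite cnorm_real ger0_norm // invr_ge0.
by rewrite fmorphV rmorphMn rmorph1.
Qed.

(** * From resolvents on a square to a power of small norm *)

Section Resolvent.
Variables (x : R -> R[i]) (N : R).
Hypothesis Wx : cwiener x N.
Hypothesis x_small : forall t, sqnorm (x t) < 2^-1.
Hypothesis resolvent : forall z, `|complex.Re z| <= 1 -> `|complex.Im z| <= 1 ->
  exists M, cwiener (fun t => (1 - z * x t)^-1) M.

(** On the square |z|^2 is at most 2; this dictates the bound 1/2 in [x_small]. The square contains
    the unit disc, where [v] lives below, and is compact as a product of intervals. *)
Lemma resolvent_neq0 z t : `|complex.Re z| <= 1 -> `|complex.Im z| <= 1 -> 1 - z * x t != 0.
Proof.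
move=> z1 z2; apply: sqnorm_lt1_neq; rewrite sqnormM.
have : sqnorm z <= 2.
  have : `|complex.Re z| ^+ 2 <= 1 by rewrite expr_le1.
  have : `|complex.Im z| ^+ 2 <= 1 by rewrite expr_le1.
  by rewrite /sqnorm !real_normK ?num_real //; lra.
have := x_small t; have := sqnorm_ge0 (x t); have := sqnorm_ge0 z; nra.
Qed.

(** Factor 1 - v x = (1 - z x) (1 - w) with w = (v - z) x / (1 - z x). The norm of w is at most 1/2,
    so a Neumann series inverts the second factor at the cost of a factor 2. *)
Lemma resolvent_near z M (v : R[i]) : `|complex.Re z| <= 1 -> `|complex.Im z| <= 1 ->
  cwiener (fun t => (1 - z * x t)^-1) M -> cnorm (v - z) * (N * M) <= 2^-1 ->
  cwiener (fun t => (1 - v * x t)^-1) (2 * M).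
Proof.
move=> z1 z2 WM small.
have W1 := cwiener_le (cwienerZ (v - z) (cwienerM Wx WM)) small.
have half1 : (2^-1 : R) < 1 by lra.
have W2 := cwienerM WM (neumann half1 W1).
rewrite (_ : 2 * M = M * (1 - 2^-1)^-1); last by field.
apply: cwiener_ext W2 _ => t; have n1 := neumann_neq0 t half1 W1.
have n2 := resolvent_neq0 t z1 z2.
rewrite -invfM; congr (_^-1); rewrite mulrBr mulr1.
rewrite (_ : (1 - z * x t) * _ = (v - z) * x t * ((1 - z * x t) / (1 - z * x t))); last by ring.
by rewrite divff //; ring.
Qed.

Lemma resolvent_bounded : exists M, forall z,
  `|complex.Re z| <= 1 -> `|complex.Im z| <= 1 -> cwiener (fun t => (1 - z * x t)^-1) M.
Proof.
pose K : set (R * R) := `[-1, 1] `*` `[-1, 1].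
have cK : compact K by apply: compact_setX; exact: segment_compact.
have inK (p : R * R) : K p <-> `|p.1| <= 1 /\ `|p.2| <= 1.
  by rewrite /K /setX /= !in_itv /= !ler_norml.
(* With the bound tending to +oo as the auxiliary filter, near-covering compactness turns local
   bounds into a common one. *)
have /compact_near_coveringP /(_ R (pinfty_nbhs R)
  (fun M p => cwiener (fun t => (1 - (Complex p.1 p.2) * x t)^-1) M) _) := cK.
case.
- move=> p /inK[p1 p2]; have [M WM] := @resolvent (Complex p.1 p.2) p1 p2.
  have NM0 : 0 <= N * M by rewrite mulr_ge0 // ?(cwiener_ge0 Wx) ?(cwiener_ge0 WM).
  (* Within [d] in each coordinate, [cnorm] of the difference is at most 2 d, and 2 d N M <= 1/2;
     the added 1 covers N M = 0. *)
  pose d := (4 * (N * M + 1))^-1.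
  have d0 : 0 < d by rewrite invr_gt0; lra.
  exists (ball p d, [set M' | 2 * M < M']) => /=.
    by split; [exact: nbhsx_ballx|exists (2 * M); split => //; exact: num_real].
  move=> [q M'] /= [[q1 q2] M'M].
  apply: cwiener_le (ltW M'M).
  apply: (@resolvent_near (Complex p.1 p.2) M (Complex q.1 q.2) p1 p2 WM).
  apply: (@le_trans _ _ ((2 * d) * (N * M))).
    apply: ler_wpM2r => //; rewrite /cnorm !reim /= -opprB normrN -[X in _ + X]normrN opprB.
    have : `|p.1 - q.1| < d := q1; have : `|p.2 - q.2| < d := q2.
    lra.
  rewrite (_ : 2 * d * (N * M) = 2^-1 * ((N * M) / (N * M + 1))); last first.
    by rewrite /d; field; lra.
  rewrite -[leRHS]mulr1 ler_pM2l ?invr_gt0 // ler_pdivrMr; lra.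
- move=> M0 [_ KM]; exists (M0 + 1) => z z1 z2.
  have := KM (M0 + 1); rewrite ltrDl ltr01 => /(_ isT (complex.Re z, complex.Im z)).
  by case: z z1 z2 => a b z1 z2; apply; apply/inK.
Qed.

Let scaled s m t := (s%:C * x t) ^+ (2 ^ m)%N.

Lemma scaled_small s m t : 0 <= s <= 1 -> sqnorm (scaled s m t) < 1.
Proof.
move=> /andP[s0 s1]; rewrite /scaled sqnormX sqnormM sqnorm_real.
have h1 : s ^+ 2 <= 1 by rewrite expr_le1.
have := x_small t; have := sqnorm_ge0 (x t); have := sqr_ge0 s => h2 h3 h4.
by rewrite exprn_ilt1 ?expn_eq0 //; nra.
Qed.

Lemma scaled_neq0 v s m t : sqnorm v <= 1 -> 0 <= s <= 1 -> 1 - v * scaled s m t != 0.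
Proof.
move=> v1 s01; apply: sqnorm_lt1_neq; rewrite sqnormM.
have := scaled_small m t s01; have := sqnorm_ge0 (scaled s m t).
have := sqnorm_ge0 v; nra.
Qed.

Lemma scaledS s m t : scaled s m.+1 t = scaled s m t ^+ 2.
Proof. by rewrite /scaled expnS mulnC exprM. Qed.

Lemma scaled_average v s m t : sqnorm v <= 1 -> 0 <= s <= 1 ->
  (1 - v ^+ 2 * scaled s m.+1 t)^-1 =
  2^-1 * ((1 - v * scaled s m t)^-1 + (1 - (- v) * scaled s m t)^-1).
Proof.
move=> v1 s01; rewrite scaledS square_average //; first exact: scaled_neq0.
by rewrite -[v]opprK mulNr; apply: scaled_neq0; rewrite ?sqnormN.
Qed.

Section Lipschitz.
Variables M : R.
Hypothesis WM : forall z, `|complex.Re z| <= 1 -> `|complex.Im z| <= 1 ->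
  cwiener (fun t => (1 - z * x t)^-1) M.

(* Averaging over the two square roots of [v] carries the estimate from [x ^+ n] to
   [x ^+ (2 * n)] without loss. *)
Lemma scaled_lipschitz m : forall v r s, sqnorm v <= 1 -> 0 <= r <= 1 -> 0 <= s <= 1 ->
  cwiener (fun t => (1 - v * scaled r m t)^-1 - (1 - v * scaled s m t)^-1)
    (2 * `|r - s| * (N * (M * M))).
Proof.
elim: m => [|m IH] v r s v1 r01 s01.
  have coord s' : 0 <= s' <= 1 ->
      cwiener (fun t => (1 - v * scaled s' 0 t)^-1) M.
    move=> /andP[s0 s1].
    have W : cwiener (fun t => (1 - (v * s'%:C) * x t)^-1) M.
      have small (a : R) : a ^+ 2 <= sqnorm v -> `|a * s'| <= 1.
        move=> av; rewrite normrM (ger0_norm s0).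
        have : `|a| <= 1 by rewrite -sqrtr_sqr -[leRHS]sqrtr1 ler_wsqrtr; lra.
        by have := normr_ge0 a; nra.
      apply: WM; rewrite !reim /= mulr0 ?subr0 ?add0r; apply: small;
        rewrite /sqnorm ?lerDl ?lerDr sqr_ge0 //.
    by apply: cwiener_ext W _ => t; rewrite /scaled expr1 mulrA.
  (* Resolvent identity: the difference is v (r - s) x times both resolvents. The factor 2 bounds
     [cnorm v] on the unit disc. *)
  have W := cwienerZ (v * (r - s)%:C) (cwienerM Wx (cwienerM (coord r r01) (coord s s01))).
  apply: cwiener_le (cwiener_ext W _) _.
    move=> t; have := scaled_neq0 0 t v1 r01; have := scaled_neq0 0 t v1 s01.
    rewrite /scaled !expr1 rmorphB /= => n1 n2; field; rewrite n1 n2 //.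
  apply: ler_wpM2r.
    by rewrite !mulr_ge0 ?(cwiener_ge0 Wx) ?(cwiener_ge0 (coord r r01)).
  apply: le_trans (cnormM _ _) _; rewrite cnorm_real ler_wpM2r //; exact: cnorm_le2.
have [w <- w1] := sqr_root_disc v1.
have w1' : sqnorm (- w) <= 1 by rewrite sqnormN.
have W := cwienerZ 2^-1 (cwienerD (IH _ _ _ w1 r01 s01) (IH _ _ _ w1' r01 s01)).
apply: cwiener_le (cwiener_ext W _) _.
  by move=> t; rewrite !scaled_average //; ring.
by rewrite cnorm_half; lra.
Qed.

(** The constants close a loop. If a has norm 1/5, then 1 / (1 - a) is within (1/5) / (1 - 1/5) =
    1/4 of 1. The move from [r] to [s] adds 1/12, giving 1/3; undoing the inversion bounds the new
    element by (1/3) / (1 - 1/3) = 1/2. Its fourth power, hence [m.+2], has norm 1/16, again below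
    1/5. *)
Lemma scaled_step r s m : 0 <= r <= 1 -> 0 <= s <= 1 ->
  2 * `|r - s| * (N * (M * M)) <= 12^-1 ->
  cwiener (scaled r m) 5^-1 -> cwiener (scaled s m.+2) 5^-1.
Proof.
move=> r01 s01 rs Wr.
have sq1 : sqnorm 1 <= 1 :> R by rewrite sqnorm1.
have fifth : (5^-1 : R) < 1 by lra.
have W1 := cwienerM Wr (neumann fifth Wr).
have W2 := cwiener_le (scaled_lipschitz m sq1 s01 r01) _.
rewrite distrC in W2; have {}W2 := W2 _ rs.
have W3 : cwiener (fun t => 1 - (1 - scaled s m t)^-1) 3^-1.
  apply: cwiener_le (cwiener_ext (cwienerN (cwienerD W1 W2)) _) _.
    move=> t; have := scaled_neq0 m t sq1 r01; rewrite !mul1r => n1.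
    rewrite (_ : scaled r m t * (1 - scaled r m t)^-1 = (1 - scaled r m t)^-1 - 1).
      by ring.
    by field.
  by rewrite (_ : (1 - 5^-1)^-1 = 5 / 4); [lra|field].
have third : (3^-1 : R) < 1 by lra.
have W4 := cwienerN (cwienerM W3 (neumann third W3)).
have W5 : cwiener (scaled s m) 2^-1.
  apply: cwiener_le (cwiener_ext W4 _) _; last first.
    by rewrite (_ : (1 - 3^-1)^-1 = 3 / 2); [lra|field].
  move=> t; have := scaled_neq0 m t sq1 s01; rewrite !mul1r => n1.
  rewrite opprB addrCA subrr addr0 invrK.
  by field.
apply: cwiener_le (cwiener_ext (cwienerX 4 W5) _) _; last by lra.
by move=> t; rewrite !scaledS -exprM.
Qed.

End Lipschitz.

(* The Lipschitz estimate is uniform in [m], so the parameter moves from [0] to [1] in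
   finitely many equal steps, each keeping some power [2 ^ m] small. *)
Lemma power_small : exists m, cwiener (fun t => x t ^+ (2 ^ m)%N) 5^-1.
Proof.
have [M WM] := resolvent_bounded.
have M0 : 0 <= M by apply: cwiener_ge0 (WM 0 _ _); rewrite normr0.
have N0 := cwiener_ge0 Wx.
(* A step of length 1 / n with n > B keeps 2 (1 / n) N M^2 below the 1/12 allowed by
   [scaled_step]. *)
pose B := 24 * (N * (M * M)).
have B0 : 0 <= B by rewrite !mulr_ge0.
pose n := (Num.truncn B).+1.
have nB : B < n%:R by rewrite /n truncnS_gt.
have n0 : 0 < n%:R :> R by rewrite ltr0n.
have step k : (k <= n)%N -> exists m, cwiener (scaled (k%:R / n%:R) m) 5^-1.
  elim: k => [_|k IH kn].
    exists 0%N; have := @cwiener_cst R 0; rewrite cnorm0 => /cwiener_le W.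
    apply: cwiener_ext (W 5^-1 _) _; first by rewrite invr_ge0.
    by move=> t; rewrite /scaled !mul0r expr1.
  have [m Wm] := IH (ltnW kn); exists m.+2.
  have k01 j : (j <= n)%N -> 0 <= (j%:R / n%:R : R) <= 1.
    by move=> jn; rewrite divr_ge0 //= ler_pdivrMr // mul1r ler_nat.
  apply: (scaled_step WM (k01 _ (ltnW kn)) (k01 _ kn)) Wm.
  rewrite -mulrBl -[k.+1]addn1 natrD opprD addrA subrr sub0r mulNr mul1r normrN.
  rewrite ger0_norm ?invr_ge0 ?ler0n // mulrAC ler_pdivrMr //.
  by move: nB; rewrite /B; lra.
have [m Wm] := step n (leqnn n); exists m.
apply: cwiener_ext Wm _ => t; by rewrite /scaled divff ?gt_eqF // mul1r.
Qed.

End Resolvent.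
End Spectral.

(** * Rational transforms *)

Section Exponential.
Context {R : realType}.
Local Notation mu := (@lebesgue_measure R).
Implicit Types (b t u : R).

(** The summand - 1 adds b e^(- b u) to the derivative. This makes the integrands b e^(- b u) (1 +
    cos) and b e^(- b u) (1 + sin) nonnegative, as the fundamental theorem on a half-line requires;
    the extra mass 1 is subtracted afterwards. *)
Lemma derive_damped b t (alpha beta u : R) :
  is_derive u 1 (fun u : R => expR (- b * u) * (alpha * cos (t * u) + beta * sin (t * u) - 1))
    (expR (- b * u) * (b + (beta * t - b * alpha) * cos (t * u)
                         + (- (b * beta) - alpha * t) * sin (t * u))).
Proof.
apply: is_derive_eq.
by rewrite /GRing.scale /= !mulr1; ring.
Qed.

Lemma cvg_damped b t (alpha beta : R) : 0 < b ->
  expR (- b * u) * (alpha * cos (t * u) + beta * sin (t * u) - 1) @[u --> +oo] --> (0 : R).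
Proof.
move=> b0.
have e0 : expR (- b * u) @[u --> +oo] --> (0 : R).
  rewrite (_ : (fun u => _) = (fun z => expR (- z)) \o (fun z => b * z)); last first.
    by apply: eq_fun => x; rewrite mulNr.
  apply: (@cvg_comp _ _ _ _ _ _ (pinfty_nbhs R)); last exact: cvgr_expR.
  exact: gt0_cvgMry.
pose C := `|alpha| + `|beta| + 1.
have C0 : expR (- b * u) * C @[u --> +oo] --> (0 : R).
  by rewrite -[X in _ --> X](mul0r C); apply: cvgMr_tmp.
apply/cvgr0Pnorm_le => e ep; near=> u.
apply: (@le_trans _ _ (expR (- b * u) * C)).
  rewrite normrM (ger0_norm (expR_ge0 _)) ler_wpM2l ?expR_ge0 //.
  apply: le_trans (ler_normB _ _) _; rewrite normr1 lerD2r.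
  apply: le_trans (ler_normD _ _) _; rewrite !normrM lerD //.
    by rewrite ler_piMr // cosM_le1.
  by rewrite ler_piMr // sinM_le1.
apply: le_trans (ler_norm _) _.
near: u; move: e ep; exact/cvgr0Pnorm_le.
Unshelve. all: by end_near. Qed.

Lemma integral_damped b t (alpha beta : R) : 0 < b ->
  (forall u, 0 <= b + (beta * t - b * alpha) * cos (t * u)
                         + (- (b * beta) - alpha * t) * sin (t * u)) ->
  \int[mu]_(u in `[0, +oo[) (expR (- b * u) * (b + (beta * t - b * alpha) * cos (t * u)
                         + (- (b * beta) - alpha * t) * sin (t * u))) = 1 - alpha.
Proof.
move=> b0 pos.
have dF u := derive_damped b t alpha beta u.
rewrite (Rintegral_ge0_continuous_FTC2y _ _ (cvg_damped t alpha beta b0)).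
- by rewrite !mulr0 expR0 cos0 sin0; ring.
- by move=> u _; rewrite mulr_ge0 // expR_ge0.
- by apply: derivable_within_continuous => u _; exact: ex_derive.
- by move=> u _; have [] := dF u.
- apply: cvg_at_right_filter; have [dF0 _] := dF 0.
  by have /derivable1_diffP/differentiable_continuous := dF0; apply.
- by move=> u _; rewrite derive1E; have [_ ->] := dF u.
Qed.

Lemma L1_exponential b : 0 < b -> L1 (exponential_pdf b).
Proof. exact: integrable_exponential_pdf. Qed.

Lemma Rintegral_exponential b (w : R -> R) :
  \int[mu]_u (w u * exponential_pdf b u) =
  \int[mu]_(u in `[0, +oo[) (w u * (b * expR (- b * u))).
Proof.
rewrite [RHS]Rintegral_mkcond; apply: eq_Rintegral => u _.
rewrite /exponential_pdf !patchE; case: ifP => // _; exact: mulr0.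
Qed.

Lemma Rintegral_exponential_shift b (w : R -> R) : 0 < b ->
  measurable_fun setT w -> (forall u, `|w u| <= 1) ->
  \int[mu]_u (w u * exponential_pdf b u) =
  \int[mu]_(u in `[0, +oo[) (expR (- b * u) * (b + b * w u)) - 1.
Proof.
move=> b0 mw w1.
have L1e := L1_exponential b0.
have -> : \int[mu]_(u in `[0, +oo[) (expR (- b * u) * (b + b * w u)) =
    \int[mu]_u ((1 + w u) * exponential_pdf b u).
  by rewrite Rintegral_exponential; apply: eq_Rintegral => u _; ring.
transitivity (\int[mu]_u (exponential_pdf b u + w u * exponential_pdf b u) - 1).
  rewrite RintegralD //; last exact: L1_bounded_mul.
  have -> : \int[mu]_u exponential_pdf b u = 1.
    by rewrite /Rintegral integral_exponential_pdf.
  by ring.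
by congr (_ - 1); apply: eq_Rintegral => u _; ring.
Qed.

Lemma hat_exponential b t : 0 < b ->
  hat (exponential_pdf b) t = b%:C / (b%:C - 'i * t%:C).
Proof.
move=> b0; have d0 : b ^+ 2 + t ^+ 2 != 0.
  by rewrite gt_eqF // ltr_wpDr ?sqr_ge0 // exprn_gt0.
have -> : hat (exponential_pdf b) t =
    Complex (b ^+ 2 / (b ^+ 2 + t ^+ 2)) (b * t / (b ^+ 2 + t ^+ 2)).
  apply: complexP => /=; rewrite Rintegral_exponential_shift //.
  (* [alpha] and [beta] solve the linear system that makes the cosine coefficient [b] and the sine
     coefficient 0; for the imaginary part the roles are exchanged. *)
  - have := @integral_damped b t (- (b ^+ 2 / (b ^+ 2 + t ^+ 2))) (b * t / (b ^+ 2 + t ^+ 2)) b0.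
    rewrite (_ : b * t / (b ^+ 2 + t ^+ 2) * t - b * - (b ^+ 2 / (b ^+ 2 + t ^+ 2)) = b);
      last by field.
    rewrite (_ : - (b * (b * t / (b ^+ 2 + t ^+ 2))) - - (b ^+ 2 / (b ^+ 2 + t ^+ 2)) * t = 0);
      last by field.
    under eq_Rintegral do rewrite mul0r addr0.
    move=> ->; first by ring.
    move=> u; rewrite mul0r addr0 -[X in X + _]mulr1 -mulrDr mulr_ge0 // ?(ltW b0) //.
  - exact: measurable_cosM.
  - exact: cosM_le1.
  - have := @integral_damped b t (- (b * t / (b ^+ 2 + t ^+ 2)))
      (- (b ^+ 2 / (b ^+ 2 + t ^+ 2))) b0.
    rewrite (_ : - (b ^+ 2 / (b ^+ 2 + t ^+ 2)) * t - b * - (b * t / (b ^+ 2 + t ^+ 2)) = 0);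
      last by field.
    rewrite (_ : - (b * - (b ^+ 2 / (b ^+ 2 + t ^+ 2))) - - (b * t / (b ^+ 2 + t ^+ 2)) * t = b);
      last by field.
    under eq_Rintegral do rewrite mul0r addr0.
    move=> ->; first by ring.
    move=> u; rewrite mul0r addr0 -[X in X + _]mulr1 -mulrDr mulr_ge0 // ?(ltW b0) //.
  - exact: measurable_sinM.
  - exact: sinM_le1.
have n0 : b%:C - 'i * t%:C != 0.
  by apply/eqP => /(congr1 (@complex.Re R)); rewrite !reim /= => e; lra.
apply: (mulIf n0); rewrite divfK //.
by apply: complexP; rewrite !reim /=; field.
Qed.

End Exponential.

(** * Proper rational functions without real poles *)

Section Poles.
Context {R : realType}.
Local Notation mu := (@lebesgue_measure R).

Lemma hat_opp (h : R -> R) t : L1 h -> hat (fun u => h (- u)) t = hat h (- t).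
Proof.
move=> L1h; apply: complexP => /=.
  rewrite -[RHS](Rintegral_opp (L1_cosM (- t) L1h)).
  by apply: eq_Rintegral => u _; rewrite mulrNN.
rewrite -[RHS](Rintegral_opp (L1_sinM (- t) L1h)).
by apply: eq_Rintegral => u _; rewrite mulrNN.
Qed.

Lemma norm1_opp (h : R -> R) : L1 h -> norm1 (fun u => h (- u)) = norm1 h.
Proof. by move=> L1h; exact: (Rintegral_opp (L1_abs L1h)). Qed.

Lemma cwiener_hat (h1 h2 : R -> R) : L1 h1 -> L1 h2 ->
  cwiener (fun t => hat h1 t + 'i * hat h2 t) (norm1 h1 + norm1 h2).
Proof.
move=> L1h1 L1h2; exists (hat h1), (hat h2), (norm1 h1), (norm1 h2); split => //.
  by exists 0, h1; split => // [t|]; rewrite ?rmorph0 ?normr0 add0r.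
by exists 0, h2; split => // [t|]; rewrite ?rmorph0 ?normr0 add0r.
Qed.

(** Translating a transform by [s] multiplies the density by e^(i s u), whose real and imaginary
    parts give two real densities. *)
Lemma cwiener_hat_shift (h : R -> R) s : L1 h ->
  exists r, cwiener (fun t => hat h (t + s)) r.
Proof.
move=> L1h; have L1c := L1_cosM s L1h; have L1s := L1_sinM s L1h.
eexists; apply: cwiener_ext (cwiener_hat L1c L1s) _ => t.
apply: complexP; rewrite !reim /=.
  rewrite mul0r mul1r add0r -RintegralB //; [|exact: L1_cosM|exact: L1_sinM].
  by apply: eq_Rintegral => u _; rewrite mulrDl cosD; ring.
rewrite mul0r mul1r add0r -RintegralD //; [|exact: L1_sinM|exact: L1_cosM].
by apply: eq_Rintegral => u _; rewrite mulrDl sinD; ring.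
Qed.

(** Up to a constant this is the transform of a one-sided exponential modulated at frequency Re a:
    supported on the right half-line if Im a < 0, on the left one if Im a > 0. *)
Lemma cwiener_pole (a : R[i]) : complex.Im a != 0 ->
  exists r, cwiener (fun t => (t%:C - a)^-1) r.
Proof.
case: a => s b /= b0.
have ib0 : 'i * b%:C != 0 :> R[i].
  by apply/eqP => /(congr1 (@complex.Im R)); rewrite !reim /= mul1r mul0r add0r => /eqP; apply/negP.
have ts t : t%:C - Complex s b != 0.
  by apply/eqP => /(congr1 (@complex.Im R)); rewrite !reim /= => /eqP;
    rewrite add0r oppr_eq0; apply/negP.
have conclude (g : R -> R[i]) r : cwiener g r ->
    (forall t, g t * ('i * (t%:C - Complex s b)) = b%:C) ->
    exists r, cwiener (fun t => (t%:C - Complex s b)^-1) r.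
  move=> Wg e; exists (cnorm ('i / b%:C) * r); apply: cwiener_ext (cwienerZ _ Wg) _ => t.
  apply: (mulIf (ts t)); rewrite mulVf //.
  have bC0 : b%:C != 0 :> R[i] by move: ib0; rewrite mulf_eq0 negb_or => /andP[].
  by apply: (mulIf bC0); rewrite mul1r -[RHS](e t); field.
have [bneg|bpos] : b < 0 \/ 0 < b by apply/orP; rewrite -neq_lt.
  have nb0 : 0 < - b by rewrite oppr_gt0.
  have [r Wr] := cwiener_hat_shift (- s) (L1_exponential nb0).
  apply: conclude Wr _ => t; rewrite hat_exponential //.
  rewrite (_ : 'i * (t%:C - Complex s b) = - ((- b)%:C - 'i * (t - s)%:C)); last first.
    by apply: complexP; rewrite !reim /=; ring.
  rewrite mulrN divfK; first by rewrite rmorphN opprK.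
  by apply/eqP => /(congr1 (@complex.Re R)); rewrite !reim /= => e; lra.
have [r Wr] := cwiener_hat_shift (- s) (L1_opp (L1_exponential bpos)).
apply: conclude Wr _ => t; rewrite hat_opp ?hat_exponential //; last exact: L1_exponential.
rewrite (_ : 'i * (t%:C - Complex s b) = b%:C - 'i * (- (t - s))%:C); last first.
  by apply: complexP; rewrite !reim /=; ring.
rewrite divfK //.
by apply/eqP => /(congr1 (@complex.Re R)); rewrite !reim /= => e; lra.
Qed.

(** Roots of [Q] are peeled off one at a time: with P = q (X - z) + P(z), the quotient P / ((X - z)
    S) is q / S plus P(z) (1 / S) (1 / (X - z)). Repeated roots need no separate treatment. *)
Lemma cwiener_rational (P Q : {poly R[i]}) : (forall t : R, Q.[t%:C] != 0) ->
  (size P <= size Q)%N -> exists r, cwiener (fun t => P.[t%:C] / Q.[t%:C]) r.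
Proof.
have [s ->] := closed_field_poly_normal Q; set c := lead_coef Q => Q0.
have c0 : c != 0.
  by apply: contraNneq (Q0 0) => ->; rewrite scale0r horner0.
rewrite size_scale // size_prod_XsubC => sP.
have s0 z : z \in s -> complex.Im z != 0.
  move=> zs; apply/eqP => Imz; have := Q0 (complex.Re z).
  rewrite hornerZ mulf_eq0 negb_or => /andP[_]; apply/negP; rewrite negbK.
  rewrite -[_ == 0]/(root _ _) root_prod_XsubC.
  by rewrite (_ : (complex.Re z)%:C = z) //; exact: complexP.
suff [r Wr] : exists r, cwiener (fun t => P.[t%:C] / (\prod_(z <- s) ('X - z%:P)).[t%:C]) r.
  exists (cnorm (c^-1) * r); apply: cwiener_ext (cwienerZ _ Wr) _ => t.
  by rewrite hornerZ invfM mulrCA.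
elim: s s0 P sP {Q0} => [|z s IH] s0 P sP.
  exists (cnorm P`_0); apply: cwiener_ext (cwiener_cst _) _ => t.
  by rewrite big_nil [in RHS](size1_polyC sP) !hornerE divr1.
have {}IH := IH (fun y ys => s0 y (@mem_behead _ (z :: s) y ys)).
have z0 : complex.Im z != 0 by apply: s0; rewrite mem_head.
have tz t : t%:C - z != 0.
  apply/eqP => /(congr1 (@complex.Im R)); rewrite !reim /= => /eqP.
  by rewrite add0r oppr_eq0; apply/negP.
have /factor_theorem[q Pq] : root (P - P.[z]%:P) z by rewrite /root !hornerE subrr.
have sq : (size q <= (size s).+1)%N.
  have [->|q0] := eqVneq q 0; first by rewrite size_poly0.
  have : (size (q * ('X - z%:P))%R <= (size (z :: s)).+1)%N.
    rewrite -Pq; apply: leq_trans (size_polyD _ _) _; rewrite size_polyN geq_max sP /=.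
    by rewrite (leq_trans (size_polyC_leq1 _)).
  by rewrite size_Mmonic ?monicXsubC // size_XsubC addn2.
have [r1 W1] := IH q sq.
have [r2 W2] := IH 1 (leq_trans (size_polyC_leq1 _) (ltn0Sn _)).
have [r3 W3] := cwiener_pole z0.
exists (r1 + cnorm P.[z] * (r2 * r3)).
apply: cwiener_ext (cwienerD W1 (cwienerZ P.[z] (cwienerM W2 W3))) _ => t.
have PE : P = q * ('X - z%:P) + P.[z]%:P by rewrite -Pq subrK.
rewrite [in RHS]PE big_cons hornerD hornerM hornerXsubC hornerC hornerM hornerXsubC.
rewrite invfM mulrDl [q.[_] * _ * _]mulrA mulfK //.
by rewrite hornerC mul1r [(_ - _)^-1 * _]mulrC.
Qed.

End Poles.

Section StrictRational.
Context {R : realType}.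
Implicit Types (g : R -> R[i]) (P Q : {poly R[i]}).

(** Strictness expresses vanishing at infinity, and leaves room for one factor [t] in the
    numerator. *)
Definition strictly_proper g := exists P Q, [/\ forall t : R, Q.[t%:C] != 0,
  (size P < size Q)%N & forall t, g t = P.[t%:C] / Q.[t%:C]].

Lemma strictly_proper0 : strictly_proper (fun=> 0).
Proof.
exists 0, 1; rewrite size_poly0 size_poly1; split => // t.
  by rewrite hornerC oner_neq0.
by rewrite horner0 mul0r.
Qed.

Lemma strictly_properD g g' : strictly_proper g -> strictly_proper g' ->
  strictly_proper (fun t => g t + g' t).
Proof.
move=> [P [Q [Q0 PQ e]]] [P' [Q' [Q'0 PQ' e']]].
have nQ : Q != 0 by apply: contraNneq (Q0 0) => ->; rewrite horner0.
have nQ' : Q' != 0 by apply: contraNneq (Q'0 0) => ->; rewrite horner0.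
exists (P * Q' + P' * Q), (Q * Q'); split=> [t||t].
- by rewrite hornerM mulf_neq0.
- rewrite size_mul //; apply: leq_ltn_trans (size_polyD _ _) _.
  rewrite gtn_max; apply/andP; split; apply: leq_ltn_trans (size_polyMleq _ _) _.
    by rewrite ltn_predRL prednK ?addn_gt0 ?size_poly_gt0 ?nQ' ?orbT // ltn_add2r.
  by rewrite ltn_predRL prednK ?addn_gt0 ?size_poly_gt0 ?nQ ?orbT // addnC ltn_add2l.
- by rewrite e e' !hornerE; field; rewrite Q0 Q'0.
Qed.

Lemma strictly_properZ z g : strictly_proper g -> strictly_proper (fun t => z * g t).
Proof.
move=> [P [Q [Q0 PQ e]]]; exists (z *: P), Q; split => // [|t].
  exact: leq_ltn_trans (size_scale_leq _ _) PQ.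
by rewrite e hornerZ mulrA.
Qed.

Lemma strictly_proper_pole (z a : R[i]) : complex.Im a != 0 ->
  strictly_proper (fun t => z / (t%:C - a)).
Proof.
move=> a0; exists z%:P, ('X - a%:P); split=> [t||t].
- rewrite hornerXsubC; apply: contraNneq a0 => /(congr1 (@complex.Im R)).
  by rewrite !reim /= add0r => /eqP; rewrite oppr_eq0.
- by rewrite size_XsubC ltnS size_polyC_leq1.
- by rewrite hornerXsubC hornerC.
Qed.

Lemma strictly_proper_ext g g' : strictly_proper g -> g =1 g' -> strictly_proper g'.
Proof. by move=> Sg /funext <-. Qed.

Lemma strictly_proper_exponential b : 0 < b -> strictly_proper (hat (exponential_pdf b)).
Proof.
move=> b0.
have b0' : complex.Im (Complex 0 (- b)) != 0 by rewrite /= oppr_eq0 gt_eqF.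
apply: strictly_proper_ext (strictly_proper_pole (Complex 0 b) b0') _ => t.
rewrite hat_exponential //.
have D0 : t%:C - Complex 0 (- b) != 0.
  apply: contraNneq b0' => /(congr1 (@complex.Im R)).
  by rewrite !reim /= add0r => /eqP; rewrite oppr_eq0.
have i0 : 'i != 0 :> R[i] by apply/eqP => -[] /eqP; rewrite oner_eq0.
have -> : b%:C - 'i * t%:C = - 'i * (t%:C - Complex 0 (- b)).
  by apply: complexP; rewrite !reim /=; ring.
have -> : b%:C = Complex 0 b * (- 'i).
  by apply: complexP; rewrite !reim /=; ring.
by field; rewrite D0 i0.
Qed.

End StrictRational.

(** * Density of the functions with rational transform *)

Section Bernstein.
Context {R : realType}.

(* De Casteljau recursion for the Bernstein polynomial with nodes [f 0 .. f n]. *)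
Fixpoint bernstein n (f : nat -> R) : {poly R} :=
  if n is m.+1 then (1 - 'X) * bernstein m f + 'X * bernstein m (fun k => f k.+1)
  else (f 0%N)%:P.

Lemma bernsteinS n (f : nat -> R) (x : R) : (bernstein n.+1 f).[x] =
  (1 - x) * (bernstein n f).[x] + x * (bernstein n (fun k => f k.+1)).[x].
Proof. by rewrite /= !hornerE. Qed.

Lemma bernstein_cst n (c x : R) : (bernstein n (fun=> c)).[x] = c.
Proof.
by elim: n => [|n IH]; rewrite ?hornerC // bernsteinS IH; ring.
Qed.

Lemma bernsteinD n (f g : nat -> R) (x : R) :
  (bernstein n (fun k => f k + g k)).[x] = (bernstein n f).[x] + (bernstein n g).[x].
Proof.
elim: n f g => [|n IH] f g; first by rewrite !hornerC.
by rewrite !bernsteinS IH (IH (fun k => f k.+1)); ring.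
Qed.

Lemma bernsteinZ n (c : R) (f : nat -> R) (x : R) :
  (bernstein n (fun k => c * f k)).[x] = c * (bernstein n f).[x].
Proof.
elim: n f => [|n IH] f; first by rewrite !hornerC.
by rewrite !bernsteinS IH (IH (fun k => f k.+1)); ring.
Qed.

Lemma bernstein_le n (f g : nat -> R) (x : R) : 0 <= x <= 1 ->
  (forall k, (k <= n)%N -> f k <= g k) -> (bernstein n f).[x] <= (bernstein n g).[x].
Proof.
move=> /andP[x0 x1]; elim: n f g => [|n IH] f g fg; first by rewrite !hornerC fg.
have h1 : (bernstein n f).[x] <= (bernstein n g).[x].
  by apply: IH => k kn; rewrite fg // (leq_trans kn).
have h2 : (bernstein n (fun k => f k.+1)).[x] <= (bernstein n (fun k => g k.+1)).[x].
  by apply: IH => k kn; rewrite fg.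
by rewrite !bernsteinS; nra.
Qed.

(** Variance plus squared bias of the binomial law. The centre [a] is free because the recursion
    shifts the nodes by one, which replaces [a] by [a - 1]. *)
Lemma bernstein_variance n (a x : R) :
  (bernstein n (fun k => (k%:R - a) ^+ 2)).[x] = n%:R * x * (1 - x) + (n%:R * x - a) ^+ 2.
Proof.
elim: n a => [|n IH] a; first by rewrite hornerC; ring.
have IH1 := IH (a - 1).
rewrite bernsteinS (_ : (fun k => (k.+1%:R - a) ^+ 2) = fun k => (k%:R - (a - 1)) ^+ 2).
  by rewrite IH IH1 -[n.+1%:R]natr1; ring.
by apply/funext => k /=; rewrite -natr1; ring.
Qed.

Lemma bernstein_bound n (f : nat -> R) (x M : R) : 0 <= x <= 1 ->
  (forall k, `|f k| <= M) -> `|(bernstein n f).[x]| <= M.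
Proof.
move=> x01 fM; rewrite ler_norml; apply/andP; split.
  rewrite -[leLHS](bernstein_cst n _ x); apply: bernstein_le => // k _.
  by have := fM k; rewrite ler_norml => /andP[].
rewrite -[leRHS](bernstein_cst n _ x); apply: bernstein_le => // k _.
by have := fM k; rewrite ler_norml => /andP[].
Qed.

(* [|psi y - psi x| <= e + 2 M (y - x)^2 / d^2], averaged against the binomial law of
   mean [n x] and variance [n x (1 - x)]. *)
Lemma bernstein_cvg (psi : R -> R) (x M : R) : 0 <= x <= 1 ->
  (forall y, 0 <= y <= 1 -> `|psi y| <= M) -> psi @ x --> psi x ->
  (bernstein n (fun k => psi (k%:R / n%:R))).[x] @[n --> \oo] --> psi x.
Proof.
move=> x01 psiM cpsi; have M0 : 0 <= M by apply: le_trans (psiM x x01).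
apply/cvgrPdist_le => e e0.
have e2 : 0 < e / 2 by rewrite divr_gt0.
have /cvgrPdist_le /(_ _ e2) [d /= d0 psid] := cpsi.
have dev y : 0 <= y <= 1 -> `|psi y - psi x| <= e / 2 + 2 * M / d ^+ 2 * (y - x) ^+ 2.
  move=> y01; have c0 : 0 <= 2 * M / d ^+ 2 * (y - x) ^+ 2.
    by rewrite mulr_ge0 ?sqr_ge0 // divr_ge0 ?sqr_ge0 // mulr_ge0.
  have [xy|xy] := ltP `|x - y| d.
    by have := psid y xy; rewrite distrC; lra.
  apply: (@le_trans _ _ (2 * M)).
    by have := ler_normB (psi y) (psi x); have := psiM x x01; have := psiM y y01; lra.
  apply: (@le_trans _ _ (2 * M / d ^+ 2 * (y - x) ^+ 2)); last by lra.
  rewrite -mulrA ler_peMr ?mulr_ge0 // mulrC ler_pdivlMr ?exprn_gt0 // mul1r.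
  by rewrite -[leRHS]real_normK ?num_real // distrC lerXn2r ?nnegrE // ltW.
near=> n.
have n0 : (0 < n)%N by near: n; exact: nbhs_infty_gt.
have nR : 0 < n%:R :> R by rewrite ltr0n.
(* Makes 2 M / (d^2 n), which bounds the averaged quadratic term, at most e / 2. *)
have nbig : 4 * M / (d ^+ 2 * e) <= n%:R by near: n; exact: nbhs_infty_ger.
pose c := 2 * M / d ^+ 2 / n%:R ^+ 2.
have devk k : (k <= n)%N ->
    `|psi (k%:R / n%:R) - psi x| <= e / 2 + c * (k%:R - n%:R * x) ^+ 2.
  move=> kn; have k01 : 0 <= (k%:R / n%:R : R) <= 1.
    by rewrite divr_ge0 //= ler_pdivrMr // mul1r ler_nat.
  apply: le_trans (dev _ k01) _; rewrite lerD2l /c.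
  rewrite le_eqVlt; apply/orP; left; apply/eqP.
  by field; rewrite !gt_eqF.
have avg (s : R) : (bernstein n (fun k => s + c * (k%:R - n%:R * x) ^+ 2)).[x] =
    s + c * (n%:R * x * (1 - x)).
  rewrite bernsteinD bernstein_cst bernsteinZ bernstein_variance; congr (_ + _).
  by ring.
have small : c * (n%:R * x * (1 - x)) <= e / 2.
  have -> : c * (n%:R * x * (1 - x)) = 2 * M / d ^+ 2 / n%:R * (x * (1 - x)).
    by rewrite /c; field; rewrite !gt_eqF.
  apply: (@le_trans _ _ (2 * M / d ^+ 2 / n%:R)).
    rewrite ler_piMr //; last by move/andP: x01 => [x0 x1]; nra.
    by rewrite divr_ge0 // divr_ge0 ?sqr_ge0 // mulr_ge0.
  have -> : 2 * M / d ^+ 2 / n%:R = 4 * M / (d ^+ 2 * e) / n%:R * (e / 2).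
    by field; rewrite !gt_eqF.
  by rewrite ler_piMl ?(ltW e2) // ler_pdivrMr // mul1r.
rewrite ler_norml; apply/andP; split.
  have : (bernstein n (fun k => psi (k%:R / n%:R))).[x] <=
         (bernstein n (fun k => (psi x + e / 2) + c * (k%:R - n%:R * x) ^+ 2)).[x].
    apply: bernstein_le => // k kn.
    by have := devk k kn; rewrite ler_norml => /andP[_]; lra.
  by rewrite avg; lra.
have : - (bernstein n (fun k => psi (k%:R / n%:R))).[x] <=
       (bernstein n (fun k => (- psi x + e / 2) + c * (k%:R - n%:R * x) ^+ 2)).[x].
  rewrite -mulN1r -bernsteinZ; apply: bernstein_le => // k kn.
  by have := devk k kn; rewrite ler_norml => /andP[+ _]; lra.
by rewrite avg; lra.
Unshelve. all: by end_near. Qed.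

End Bernstein.

(** * Approximation in L_1 by combinations of exponentials *)

Section Density.
Context {R : realType}.
Local Notation mu := (@lebesgue_measure R).
Implicit Types (h k g : R -> R) (e T u : R).

Definition rational_transform k := L1 k /\ strictly_proper (hat k).

Definition approximable h := forall e, 0 < e ->
  exists2 k, rational_transform k & norm1 (fun u => h u - k u) <= e.

Lemma rational_transform0 : rational_transform (fun=> 0).
Proof.
by split; [exact: L10|apply: strictly_proper_ext strictly_proper0 _ => t; rewrite hat0].
Qed.

Lemma rational_transformD h k : rational_transform h -> rational_transform k ->
  rational_transform (fun u => h u + k u).
Proof.
move=> [L1h Sh] [L1k Sk]; split; first exact: L1D.
by apply: strictly_proper_ext (strictly_properD Sh Sk) _ => t; rewrite hatD.
Qed.

Lemma rational_transformZ (c : R) k : rational_transform k ->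
  rational_transform (fun u => c * k u).
Proof.
move=> [L1k Sk]; split; first exact: L1Z.
by apply: strictly_proper_ext (strictly_properZ c%:C Sk) _ => t; rewrite hatZ.
Qed.

Lemma rational_transform_sum n (f : nat -> R -> R) :
  (forall j, rational_transform (f j)) -> rational_transform (fun u => \sum_(j < n) f j u).
Proof.
move=> Rf; elim: n => [|n IH].
  by under eq_fun do rewrite big_ord0; exact: rational_transform0.
by under eq_fun do rewrite big_ord_recr /=; exact: rational_transformD.
Qed.

Lemma rational_transform_exponential b : 0 < b -> rational_transform (exponential_pdf b).
Proof. by move=> b0; split; [exact: L1_exponential|exact: strictly_proper_exponential]. Qed.

(** The exponential density of rate 1 times e^(- j u) is 1 / (j + 1) times the density of rate j +
    1. *)
Lemma rational_transform_horner (p : {poly R}) :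
  rational_transform (fun u => exponential_pdf 1 u * p.[expR (- u)]).
Proof.
rewrite (_ : (fun u => _) = fun u => \sum_(j < size p)
    ((p`_j / j.+1%:R) * exponential_pdf j.+1%:R u)).
  apply: (@rational_transform_sum _ (fun j u => (p`_j / j.+1%:R) * exponential_pdf j.+1%:R u)) => j.
  by apply: rational_transformZ; exact: rational_transform_exponential.
apply/funext => u; rewrite horner_coef mulr_sumr; apply: eq_bigr => j _.
rewrite /exponential_pdf !patchE; case: ifP => _; last by rewrite mul0r mulr0.
rewrite /= mul1r mulN1r -expRM_natr [- u * _]mulrC.
rewrite (_ : - j.+1%:R * u = - u + j%:R * - u); last by rewrite -natr1; ring.
by rewrite expRD; field; apply/eqP => e; have := ler0n R j; lra.
Qed.

Lemma approximable_close h : L1 h ->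
  (forall e, 0 < e -> exists h', [/\ L1 h', approximable h' &
    norm1 (fun u => h u - h' u) <= e]) -> approximable h.
Proof.
move=> L1h clos e e0; have e2 : 0 < e / 2 by rewrite divr_gt0.
have [h' [L1h' ah' hh']] := clos _ e2.
have [k Rk h'k] := ah' _ e2; exists k => //.
have L1k : L1 k by case: Rk.
have := norm1D (L1B L1h L1h') (L1B L1h' L1k).
rewrite (_ : (fun u => h u - h' u + (h' u - k u)) = fun u => h u - k u); last first.
  by apply/funext => u; ring.
by lra.
Qed.

Lemma approximableD h h' : L1 h -> L1 h' -> approximable h -> approximable h' ->
  approximable (fun u => h u + h' u).
Proof.
move=> L1h L1h' ah ah' e e0; have e2 : 0 < e / 2 by rewrite divr_gt0.
have [k Rk hk] := ah _ e2; have [k' Rk' hk'] := ah' _ e2.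
exists (fun u => k u + k' u); first exact: rational_transformD.
have [L1k _] := Rk; have [L1k' _] := Rk'.
have := norm1D (L1B L1h L1k) (L1B L1h' L1k').
rewrite (_ : (fun u => h u - k u + (h' u - k' u)) = fun u => h u + h' u - (k u + k' u)).
  by lra.
by apply/funext => u; ring.
Qed.

Lemma strictly_proper_opp (g : R -> R[i]) : strictly_proper g ->
  strictly_proper (fun t => g (- t)).
Proof.
move=> [P [Q [Q0 PQ e]]].
exists (P \Po (- 'X)), (Q \Po (- 'X)).
have sN (S : {poly R[i]}) : size (S \Po (- 'X)) = size S.
  by rewrite size_comp_poly2 // size_polyN size_polyX.
split=> [t||t]; rewrite ?sN // ?e !horner_comp !hornerE -?rmorphN //.
exact: Q0.
Qed.

Lemma approximable_opp h : L1 h -> approximable h -> approximable (fun u => h (- u)).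
Proof.
move=> L1h ah e e0; have [k [L1k Sk] hk] := ah e e0.
exists (fun u => k (- u)).
  split; first exact: L1_opp.
  by apply: strictly_proper_ext (strictly_proper_opp Sk) _ => t; rewrite hat_opp.
by rewrite (norm1_opp (L1B L1h L1k)).
Qed.

Lemma norm1_dominated (f : nat -> R -> R) h g : (forall n, L1 (f n)) -> L1 h -> L1 g ->
  (forall n u, `|f n u| <= g u) ->
  {ae mu, forall u : measurableTypeR R, f n u @[n --> \oo] --> h u} ->
  norm1 (fun u => h u - f n u) @[n --> \oo] --> (0 : R).
Proof.
move=> L1f L1h L1g fg aefh.
have mf n : measurable_fun setT (EFin \o f n).
  by apply/measurable_EFinP; exact: L1_measurable.
have mh : measurable_fun setT (EFin \o h) by apply/measurable_EFinP; exact: L1_measurable.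
have aecv : {ae mu, forall u : measurableTypeR R,
    setT u -> (EFin \o f n) u @[n --> \oo] --> (EFin \o h) u}.
  apply: filterS aefh => u fu _.
  by apply: cvg_EFin; first exact: nearW.
have aele : {ae mu, forall u n, setT u -> (`|(EFin \o f n) u| <= (EFin \o g) u)%E}.
  by apply: aeW => u n _; rewrite /= lee_fin.
have [_ cv _] := @dominated_convergence _ (measurableTypeR R) R mu setT measurableT
  (fun n => EFin \o f n) (EFin \o h) (EFin \o g) mf mh aecv L1g aele.
rewrite (_ : (fun n => _) = fun n => fine (\int[mu]_u `|(EFin \o f n) u - (EFin \o h) u|)%E).
  exact: (fine_cvg cv).
apply/funext => n; rewrite /norm1 /Rintegral; congr fine.
by apply: eq_integral => u _; rewrite /= distrC.
Qed.

Lemma approximable_cvg (f : nat -> R -> R) h : L1 h ->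
  (forall n, L1 (f n)) -> (forall n, approximable (f n)) ->
  norm1 (fun u => h u - f n u) @[n --> \oo] --> (0 : R) -> approximable h.
Proof.
move=> L1h L1f af cv; apply: approximable_close => // e e0.
have [n _ /(_ n (leqnn n)) hn] : \forall n \near \oo, `|norm1 (fun u => h u - f n u)| <= e.
  by move/cvgr0Pnorm_le: cv; apply.
by exists (f n); split => //; apply: le_trans (ler_norm _) hn.
Qed.

Lemma L1_cut T h : L1 h -> L1 (h \_ `[0, T]).
Proof.
move=> L1h; apply: (L1_le _ L1h) => [|u].
  by apply/(measurable_restrictT _ _).1 => //; apply: measurable_funTS; exact: L1_measurable.
by rewrite patchE; case: ifP => // _; rewrite normr0.
Qed.

Lemma L1_cut_continuous T g : continuous g -> L1 (g \_ `[0, T]).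
Proof.
move=> cg; rewrite /L1.
have : mu.-integrable `[0, T] (EFin \o g).
  by apply: continuous_compact_integrable; [exact: segment_compact|exact: continuous_subspaceT].
move=> ig; rewrite -restrict_EFin.
exact: (integrable_mkcond (mu := mu) (EFin \o g) (measurable_itv `[0%R, T])).1 ig.
Qed.

Lemma ae_neq2 (a b : R) (P : R -> Prop) : (forall u, u != a -> u != b -> P u) ->
  {ae mu, forall u : measurableTypeR R, P u}.
Proof.
move=> Pu; exists ([set a] `|` [set b]); split.
- exact: measurableU.
- rewrite null_set_setU //; exact: lebesgue_measure_set1.
- move=> u /= nPu; apply: contrapT => /not_orP[ua ub].
  by apply: nPu; apply: Pu; exact/eqP.
Qed.

(* Substituting [x = expR (- u)] turns the Bernstein polynomials of [psi] into combinations
   of exponentials, whose transforms are rational. *)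
Lemma approximable_continuous T g : 0 <= T -> continuous g -> approximable (g \_ `[0, T]).
Proof.
move=> T0 cg; set h := g \_ `[0, T].
have L1h : L1 h by exact: L1_cut_continuous.
have hneg u : u < 0 -> h u = 0.
  by move=> u0; rewrite /h patchE ifF // memNset //= in_itv /= leNgt u0.
have hbig u : T < u -> h u = 0.
  by move=> uT; rewrite /h patchE ifF // memNset //= in_itv /= (leNgt u T) uT andbF.
have [M0 hM0] : exists M0, forall u, `|h u| <= M0.
  have [|c _ gc] := @EVT_max R (fun u => `|g u|) 0 T T0.
    apply: continuous_subspaceT => u.
    by apply: (continuous_comp (cg u)); exact: norm_continuous.
  exists `|g c| => u; rewrite /h patchE; case: ifPn => [|_]; last by rewrite normr0.
  by rewrite inE => /gc.
have M00 : 0 <= M0 by apply: le_trans (hM0 0).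
(* Division by [x] undoes the weight e^(- u) that [exponential_pdf 1] puts on the approximants to
   make them integrable. Since [psi] vanishes at 0 and on ]0, e^(- T)[, it is bounded by M0 e^T. *)
pose psi x := h (- ln x) / x.
pose M := M0 * expR T.
have psiM y : 0 <= y -> `|psi y| <= M.
  move=> y0; rewrite /psi.
  have [->|yn0] := eqVneq y 0; first by rewrite invr0 mulr0 normr0 mulr_ge0 ?expR_ge0.
  have yp : 0 < y by rewrite lt_neqAle eq_sym yn0.
  have [uT|Tu] := leP (- ln y) T; last by rewrite hbig // mul0r normr0 mulr_ge0 ?expR_ge0.
  rewrite normrM ler_pM // normfV ger0_norm // -(lnK yp) -expRN ler_expR //.
pose k n u := exponential_pdf 1 u * (bernstein n (fun j => psi (j%:R / n%:R))).[expR (- u)].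
have Rk n : rational_transform (k n) by exact: rational_transform_horner.
apply: (approximable_cvg (f := k) L1h).
- by move=> n; case: (Rk n).
- move=> n e e0; exists (k n) => //.
  rewrite (_ : (fun u => _) = fun=> 0); first by rewrite norm10 ltW.
  by apply/funext => u; rewrite subrr.
apply: (norm1_dominated _ L1h (L1Z M (L1_exponential ltr01))).
- by move=> n; case: (Rk n).
- move=> n u; rewrite /k normrM ger0_norm ?exponential_pdf_ge0 // mulrC.
  have [u0|u0] := ltP u 0.
    by rewrite /exponential_pdf patchE ifF ?mulr0 // memNset //= in_itv /= leNgt u0.
  apply: ler_wpM2r; first exact: exponential_pdf_ge0.
  apply: bernstein_bound => [|j]; first by rewrite expR_ge0 expR_le1 oppr_le0.
  by apply: psiM; exact: divr_ge0.
(* Bernstein polynomials converge where [psi] is continuous; [h] may jump at 0 and at [T], a null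
   set. *)
apply: (@ae_neq2 0 T) => u u0 uT.
have [un|up] := ltP u 0.
  rewrite hneg // (_ : (fun n => _) = fun=> 0); first exact: cvg_cst.
  apply/funext => n; rewrite /k /exponential_pdf patchE ifF ?mul0r // memNset //=.
  by rewrite in_itv /= leNgt un.
have {}up : 0 < u by rewrite lt_neqAle eq_sym u0.
have -> : h u = exponential_pdf 1 u * psi (expR (- u)).
  rewrite exponential_pdfE ?ltW // mul1r mulN1r /psi expRK opprK mulrC divfK //.
  by rewrite gt_eqF ?expR_gt0.
apply: cvgMl_tmp; apply: (bernstein_cvg (M := M)) => //.
  by rewrite expR_ge0 expR_le1 oppr_le0 ltW.
  by move=> y /andP[y0 _]; exact: psiM.
have x0 : 0 < expR (- u) := expR_gt0 _.
have ch : h @ u --> h u.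
  have [uT'|Tu] := ltP u T.
    rewrite [h u](_ : _ = g u); last by rewrite /h patchE mem_set //= in_itv /= !ltW.
    apply: cvg_trans (cg u); apply: near_eq_cvg; near=> v.
    rewrite /h patchE mem_set //= in_itv /=; apply/andP; split; apply: ltW.
      by near: v; exact: lt_nbhsr.
    by near: v; exact: lt_nbhsl.
  have {}Tu : T < u by rewrite lt_neqAle eq_sym uT.
  rewrite hbig //.
  have c0 : (fun=> 0 : R) v @[v --> u] --> (0 : R) by exact: cvg_cst.
  apply: cvg_trans c0; apply: near_eq_cvg; near=> v.
  by rewrite hbig //; near: v; exact: lt_nbhsr.
have cln : - ln x @[x --> expR (- u)] --> - ln (expR (- u)).
  by apply: cvgN; exact: continuous_ln.
have chln : h (- ln x) @[x --> expR (- u)] --> h (- ln (expR (- u))).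
  by apply: (cvg_comp _ _ cln); rewrite expRK opprK.
have cinv : x^-1 @[x --> expR (- u)] --> (expR (- u))^-1.
  by apply: cvgV; [rewrite gt_eqF|exact: cvg_id].
exact: (cvgM chln cinv).
Unshelve. all: by end_near. Qed.

Lemma approximable_cut h T : 0 <= T -> L1 h -> approximable (h \_ `[0, T]).
Proof.
move=> T0 L1h.
have mE : measurable (`[0, T]%classic : set (measurableTypeR R)) by exact: measurable_itv.
have fE : (mu `[0%R, T]%classic < +oo)%E.
  by rewrite lebesgue_measure_itv /=; case: ifP => _; rewrite ?ltry.
have ih : mu.-integrable `[0, T] (EFin \o h) by exact: integrableS L1h.
have [g [cg ig cv]] := approximation_continuous_integrable mE fE ih.
apply: (approximable_cvg (f := fun n => g n \_ `[0, T]) (L1_cut T L1h)).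
- by move=> n; exact: L1_cut_continuous.
- by move=> n; exact: approximable_continuous.
rewrite (_ : (fun n => _) = fun n => fine (\int[mu]_(z in `[0%R, T]) `|(h z - g n z)%:E|)%E).
  exact: (fine_cvg cv).
apply/funext => n; rewrite /norm1 /Rintegral [in RHS]integral_mkcond; congr fine.
apply: eq_integral => u _; rewrite !patchE; case: ifP => _ //.
by rewrite subr0 normr0.
Qed.

Lemma approximable_half h : L1 h -> (forall u, u < 0 -> h u = 0) -> approximable h.
Proof.
move=> L1h h0; apply: (approximable_cvg (f := fun n => h \_ `[0, n%:R]) L1h).
- by move=> n; exact: L1_cut.
- by move=> n; exact: approximable_cut.
apply: (norm1_dominated _ L1h (L1_abs L1h)).
- by move=> n; exact: L1_cut.
- by move=> n u; rewrite patchE; case: ifP => // _; rewrite normr0.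
apply: aeW => u; apply: cvg_near_cst; near=> n; rewrite patchE.
case: ifPn => //; rewrite notin_setE /= in_itv /= => /negP; rewrite negb_and -!ltNge.
case/orP => [u0|nu]; first by rewrite h0.
have : u <= n%:R by near: n; exact: nbhs_infty_ger.
by rewrite leNgt nu.
Unshelve. all: by end_near. Qed.

Lemma L1_approximable h : L1 h -> approximable h.
Proof.
move=> L1h.
(* The inequality is weak in [a] and strict in [b], so that the value at 0 is counted once. *)
pose a u := if 0 <= u then h u else 0.
pose b u := if 0 < u then h (- u) else 0.
have L1a : L1 a.
  apply: (L1_le _ L1h) => [|u]; last by rewrite /a; case: ifP; rewrite ?normr0.
  apply: measurable_fun_ifT => //; last exact: L1_measurable.
  exact: measurable_fun_ler.
have L1b : L1 b.
  apply: (L1_le _ (L1_opp L1h)) => [|u]; last by rewrite /b; case: ifP; rewrite ?normr0.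
  apply: measurable_fun_ifT => //; last by apply: L1_measurable; exact: L1_opp.
  exact: measurable_fun_ltr.
have -> : h = fun u => a u + b (- u).
  apply/funext => u; rewrite /a /b oppr_gt0 opprK.
  by case: (ltP u 0); rewrite ?add0r ?addr0.
apply: approximableD => //; first exact: L1_opp.
  by apply: approximable_half => // u u0; rewrite /a leNgt u0.
apply: approximable_opp => //.
by apply: approximable_half => // u u0; rewrite /b ltNge ltW.
Qed.

End Density.

(** * Wiener's lemma *)

Section WienerLemma.
Context {R : realType}.
Local Notation mu := (@lebesgue_measure R).
Implicit Types (h k : R -> R) (c d e r s t u : R).

Lemma continuous_bounded_kernel (w : R -> R -> R) h : L1 h ->
  (forall t, measurable_fun setT (w t)) -> (forall t u, `|w t u| <= 1) ->
  (forall u, continuous (w ^~ u)) -> continuous (fun t => \int[mu]_u (w t u * h u)).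
Proof.
move=> L1h mw w1 cw t.
have := @continuity_under_integral R _ _ mu (fun t u => w t u * h u) setT measurableT
  (t - 1) (t + 1) _ _ (fun u => `|h u|) (L1_abs L1h) _.
move=> /(_ _ _ _ t); apply.
- by move=> s _; exact: L1_bounded_mul.
- apply: aeW => u _ s _; apply: cvgMr_tmp; exact: cw.
- by move=> s _; apply: aeW => u _; rewrite normrM ler_piMl.
- by rewrite inE /= in_itv /= ltrBlDr !ltrDl ltr01.
Qed.

Lemma continuous_Re_hat h : L1 h -> continuous (fun t => complex.Re (hat h t)).
Proof.
move=> L1h; apply: (continuous_bounded_kernel (w := fun t u => cos (t * u))) => //.
- exact: measurable_cosM.
- exact: cosM_le1.
- by move=> u t; apply: continuous_comp; [exact: mulrr_continuous|exact: continuous_cos].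
Qed.

Lemma continuous_Im_hat h : L1 h -> continuous (fun t => complex.Im (hat h t)).
Proof.
move=> L1h; apply: (continuous_bounded_kernel (w := fun t u => sin (t * u))) => //.
- exact: measurable_sinM.
- exact: sinM_le1.
- by move=> u t; apply: continuous_comp; [exact: mulrr_continuous|exact: continuous_sin].
Qed.

Lemma cnormZ_real (a : R) (z : R[i]) : cnorm (a%:C * z) = `|a| * cnorm z.
Proof. by rewrite /cnorm !reim /= !mul0r subr0 addr0 !normrM mulrDr. Qed.

(* [t * g t] is again a proper rational function, hence in the algebra and bounded. *)
Lemma strictly_proper_decay (g : R -> R[i]) : strictly_proper g ->
  exists C, forall t, `|t| * cnorm (g t) <= C.
Proof.
move=> [P [Q [Q0 PQ e]]].
have [|r Wr] := @cwiener_rational _ ('X * P) Q Q0.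
  by apply: leq_trans (size_polyMleq _ _) _; rewrite size_polyX.
exists (2 * r) => t; rewrite -cnormZ_real; apply: le_trans _ (cwiener_bound t Wr).
by rewrite e hornerM hornerX mulrA.
Qed.

(** Split off [k] with rational transform at distance e / 4. Both coordinates of the remaining
    transform are at most e / 4, and that of [k] decays like C / |t|. *)
Lemma riemann_lebesgue h e : L1 h -> 0 < e ->
  exists2 T, 0 < T & forall t, T <= `|t| -> cnorm (hat h t) <= e.
Proof.
move=> L1h e0; have e4 : 0 < e / 4 by rewrite divr_gt0.
have [k [L1k Sk] hk] := L1_approximable L1h e4.
have [C gC] := strictly_proper_decay Sk.
have C0 : 0 <= C by apply: le_trans (gC 0); rewrite normr0 mul0r.
exists (2 * C / e + 1) => [|t Tt].
  by rewrite ltr_wpDl // divr_ge0 ?mulr_ge0 // ltW.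
have -> : hat h t = hat (fun u => h u - k u) t + hat k t.
  rewrite -hatD //; last exact: L1B.
  by congr (hat _ t); apply/funext => u; rewrite subrK.
apply: le_trans (cnormD _ _) _.
have t0 : 0 < `|t|.
  by apply: lt_le_trans Tt; rewrite ltr_wpDl // divr_ge0 ?mulr_ge0 // ltW.
have gk : cnorm (hat k t) <= e / 2.
  have := gC t; rewrite -ler_pdivlMl // => /le_trans; apply.
  rewrite ler_pdivrMl // -ler_pdivrMr ?divr_gt0 // invf_div.
  by apply: le_trans Tt; rewrite mulrA [C * 2]mulrC lerDl.
have := Re_hat_le t (L1B L1h L1k); have := Im_hat_le t (L1B L1h L1k).
by rewrite /cnorm in gk *; lra.
Qed.

Lemma rwiener_cwiener (g : R -> R[i]) r : rwiener g r -> cwiener g r.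
Proof.
move=> Wg; have := @rwiener_cst R 0; rewrite normr0 => W0.
exists g, (fun=> 0%:C), r, 0; split => //; last by rewrite addr0.
by move=> t; rewrite mulr0 addr0.
Qed.

(** Since [d] is the value at infinity, the function has no zero on the compactified line: the
    extreme value theorem handles [- T, T], and outside the transform is at most half of |d|. *)
Lemma hat_lower_bound d h : L1 h -> d != 0 -> (forall t, d%:C + hat h t != 0) ->
  exists2 delta, 0 < delta & forall t, delta <= sqnorm (d%:C + hat h t).
Proof.
move=> L1h d0 nz.
have d20 : 0 < `|d| / 2 by rewrite divr_gt0 // normr_gt0.
have [T T0 hT] := riemann_lebesgue L1h d20.
have TT : - T <= T by lra.
have pos (z : R[i]) : z != 0 -> 0 < sqnorm z.
  move=> z0; rewrite lt_neqAle sqnorm_ge0 andbT eq_sym /sqnorm paddr_eq0 ?sqr_ge0 //.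
  by apply: contraNN z0; rewrite !sqrf_eq0 => /andP[/eqP ? /eqP ?]; apply/eqP/complexP.
have [|c _ cmin] := @EVT_min R (fun t => sqnorm (d%:C + hat h t)) _ _ TT.
  apply: continuous_subspaceT => t.
  rewrite /sqnorm; under eq_fun do rewrite !reim.
  have cR := @continuous_Re_hat h L1h t; have cI := @continuous_Im_hat h L1h t.
  by apply: cvgD; apply: cvgM; apply: cvgD => //; exact: cvg_cst.
exists (Num.min (sqnorm (d%:C + hat h c)) (d ^+ 2 / 4)).
  by rewrite lt_min pos // divr_gt0 // exprn_even_gt0.
move=> t; rewrite ge_min; have [tT|Tt] := leP `|t| T.
  by rewrite cmin // in_itv /= -ler_norml.
apply/orP; right; have := hT t (ltW Tt); case: (hat h t) => a b.
rewrite /cnorm /sqnorm !reim /= add0r => small; have i0 := normr_ge0 b.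
apply: (@le_trans _ _ ((d + a) ^+ 2)); last by rewrite lerDl sqr_ge0.
have a2 : `|a| <= `|d| / 2 by lra.
have da : `|d| / 2 <= `|d + a|.
  by have := ler_normB (d + a) a; rewrite addrK; lra.
rewrite -[leRHS]real_normK ?num_real // -[d ^+ 2]real_normK ?num_real //.
have -> : `|d| ^+ 2 / 4 = (`|d| / 2) ^+ 2 by field.
by rewrite lerXn2r // ?nnegrE // ltW.
Qed.

Lemma cwiener_sum n (g : nat -> R -> R[i]) : (forall j, exists r, cwiener (g j) r) ->
  exists r, cwiener (fun t => \sum_(j < n) g j t) r.
Proof.
move=> Wg; elim: n => [|n [r Wr]].
  by exists (cnorm 0); apply: cwiener_ext (cwiener_cst _) _ => t; rewrite big_ord0.
have [r' Wr'] := Wg n; exists (r + r').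
by apply: cwiener_ext (cwienerD Wr Wr') _ => t; rewrite big_ord_recr.
Qed.

(* [1 - w] is inverted by [\sum_(j < n) w ^+ j / (1 - w ^+ n)]. *)
Lemma cwiener_inv_power n (w : R -> R[i]) r q : cwiener w r -> q < 1 ->
  cwiener (fun t => w t ^+ n) q ->
  (forall t, 1 - w t != 0) /\ exists r', cwiener (fun t => (1 - w t)^-1) r'.
Proof.
move=> Ww q1 Wn; have nz t := neumann_neq0 t q1 Wn.
have e t : (1 - w t) * \sum_(j < n) w t ^+ j = 1 - w t ^+ n.
  by rewrite -opprB mulNr -subrX1 opprB.
have nw t : 1 - w t != 0.
  by apply: contraNneq (nz t) => w0; rewrite -e w0 mul0r.
split=> //; have [r1 W1] := @cwiener_sum n (fun j t => w t ^+ j)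
  (fun j => ex_intro _ _ (cwienerX j Ww)).
exists (r1 * (1 - q)^-1); apply: cwiener_ext (cwienerM W1 (neumann q1 Wn)) _ => t.
apply: (mulIf (nz t)); rewrite mulfVK //.
by apply: (mulfI (nw t)); rewrite e mulrA divff // mul1r.
Qed.

Lemma sqnormD_le (z w : R[i]) : sqnorm (z + w) <= 2 * sqnorm z + 2 * sqnorm w.
Proof.
rewrite /sqnorm !reim.
have := sqr_ge0 (complex.Re z - complex.Re w).
have := sqr_ge0 (complex.Im z - complex.Im w).
nra.
Qed.

Lemma sqnormV (z : R[i]) : sqnorm z^-1 = (sqnorm z)^-1.
Proof.
have [->|z0] := eqVneq z 0.
  by rewrite invr0 /sqnorm /= expr0n addr0 invr0.
have : sqnorm z * sqnorm z^-1 = 1 by rewrite -sqnormM divff // sqnorm1.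
move=> e; have s0 : sqnorm z != 0.
  by apply: contra_eq_neq e => ->; rewrite mul0r eq_sym oner_eq0.
by apply: (mulfI s0); rewrite e divff.
Qed.

(* A rational [F = D + E] with [E] of norm at most [e] gives [1 - y = D / F] for
   [y = (E / e) (e / F)]; powers of the first factor stay bounded, those of the second
   become small by [power_small]. *)
Lemma cwiener_inv d h : L1 h -> d != 0 -> (forall t, d%:C + hat h t != 0) ->
  exists r, cwiener (fun t => (d%:C + hat h t)^-1) r.
Proof.
move=> L1h d0 nz; have [delta delta0 low] := hat_lower_bound L1h d0 nz.
(* The bound |d| / 2 keeps F - z e nonzero at infinity for z in the square; the bounds 1 and delta /
   16 give 8 e^2 < delta. *)
pose e := Num.min (`|d| / 2) (Num.min 1 (delta / 16)).
have e0 : 0 < e by rewrite !lt_min ltr01 !divr_gt0 // normr_gt0.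
have ed : e < `|d|.
  have : e <= `|d| / 2 by rewrite /e ge_min lexx.
  by have := d0; rewrite -normr_gt0; lra.
have esmall : 8 * e ^+ 2 < delta.
  have : e <= 1 by rewrite /e !ge_min lexx orbT.
  have : e <= delta / 16 by rewrite /e !ge_min lexx !orbT.
  by nra.
have [k [L1k [P [Q [Q0 PQ kPQ]]]] hk] := L1_approximable L1h e0.
pose D t := d%:C + hat h t; pose F t := d%:C + hat k t; pose E t := F t - D t.
have small : rwiener E e.
  exists 0, (fun u => k u - h u); split; first exact: L1B.
    by move=> t; rewrite rmorph0 add0r hatB // /E /F /D; ring.
  rewrite normr0 add0r -(norm1N (fun u => k u - h u)).
  by rewrite (_ : (fun u => _) = fun u => h u - k u) //; apply/funext => u; rewrite opprB.
have WE := rwiener_cwiener small.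
have sE t : sqnorm (E t) <= 2 * e ^+ 2.
  rewrite mulr_natl mulr2n; apply: lerD; rewrite -[leLHS]real_normK ?num_real //.
    by rewrite lerXn2r ?nnegrE ?(ltW e0) //; exact: rwiener_Re_le small.
  by rewrite lerXn2r ?nnegrE ?(ltW e0) //; exact: rwiener_Im_le small.
(* From delta <= |D|^2 <= 2 |F|^2 + 2 |E|^2 and |E|^2 <= 2 e^2. The result is exactly what places |e
   / F|^2 below 1/2. *)
have sF t : 2 * e ^+ 2 < sqnorm (F t).
  have := low t; rewrite -/(D t) (_ : D t = F t + - E t); last by rewrite /E; ring.
  by have := sqnormD_le (F t) (- E t); rewrite sqnormN; have := sE t; lra.
have nF t : F t != 0.
  by apply: contraTneq (sF t) => ->; rewrite /sqnorm /= expr0n addr0 -leNgt mulr_ge0 // sqr_ge0.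
pose x t := e%:C / F t.
have FE t : F t = (d%:C *: Q + P).[t%:C] / Q.[t%:C].
  by rewrite /F kPQ hornerD hornerZ mulrDl mulfK.
(* These are the resolvents of [x]. Numerator and denominator have the same size because [d] and d -
   z e are both nonzero. *)
have shifted z : `|complex.Re z| <= 1 -> `|complex.Im z| <= 1 ->
    exists M, cwiener (fun t => F t / (F t - z * e%:C)) M.
  move=> z1 z2.
  have sz : sqnorm (z * e%:C) <= 2 * e ^+ 2.
    rewrite sqnormM sqnorm_real ler_wpM2r ?sqr_ge0 // /sqnorm.
    have : `|complex.Re z| ^+ 2 <= 1 by rewrite expr_le1.
    have : `|complex.Im z| ^+ 2 <= 1 by rewrite expr_le1.
    by rewrite !real_normK ?num_real //; lra.
  have nFz t : F t - z * e%:C != 0.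
    by rewrite subr_eq0; apply: contraTneq (sF t) => ->; rewrite -leNgt.
  have dz : d%:C - z * e%:C != 0.
    rewrite subr_eq0; apply/eqP => /(congr1 (@complex.Re R)).
    rewrite !reim /= mulr0 subr0 => dE; move: ed; rewrite dE normrM (gtr0_norm e0).
    by rewrite ltNge ler_piMl // ltW.
  have Fz t : F t - z * e%:C = ((d%:C - z * e%:C) *: Q + P).[t%:C] / Q.[t%:C].
    rewrite FE !hornerD !hornerZ; field; exact: Q0.
  have sQ (a : R[i]) : (size (a *: Q + P)%R <= size Q)%N.
    apply: leq_trans (size_polyD _ _) _; rewrite geq_max (ltnW PQ) andbT.
    exact: size_scale_leq.
  have nz' t : ((d%:C - z * e%:C) *: Q + P).[t%:C] != 0.
    by apply: contraNneq (nFz t) => H; rewrite Fz H mul0r.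
  have [|M WM] := @cwiener_rational _ (d%:C *: Q + P) ((d%:C - z * e%:C) *: Q + P) nz'.
    by rewrite [leqRHS]size_polyDl ?size_scale.
  exists M; apply: cwiener_ext WM _ => t; rewrite Fz FE.
  by field; rewrite nz' Q0.
have [N WN] : exists N, cwiener x N.
  have [||M WM] := @cwiener_rational _ Q (d%:C *: Q + P).
  - by move=> t; apply: contraNneq (nF t) => H; rewrite FE H mul0r.
  - by rewrite size_polyDl ?size_scale // fmorph_eq0.
  exists (cnorm e%:C * M); apply: cwiener_ext (cwienerZ _ WM) _ => t.
  by rewrite /x FE invf_div.
have xsmall t : sqnorm (x t) < 2^-1.
  rewrite sqnormM sqnormV sqnorm_real ltr_pdivrMr; last first.
    by apply: le_lt_trans (sF t); rewrite mulr_ge0 ?sqr_ge0.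
  by have := sF t; lra.
have resolvent z : `|complex.Re z| <= 1 -> `|complex.Im z| <= 1 ->
    exists M, cwiener (fun t => (1 - z * x t)^-1) M.
  move=> z1 z2; have [M WM] := shifted z z1 z2; exists M.
  apply: cwiener_ext WM _ => t; rewrite /x.
  rewrite (_ : 1 - z * (e%:C / F t) = (F t - z * e%:C) / F t) ?invf_div //.
  by field; exact: nF.
have [m Wm] := power_small WN xsmall resolvent.
have eC : e%:C != 0 :> R[i] by rewrite fmorph_eq0 gt_eqF.
pose y t := (e%:C)^-1 * E t * x t.
have Wy := cwienerM (cwienerZ (e%:C)^-1 WE) WN.
have ce : cnorm (e%:C)^-1 = e^-1.
  by rewrite -fmorphV cnorm_real ger0_norm // invr_ge0 ltW.
(* The norm of E / e is at most 1, hence so is that of its powers, and the smallness of the power of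
   [x] passes to [y]. *)
have Wyn : cwiener (fun t => y t ^+ (2 ^ m)%N) 5^-1.
  have W1 := cwienerX (2 ^ m)%N (cwienerZ (e%:C)^-1 WE).
  rewrite ce mulVf ?gt_eqF // expr1n in W1.
  have := cwienerM W1 Wm; rewrite mul1r => /cwiener_ext; apply => t.
  by rewrite /y !exprMn.
have fifth : (5^-1 : R) < 1 by lra.
have [nzy [r Wr]] := cwiener_inv_power Wy fifth Wyn.
exists (cnorm (e%:C)^-1 * (N * r)).
apply: cwiener_ext (cwienerZ _ (cwienerM WN Wr)) _ => t.
have := nzy t; rewrite -/(D t) (_ : 1 - _ = D t / F t).
  move=> ?; rewrite invf_div /x; field.
  by apply/and3P; split; [exact: nz|exact: nF|exact: eC].
rewrite /x /E; field.
by apply/andP; split; [exact: nF|exact: eC].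
Qed.

(* The inverse inherits the symmetry [g (- t) = (g t)^*] of transforms of real
   functions, so that its imaginary component drops out. *)
Lemma wiener_lemma d h : L1 h -> d != 0 -> (forall t, d%:C + hat h t != 0) ->
  exists c k, L1 k /\ forall t, (d%:C + hat h t) * (c%:C + hat k t) = 1.
Proof.
move=> L1h d0 nz; have [r [g1 [g2 [r1 [r2 [W1 W2 e _]]]]]] := cwiener_inv L1h d0 nz.
have [c1 [h1 [L1h1 e1 _]]] := W1; have [c2 [h2 [L1h2 e2 _]]] := W2.
exists c1, h1; split => // t.
have hat_conj k s : L1 k -> hat k (- s) = conjc (hat k s).
  move=> L1k; apply: complexP => /=.
    by apply: eq_Rintegral => u _; rewrite mulNr cosN.
  rewrite -mulN1r -RintegralZl //; last exact: L1_sinM.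
  by apply: eq_Rintegral => u _; rewrite mulNr sinN; ring.
have eq1 : (d%:C + hat h t) * (g1 t + 'i * g2 t) = 1 by rewrite -e divff.
(* Conjugate the identity at - t: transforms of real data return to their values at t, while ['i]
   changes sign. *)
have eq2 : (d%:C + hat h t) * (g1 t - 'i * g2 t) = 1.
  have := divff (nz (- t)); rewrite e !e1 !e2 !hat_conj //.
  case: (hat h t) (hat h1 t) (hat h2 t) => [a a'] [b b'] [p p'] E.
  apply: complexP.
    by apply: etrans (congr1 (@complex.Re R) E); rewrite !reim /=; ring.
  have /esym e0 := etrans (congr1 (fun z : R[i] => - complex.Im z) E) (oppr0 R).
  by apply: etrans (esym e0); rewrite !reim /=; ring.
rewrite -e1.
have : (d%:C + hat h t) * (g1 t + 'i * g2 t) + (d%:C + hat h t) * (g1 t - 'i * g2 t) = 2.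
  by rewrite eq1 eq2.
rewrite -mulrDr addrACA subrr addr0 -mulr2n mulrnAr => /eqP.
by rewrite -[2]/(1 *+ 2) eqrMn2r => /eqP.
Qed.

End WienerLemma.

(** * Quaternionic transforms and the determinant *)

Section Transform.
Context {R : realType}.
Local Notation mu := (@lebesgue_measure R).
Implicit Types (f g : R -> quat R) (c i j p q : quat R) (t u v : R) (F G : wiener R).

Definition coordL1 f := [/\ L1 (fun u => q0 (f u)), L1 (fun u => q1 (f u)),
  L1 (fun u => q2 (f u)) & L1 (fun u => q3 (f u))].

Lemma qL1_coordL1 f : qL1 f -> coordL1 f.
Proof.
move=> [[m0 m1 m2 m3] fin].
have mn : measurable_fun setT (fun u => qnorm (f u)).
  rewrite /qnorm; apply: measurableT_comp.
    exact: continuous_measurable_fun (@sqrt_continuous R).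
  by do 3 (apply: measurable_funD; last exact: measurable_funX); exact: measurable_funX.
have L1n : L1 (fun u => qnorm (f u)).
  apply/integrableP; split; first exact/measurable_EFinP.
  by under eq_integral do rewrite /= ger0_norm ?sqrtr_ge0 //.
have le (pi : quat R -> R) : measurable_fun setT (fun u => pi (f u)) ->
    (forall q, pi q ^+ 2 <= q0 q ^+ 2 + q1 q ^+ 2 + q2 q ^+ 2 + q3 q ^+ 2) ->
    L1 (fun u => pi (f u)).
  move=> mpi piq; apply: (L1_le mpi L1n) => u.
  by rewrite [leRHS]ger0_norm ?sqrtr_ge0 // -sqrtr_sqr ler_wsqrtr.
split; apply: le => // q; have := sqr_ge0 (q0 q); have := sqr_ge0 (q1 q);
  have := sqr_ge0 (q2 q); have := sqr_ge0 (q3 q); lra.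
Qed.

Lemma coordL1_qL1 f : coordL1 f -> qL1 f.
Proof.
move=> [H0 H1 H2 H3];
  have := (L1_measurable H0, L1_measurable H1, L1_measurable H2, L1_measurable H3).
move=> [[[m0 m1] m2] m3].
split; first by split.
pose k u := `|q0 (f u)| + `|q1 (f u)| + `|q2 (f u)| + `|q3 (f u)|.
have L1k : L1 k by do 3 (apply: L1D; last exact: L1_abs); exact: L1_abs.
have mn : measurable_fun setT (fun u => qnorm (f u)).
  rewrite /qnorm; apply: measurableT_comp.
    exact: continuous_measurable_fun (@sqrt_continuous R).
  by do 3 (apply: measurable_funD; last exact: measurable_funX); exact: measurable_funX.
have : L1 (fun u => qnorm (f u)).
  apply: (L1_le mn L1k) => u; rewrite !ger0_norm ?sqrtr_ge0 ?addr_ge0 //.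
  rewrite -[leRHS]ger0_norm ?addr_ge0 // -sqrtr_sqr ler_wsqrtr // /k.
  rewrite -(real_normK (num_real (q0 (f u)))) -(real_normK (num_real (q1 (f u)))).
  rewrite -(real_normK (num_real (q2 (f u)))) -(real_normK (num_real (q3 (f u)))).
  move: (normr_ge0 (q0 (f u))) (normr_ge0 (q1 (f u))) (normr_ge0 (q2 (f u))) (normr_ge0 (q3 (f u))).
  by move: `|_| `|_| `|_| `|_| => a b a' b'; nra.
case/integrableP => _; apply: le_lt_trans; apply: ge0_le_integral => //.
- by move=> u _; rewrite lee_fin sqrtr_ge0.
- exact/measurable_EFinP.
- by apply: measurableT_comp => //; exact/measurable_EFinP.
- by move=> u _; rewrite /= lee_fin ler_norm.
Qed.

(** [pi] is a general functional and not only a coordinate: the entries of [chi] involve q0 (q i),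
    q0 (q j) and q0 (q (i j)). *)
Definition transform (pi : quat R -> R) c f t : R[i] :=
  (pi c)%:C + hat (fun u => pi (f u)) t.

Definition qcos c f t := Quat (complex.Re (transform (@q0 R) c f t))
  (complex.Re (transform (@q1 R) c f t)) (complex.Re (transform (@q2 R) c f t))
  (complex.Re (transform (@q3 R) c f t)).

Definition qsin c f t := Quat (complex.Im (transform (@q0 R) c f t))
  (complex.Im (transform (@q1 R) c f t)) (complex.Im (transform (@q2 R) c f t))
  (complex.Im (transform (@q3 R) c f t)).

Lemma Rintegral_lin (a b0 b1 b2 b3 : R -> R) (x0 x1 x2 x3 : R) :
  L1 a -> L1 b0 -> L1 b1 -> L1 b2 -> L1 b3 ->
  \int[mu]_u (a u + (x0 * b0 u + x1 * b1 u + x2 * b2 u + x3 * b3 u)) =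
  \int[mu]_u a u + (x0 * \int[mu]_u b0 u + x1 * \int[mu]_u b1 u +
    x2 * \int[mu]_u b2 u + x3 * \int[mu]_u b3 u).
Proof.
move=> La L0 L1' L2 L3.
have [Z0 Z1 Z2 Z3] := And4 (L1Z x0 L0) (L1Z x1 L1') (L1Z x2 L2) (L1Z x3 L3).
have Z01 := L1D Z0 Z1; have Z012 := L1D Z01 Z2; have Z0123 := L1D Z012 Z3.
by rewrite !RintegralD // !RintegralZl.
Qed.

Lemma qlaplace_imag c f i t : qsphere R i -> coordL1 f ->
  qlaplace c f (t *: i) = qcos c f t + i * qsin c f t.
Proof.
move=> Si [H0 H1 H2 H3].
have e u : qexp (u *: (t *: i)) * f u =
    cos (t * u) *: f u + sin (t * u) *: (i * f u).
  rewrite scalerA qexp_imag // mulrC /qembed /expi /=.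
  by rewrite mulrDl -!scalerAl mul1r.
rewrite /qlaplace (_ : (fun u => _) = fun u =>
  cos (t * u) *: f u + sin (t * u) *: (i * f u)); last exact/funext.
have [C0 C1 C2 C3] := And4 (L1_cosM t H0) (L1_cosM t H1) (L1_cosM t H2) (L1_cosM t H3).
have [S0 S1 S2 S3] := And4 (L1_sinM t H0) (L1_sinM t H1) (L1_sinM t H2) (L1_sinM t H3).
apply: quatP => /=; rewrite !add0r -?addrA; congr (_ + _).
- have := @Rintegral_lin _ _ _ _ _ (q0 i) (- q1 i) (- q2 i) (- q3 i) C0 S0 S1 S2 S3.
  rewrite !mulNr !addrA => <-.
  by apply: eq_Rintegral => u _; ring.
- have := @Rintegral_lin _ _ _ _ _ (q0 i) (q1 i) (q2 i) (- q3 i) C1 S1 S0 S3 S2.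
  rewrite !mulNr !addrA => <-.
  by apply: eq_Rintegral => u _; ring.
- have := @Rintegral_lin _ _ _ _ _ (q0 i) (- q1 i) (q2 i) (q3 i) C2 S2 S3 S0 S1.
  rewrite !mulNr !addrA => <-.
  by apply: eq_Rintegral => u _; ring.
- have := @Rintegral_lin _ _ _ _ _ (q0 i) (q1 i) (- q2 i) (q3 i) C3 S3 S2 S1 S0.
  rewrite !mulNr !addrA => <-.
  by apply: eq_Rintegral => u _; ring.
Qed.

Definition qdet c f t := transform (@q0 R) c f t ^+ 2 + transform (@q1 R) c f t ^+ 2
  + transform (@q2 R) c f t ^+ 2 + transform (@q3 R) c f t ^+ 2.

(* Gram: [(a x b, z)^2] is the Gram determinant of [a], [b], [z]; for orthonormal
   [a], [b] this gives [(a, z)^2 + (b, z)^2 + (a x b, z)^2 = (z, z)]. *)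
Lemma gram_orthonormal (K : comNzRingType) (a1 a2 a3 b1 b2 b3 z1 z2 z3 : K) :
  a1 ^+ 2 + a2 ^+ 2 + a3 ^+ 2 = 1 -> b1 ^+ 2 + b2 ^+ 2 + b3 ^+ 2 = 1 ->
  a1 * b1 + a2 * b2 + a3 * b3 = 0 ->
  (a1 * z1 + a2 * z2 + a3 * z3) ^+ 2 + (b1 * z1 + b2 * z2 + b3 * z3) ^+ 2 +
  ((a2 * b3 - a3 * b2) * z1 + (a3 * b1 - a1 * b3) * z2 + (a1 * b2 - a2 * b1) * z3) ^+ 2 =
  z1 ^+ 2 + z2 ^+ 2 + z3 ^+ 2.
Proof.
move=> aa bb ab.
set s := _ + _ + _ in aa; set s' := _ + _ + _ in bb; set s'' := _ + _ + _ in ab.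
pose za := a1 * z1 + a2 * z2 + a3 * z3; pose zb := b1 * z1 + b2 * z2 + b3 * z3.
transitivity (za ^+ 2 * (1 - s') + zb ^+ 2 * (1 - s) +
  (s * s' - s'' ^+ 2) * (z1 ^+ 2 + z2 ^+ 2 + z3 ^+ 2) + 2 * s'' * za * zb).
  by rewrite /za /zb /s /s' /s''; ring.
by rewrite aa bb ab; ring.
Qed.

Lemma det_mx2 (K : comNzRingType) (A : 'M[K]_2) :
  \det A = A ord0 ord0 * A ord_max ord_max - A ord0 ord_max * A ord_max ord0.
Proof.
rewrite (expand_det_row _ ord0) !big_ord_recl big_ord0 addr0 /cofactor !det_mx11 !mxE /=.
have -> : lift ord0 ord0 = ord_max :> 'I_2 by exact: val_inj.
have -> : lift (ord_max : 'I_2) 0 = ord0 by exact: val_inj.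
by rewrite /bump /= expr0 expr1 mul1r mulN1r mulrN.
Qed.

Lemma transform_lin (pi : quat R -> R) (l0 l1 l2 l3 : R) c f t :
  (forall q, pi q = l0 * q0 q + l1 * q1 q + l2 * q2 q + l3 * q3 q) -> coordL1 f ->
  L1 (fun u => pi (f u)) /\
  transform pi c f t = l0%:C * transform (@q0 R) c f t + l1%:C * transform (@q1 R) c f t +
    l2%:C * transform (@q2 R) c f t + l3%:C * transform (@q3 R) c f t.
Proof.
move=> piE [H0 H1 H2 H3].
have [Z0 Z1 Z2 Z3] := And4 (L1Z l0 H0) (L1Z l1 H1) (L1Z l2 H2) (L1Z l3 H3).
have Z01 := L1D Z0 Z1; have Z012 := L1D Z01 Z2; have Z0123 := L1D Z012 Z3.
have e : (fun u => pi (f u)) =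
    fun u => l0 * q0 (f u) + l1 * q1 (f u) + l2 * q2 (f u) + l3 * q3 (f u).
  by apply/funext => u; exact: piE.
rewrite /transform e; split => //.
rewrite !hatD // !hatZ // piE !rmorphD !rmorphM /=; ring.
Qed.

Lemma cint_hat (x y : R -> R) t : L1 x -> L1 y ->
  cint (fun u => expi (t * u) * Complex (x u) (y u)) = hat x t + 'i * hat y t.
Proof.
move=> Lx Ly.
have [Cx Cy] := (L1_cosM t Lx, L1_cosM t Ly); have [Sx Sy] := (L1_sinM t Lx, L1_sinM t Ly).
apply: complexP; rewrite !reim /= mul0r mul1r.
  by rewrite sub0r -RintegralB //.
by rewrite add0r addrC -RintegralD //.
Qed.

(** In the orthonormal basis 1, i, j, ij with transformed coordinates z0, A, B, N, the matrix has
    rows (z0 + 'i A, B + 'i N) and (- B + 'i N, z0 - 'i A). Its determinant z0^2 + A^2 + B^2 + N^2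
    is a bilinear, not Hermitian, sum of squares, and a real orthonormal change of basis preserves
    it. *)
Lemma det_womega i j F t : qsphere R i -> qsphere R j -> qorthogonal i j ->
  \det (womega i j F t) = qdet (wcst F) (wdens F) t.
Proof.
move=> Si Sj ij; have fL1 := qL1_coordL1 (wdens_L1 F).
have o := qorthogonalE Si Sj ij.
have [i0 ii] := (qsphereE i).1 Si; have [j0 jj] := (qsphereE j).1 Sj.
set c := wcst F; set f := wdens F in fL1 *.
pose n1 := q2 i * q3 j - q3 i * q2 j; pose n2 := q3 i * q1 j - q1 i * q3 j.
pose n3 := q1 i * q2 j - q2 i * q1 j.
have T0 := @transform_lin (@q0 R) 1 0 0 0 c f t _ fL1.
have T0' := @transform_lin (fun q => q0 (q * i)) 0 (- q1 i) (- q2 i) (- q3 i) c f t _ fL1.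
have T00 := @transform_lin (fun q => - q0 (q * i)) 0 (q1 i) (q2 i) (q3 i) c f t _ fL1.
have T1 := @transform_lin (fun q => - q0 (q * j)) 0 (q1 j) (q2 j) (q3 j) c f t _ fL1.
have T1' := @transform_lin (fun q => q0 (q * j)) 0 (- q1 j) (- q2 j) (- q3 j) c f t _ fL1.
have T2 := @transform_lin (fun q => - q0 (q * (i * j))) 0 n1 n2 n3 c f t _ fL1.
have {T0'} [|L0' T0'] := T0'; first by move=> q /=; rewrite i0; ring.
have {T00} [|L00 T00] := T00; first by move=> q /=; rewrite i0; ring.
have {T1} [|L1' T1] := T1; first by move=> q /=; rewrite j0; ring.
have {T1'} [|L1'' T1'] := T1'; first by move=> q /=; rewrite j0; ring.
have {T2} [|L2 T2] := T2.
  move=> q /=; rewrite i0 j0 /n1 /n2 /n3.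
  by have := congr1 ( *%R (q0 q)) o; lra.
have {T0} [|L0 _] := T0; first by move=> q /=; ring.
have entry a b (pi rho : quat R -> R) : (forall q, chi i j q a b = Complex (pi q) (rho q)) ->
    L1 (fun u => pi (f u)) -> L1 (fun u => rho (f u)) ->
    womega i j F t a b = transform pi c f t + 'i * transform rho c f t.
  move=> chiE Lpi Lrho; rewrite mxE [X in _ + X]mxE.
  have -> : (fun u => (expi (t * u) *: chi i j (wdens F u)) a b) =
      fun u => expi (t * u) * Complex (pi (f u)) (rho (f u)).
    by apply/funext => u; rewrite mxE chiE.
  rewrite cint_hat // /transform chiE.
  rewrite (_ : Complex (pi _) (rho _) = (pi c)%:C + 'i * (rho c)%:C); first by ring.
  by apply: complexP; rewrite !reim /=; ring.
have c00 q : chi i j q ord0 ord0 = Complex (q0 q) (- q0 (q * i)) by rewrite mxE.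
have c01 q : chi i j q ord0 ord_max = Complex (- q0 (q * j)) (- q0 (q * (i * j))).
  by rewrite mxE.
have c10 q : chi i j q ord_max ord0 = Complex (q0 (q * j)) (- q0 (q * (i * j))).
  by rewrite mxE; apply: complexP => /=; ring.
have c11 q : chi i j q ord_max ord_max = Complex (q0 q) (q0 (q * i)).
  by rewrite mxE; apply: complexP => /=; ring.
rewrite det_mx2 (@entry _ _ (@q0 R) (fun q => - q0 (q * i)) c00) //.
rewrite (@entry _ _ (fun q => - q0 (q * j)) (fun q => - q0 (q * (i * j))) c01) //.
rewrite (@entry _ _ (fun q => q0 (q * j)) (fun q => - q0 (q * (i * j))) c10) //.
rewrite (@entry _ _ (@q0 R) (fun q => q0 (q * i)) c11) // T0' T00 T1 T1' T2.
move/(congr1 (real_complex R)): o; move/(congr1 (real_complex R)): ii.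
move/(congr1 (real_complex R)): jj.
rewrite !(rmorphD, rmorphM, rmorphXn, rmorph0, rmorph1) /= => jj' ii' o'.
rewrite /qdet -/c -/f; clear T0' T00 T1 T1' T2 entry.
rewrite /n1 /n2 /n3 !(rmorphB, rmorphN, rmorphM) /=.
move: (transform (@q0 R) c f t) (transform (@q1 R) c f t) (transform (@q2 R) c f t)
  (transform (@q3 R) c f t) => z0 z1 z2 z3.
have gram := gram_orthonormal z1 z2 z3 ii' jj' o'.
have I2 : 'i ^+ 2 = -1 :> R[i] by apply: complexP; rewrite expr2 !reim /=; ring.
move: (q1 i)%:C (q2 i)%:C (q3 i)%:C (q1 j)%:C (q2 j)%:C (q3 j)%:C gram I2.
move=> a1 a2 a3 b1 b2 b3 gram I2.
pose A := a1 * z1 + a2 * z2 + a3 * z3; pose B := b1 * z1 + b2 * z2 + b3 * z3.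
pose N := (a2 * b3 - a3 * b2) * z1 + (a3 * b1 - a1 * b3) * z2 + (a1 * b2 - a2 * b1) * z3.
transitivity (z0 ^+ 2 - 'i ^+ 2 * (A ^+ 2 + N ^+ 2) + B ^+ 2).
  by rewrite /A /B /N; ring.
transitivity (z0 ^+ 2 + (A ^+ 2 + B ^+ 2 + N ^+ 2)); first by rewrite I2; ring.
by rewrite /A /B /N gram; ring.
Qed.

End Transform.

(** * Zeros on the sphere of imaginary units *)

Section Zeros.
Context {R : realType}.
Implicit Types (f g : R -> quat R) (c i j p q : quat R) (t u v : R) (F G : wiener R).

Lemma qdet_coord c f t :
  complex.Re (qdet c f t) =
    (q0 (qcos c f t) ^+ 2 + q1 (qcos c f t) ^+ 2 + q2 (qcos c f t) ^+ 2 + q3 (qcos c f t) ^+ 2)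
    - (q0 (qsin c f t) ^+ 2 + q1 (qsin c f t) ^+ 2 + q2 (qsin c f t) ^+ 2 + q3 (qsin c f t) ^+ 2)
  /\ complex.Im (qdet c f t) =
    2 * (q0 (qcos c f t) * q0 (qsin c f t) + q1 (qcos c f t) * q1 (qsin c f t) +
         q2 (qcos c f t) * q2 (qsin c f t) + q3 (qcos c f t) * q3 (qsin c f t)).
Proof.
rewrite /qdet /qcos /qsin.
move: (transform (@q0 R) c f t) (transform (@q1 R) c f t) (transform (@q2 R) c f t)
  (transform (@q3 R) c f t) => [a a'] [b b'] [d d'] [e e'].
by rewrite !expr2 !reim /=; split; ring.
Qed.

(* For [S != 0] the unit is [- C S^-1]: the hypotheses say that it has norm one and no
   real part. *)
Lemma zero_on_sphere (C S : quat R) :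
  (q0 C ^+ 2 + q1 C ^+ 2 + q2 C ^+ 2 + q3 C ^+ 2 =
     q0 S ^+ 2 + q1 S ^+ 2 + q2 S ^+ 2 + q3 S ^+ 2 /\
   q0 C * q0 S + q1 C * q1 S + q2 C * q2 S + q3 C * q3 S = 0) <->
  exists2 i, qsphere R i & C + i * S = 0.
Proof.
split=> [[n o]|[i Si e]]; last first.
  have [i0 ii] := (qsphereE i).1 Si.
  have -> : C = - (i * S) by apply/eqP; rewrite -addr_eq0 e.
  case: i i0 ii {Si e} => _ a1 a2 a3 /= -> ii; case: S => s0 s1 s2 s3 /=.
  split; last by ring.
  by transitivity ((a1 ^+ 2 + a2 ^+ 2 + a3 ^+ 2) * (s0 ^+ 2 + s1 ^+ 2 + s2 ^+ 2 + s3 ^+ 2));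
    [ring|rewrite ii mul1r].
pose N := q0 S ^+ 2 + q1 S ^+ 2 + q2 S ^+ 2 + q3 S ^+ 2.
have [N0|N0] := eqVneq N 0.
  have z (s : quat R) : q0 s ^+ 2 + q1 s ^+ 2 + q2 s ^+ 2 + q3 s ^+ 2 = 0 -> s = 0.
    move=> /eqP; rewrite !paddr_eq0 ?addr_ge0 ?sqr_ge0 // !sqrf_eq0.
    by move=> /andP[/andP[/andP[/eqP ? /eqP ?] /eqP ?] /eqP ?]; exact: quatP.
  exists (Quat 0 1 0 0); first by apply/qsphereE => /=; split => //; ring.
  have S0 : S = 0 by exact: z.
  have C0 : C = 0 by apply: z; rewrite n.
  by rewrite C0 S0 mulr0 addr0.
move: n o N0; rewrite /N; case: C => c0 c1 c2 c3; case: S {N} => s0 s1 s2 s3 /= n o N0.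
set N := s0 ^+ 2 + s1 ^+ 2 + s2 ^+ 2 + s3 ^+ 2 in n N0.
have NE : N = s0 ^+ 2 + s1 ^+ 2 + s2 ^+ 2 + s3 ^+ 2 by [].
move: N NE n N0 => N NE n N0.
exists (Quat 0 (- (- c0 * s1 + c1 * s0 - c2 * s3 + c3 * s2) / N)
  (- (- c0 * s2 + c1 * s3 + c2 * s0 - c3 * s1) / N)
  (- (- c0 * s3 - c1 * s2 + c2 * s1 + c3 * s0) / N)).
  apply/qsphereE => /=; split=> //.
  transitivity (((c0 ^+ 2 + c1 ^+ 2 + c2 ^+ 2 + c3 ^+ 2) * (s0 ^+ 2 + s1 ^+ 2 + s2 ^+ 2 + s3 ^+ 2)
     - (c0 * s0 + c1 * s1 + c2 * s2 + c3 * s3) ^+ 2) / N ^+ 2); first by field.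
  by rewrite -NE n o; field.
have coord (x c s : R) : x * N = c * (N - (s0 ^+ 2 + s1 ^+ 2 + s2 ^+ 2 + s3 ^+ 2)) +
    (c0 * s0 + c1 * s1 + c2 * s2 + c3 * s3) * s -> x = 0.
  by move=> xN; apply: (mulIf N0); rewrite xN o -NE; ring.
apply: quatP => /=.
- by apply: (coord _ c0 s0); field.
- by apply: (coord _ c1 s1); field.
- by apply: (coord _ c2 s2); field.
- by apply: (coord _ c3 s3); field.
Qed.

End Zeros.

(** * The transform of the star product *)

Section ConvolutionSum.
Context {R : realType}.
Local Notation mu := (@lebesgue_measure R).

Lemma hat_ae_eq (h k : R -> R) : measurable_fun setT h -> L1 k ->
  {ae mu, forall u : measurableTypeR R, h u = k u} ->
  L1 h /\ forall t, hat h t = hat k t.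
Proof.
move=> mh L1k hk; have mk := L1_measurable L1k.
have L1h : L1 h.
  apply/integrableP; split; first exact/measurable_EFinP.
  have [_] := (integrableP _ _ _ L1k); apply: le_lt_trans.
  rewrite le_eqVlt; apply/orP; left; apply/eqP; apply: ae_eq_integral => //.
  - by apply: measurableT_comp => //; exact/measurable_EFinP.
  - by apply: measurableT_comp => //; exact/measurable_EFinP.
  - by apply: filterS hk => u /= -> _.
split => // t.
have eqw (w : R -> R) : measurable_fun setT w ->
    \int[mu]_u (w u * h u) = \int[mu]_u (w u * k u).
  move=> mw; rewrite /Rintegral; congr fine; apply: ae_eq_integral => //.
  - by apply/measurable_EFinP; exact: measurable_funM.
  - by apply/measurable_EFinP; exact: measurable_funM.
  - by apply: filterS hk => u -> _.
apply: complexP => /=; apply: eqw; [exact: measurable_cosM|exact: measurable_sinM].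
Qed.

(** A coordinate of [qconv] is one integral of four products. It splits into four convolutions only
    where all four sections are integrable, that is almost everywhere, which is enough for the
    transforms. *)
Lemma hat_conv_sum (a0 a1 a2 a3 b0 b1 b2 b3 : R -> R) :
  L1 a0 -> L1 a1 -> L1 a2 -> L1 a3 -> L1 b0 -> L1 b1 -> L1 b2 -> L1 b3 ->
  let h u := \int[mu]_v (a0 (u - v) * b0 v + a1 (u - v) * b1 v +
                         a2 (u - v) * b2 v + a3 (u - v) * b3 v) in
  L1 h /\ forall t, hat h t = hat a0 t * hat b0 t + hat a1 t * hat b1 t +
                             hat a2 t * hat b2 t + hat a3 t * hat b3 t.
Proof.
move=> A0 A1 A2 A3 B0 B1 B2 B3 h.
have K0 := integrable_kernel measurable_fun1 normr1_le1 A0 B0.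
have K1 := integrable_kernel measurable_fun1 normr1_le1 A1 B1.
have K2 := integrable_kernel measurable_fun1 normr1_le1 A2 B2.
have K3 := integrable_kernel measurable_fun1 normr1_le1 A3 B3.
have K := integrableD measurableT (integrableD measurableT (integrableD measurableT K0 K1) K2) K3.
have [C0 C1 C2 C3] := And4 (L1_conv A0 B0) (L1_conv A1 B1) (L1_conv A2 B2) (L1_conv A3 B3).
have C01 := L1D C0 C1; have C012 := L1D C01 C2; have C0123 := L1D C012 C3.
have [||L1h e] := hat_ae_eq _ C0123 _ (h := h).
(* Measurability of [h] comes from Fubini for the sum of the kernels, not from the splitting. *)
- have mF := measurableT_comp (@fine_measurable R setT measurableT) (measurable_fubini_F K).
  move: mF; congr (measurable_fun _ _); apply/funext => u.
  rewrite /h /fubini_F /Rintegral /=; congr fine.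
  by apply: eq_integral => v _; rewrite /kernel /= !mul1r.
- have sections (a b : R -> R) : L1 a -> L1 b ->
      {ae mu, forall u : measurableTypeR R, L1 (fun v => a (u - v) * b v)}.
    move=> La Lb; have /ae_integrable1 := integrable_kernel measurable_fun1 normr1_le1 La Lb.
    apply: filterS => u iK.
    by apply: eq_integrable iK => // v _; rewrite /kernel /= mul1r.
  pose aeI := @filterI _ (almost_everywhere mu) (ae_filter_ringOfSetsType mu).
  have := aeI _ _ (aeI _ _ (sections _ _ A0 B0) (sections _ _ A1 B1))
    (aeI _ _ (sections _ _ A2 B2) (sections _ _ A3 B3)).
  apply: filterS => u [[J0 J1] [J2 J3]].
  have J01 := L1D J0 J1; have J012 := L1D J01 J2.
  by rewrite /h (RintegralD _ J012 J3) // (RintegralD _ J01 J2) // (RintegralD _ J0 J1).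
split => // t; rewrite e (hatD _ C012 C3) (hatD _ C01 C2) (hatD _ C0 C1).
by rewrite !hat_conv.
Qed.

End ConvolutionSum.

Section StarProduct.
Context {R : realType}.
Local Notation mu := (@lebesgue_measure R).
Implicit Types (c i j p q : quat R) (t u v : R) (F G : wiener R).

(** The common shape of the four real coordinates of a star product, once the signs of quaternion
    multiplication are absorbed into the left factor. *)
Lemma hat_star (a0 a1 a2 a3 b0 b1 b2 b3 : R -> R) (x0 x1 x2 x3 y0 y1 y2 y3 : R) :
  L1 a0 -> L1 a1 -> L1 a2 -> L1 a3 -> L1 b0 -> L1 b1 -> L1 b2 -> L1 b3 ->
  let k u := (x0 * b0 u + x1 * b1 u + x2 * b2 u + x3 * b3 u)
    + (y0 * a0 u + y1 * a1 u + y2 * a2 u + y3 * a3 u)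
    + \int[mu]_v (a0 (u - v) * b0 v + a1 (u - v) * b1 v +
                  a2 (u - v) * b2 v + a3 (u - v) * b3 v) in
  L1 k /\ forall t, (x0 * y0 + x1 * y1 + x2 * y2 + x3 * y3)%:C + hat k t =
    (x0%:C + hat a0 t) * (y0%:C + hat b0 t) + (x1%:C + hat a1 t) * (y1%:C + hat b1 t) +
    (x2%:C + hat a2 t) * (y2%:C + hat b2 t) + (x3%:C + hat a3 t) * (y3%:C + hat b3 t).
Proof.
move=> A0 A1 A2 A3 B0 B1 B2 B3 k.
have [Lh hatC] := hat_conv_sum A0 A1 A2 A3 B0 B1 B2 B3.
have lin (f0 f1 f2 f3 : R -> R) (z0 z1 z2 z3 : R) : L1 f0 -> L1 f1 -> L1 f2 -> L1 f3 ->
    L1 (fun u => z0 * f0 u + z1 * f1 u + z2 * f2 u + z3 * f3 u) /\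
    forall t, hat (fun u => z0 * f0 u + z1 * f1 u + z2 * f2 u + z3 * f3 u) t =
      z0%:C * hat f0 t + z1%:C * hat f1 t + z2%:C * hat f2 t + z3%:C * hat f3 t.
  move=> F0 F1 F2 F3.
  have [Z0 Z1 Z2 Z3] := And4 (L1Z z0 F0) (L1Z z1 F1) (L1Z z2 F2) (L1Z z3 F3).
  have Z01 := L1D Z0 Z1; have Z012 := L1D Z01 Z2; split; first exact: L1D Z012 Z3.
  by move=> t; rewrite (hatD _ Z012 Z3) (hatD _ Z01 Z2) (hatD _ Z0 Z1) !hatZ.
have [Lb hatb] := lin _ _ _ _ x0 x1 x2 x3 B0 B1 B2 B3.
have [La hata] := lin _ _ _ _ y0 y1 y2 y3 A0 A1 A2 A3.
have Lba := L1D Lb La; split; first exact: L1D Lba Lh.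
move=> t; rewrite (hatD _ Lba Lh) (hatD _ Lb La) hatb hata hatC.
by rewrite !(rmorphD, rmorphM) /=; ring.
Qed.

Definition star_dens F G u :=
  wcst F * wdens G u + wdens F u * wcst G + qconv (wdens F) (wdens G) u.

Lemma transform_star_coord F G (pi l0 l1 l2 l3 : quat R -> R) :
  (forall p q, pi (p + q) = pi p + pi q) ->
  (forall p q, pi (p * q) = l0 p * q0 q + l1 p * q1 q + l2 p * q2 q + l3 p * q3 q) ->
  (forall h : R -> quat R, pi (qint h) = \int[mu]_u pi (h u)) ->
  L1 (fun u => l0 (wdens F u)) -> L1 (fun u => l1 (wdens F u)) ->
  L1 (fun u => l2 (wdens F u)) -> L1 (fun u => l3 (wdens F u)) ->
  L1 (fun u => pi (star_dens F G u)) /\ forall t,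
  transform pi (wcst F * wcst G) (star_dens F G) t =
    transform l0 (wcst F) (wdens F) t * transform (@q0 R) (wcst G) (wdens G) t +
    transform l1 (wcst F) (wdens F) t * transform (@q1 R) (wcst G) (wdens G) t +
    transform l2 (wcst F) (wdens F) t * transform (@q2 R) (wcst G) (wdens G) t +
    transform l3 (wcst F) (wdens F) t * transform (@q3 R) (wcst G) (wdens G) t.
Proof.
move=> piD piM piI F0 F1 F2 F3; have [G0 G1 G2 G3] := qL1_coordL1 (wdens_L1 G).
have [K e] := hat_star (l0 (wcst F)) (l1 (wcst F)) (l2 (wcst F)) (l3 (wcst F))
  (q0 (wcst G)) (q1 (wcst G)) (q2 (wcst G)) (q3 (wcst G)) F0 F1 F2 F3 G0 G1 G2 G3.
set k := (X in L1 X) in K.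
have E : (fun u => pi (star_dens F G u)) = k.
  apply/funext => u; rewrite /star_dens /qconv !piD !piM piI /k; congr (_ + _ + _).
    by rewrite ![q0 _ * l0 _]mulrC ![q1 _ * l1 _]mulrC ![q2 _ * l2 _]mulrC ![q3 _ * l3 _]mulrC.
  by apply: eq_Rintegral => v _; rewrite piM.
by rewrite /transform E piM; split.
Qed.

Lemma transform_opp (pi : quat R -> R) c (f : R -> quat R) t : L1 (fun u => pi (f u)) ->
  transform (fun q => - pi q) c f t = - transform pi c f t.
Proof. by move=> Lpi; rewrite /transform hatN // rmorphN opprD. Qed.

(** The four transforms form a multiplicative map into functions of [t] with values in the
    complexified quaternions. *)
Lemma transform_star F G : coordL1 (star_dens F G) /\ forall t,
  let A pi := transform pi (wcst F) (wdens F) t in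
  let B pi := transform pi (wcst G) (wdens G) t in
  let C pi := transform pi (wcst F * wcst G) (star_dens F G) t in
  [/\ C (@q0 R) = A (@q0 R) * B (@q0 R) - A (@q1 R) * B (@q1 R)
        - A (@q2 R) * B (@q2 R) - A (@q3 R) * B (@q3 R),
      C (@q1 R) = A (@q0 R) * B (@q1 R) + A (@q1 R) * B (@q0 R)
        + A (@q2 R) * B (@q3 R) - A (@q3 R) * B (@q2 R),
      C (@q2 R) = A (@q0 R) * B (@q2 R) - A (@q1 R) * B (@q3 R)
        + A (@q2 R) * B (@q0 R) + A (@q3 R) * B (@q1 R) &
      C (@q3 R) = A (@q0 R) * B (@q3 R) + A (@q1 R) * B (@q2 R)
        - A (@q2 R) * B (@q1 R) + A (@q3 R) * B (@q0 R)].
Proof.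
have [F0 F1 F2 F3] := qL1_coordL1 (wdens_L1 F).
have [N1 N2 N3] := And3 (L1N F1) (L1N F2) (L1N F3).
have [||//|K0 e0] := @transform_star_coord F G (@q0 R) (@q0 R) (fun q => - q1 q)
  (fun q => - q2 q) (fun q => - q3 q) _ _ _ F0 N1 N2 N3.
- by [].
- by move=> p q /=; ring.
have [||//|K1 e1] := @transform_star_coord F G (@q1 R) (@q1 R) (@q0 R)
  (fun q => - q3 q) (@q2 R) _ _ _ F1 F0 N3 F2.
- by [].
- by move=> p q /=; ring.
have [||//|K2 e2] := @transform_star_coord F G (@q2 R) (@q2 R) (@q3 R) (@q0 R)
  (fun q => - q1 q) _ _ _ F2 F3 F0 N1.
- by [].
- by move=> p q /=; ring.
have [||//|K3 e3] := @transform_star_coord F G (@q3 R) (@q3 R) (fun q => - q2 q) (@q1 R)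
  (@q0 R) _ _ _ F3 N2 F1 F0.
- by [].
- by move=> p q /=; ring.
split=> [|t A B C]; first by split.
by rewrite /A /B /C e0 e1 e2 e3 !transform_opp //; split; ring.
Qed.

End StarProduct.

(** * Invertibility for the star product *)

Section Invertibility.
Context {R : realType}.
Implicit Types (c i j p q : quat R) (t u v : R) (F G : wiener R).

Local Notation e1 := (Quat 0 1 0 0 : quat R).
Local Notation e2 := (Quat 0 0 1 0 : quat R).

Lemma qsphere_e1 : qsphere R e1.
Proof. by apply/qsphereE; split => //=; ring. Qed.

Lemma qsphere_e2 : qsphere R e2.
Proof. by apply/qsphereE; split => //=; ring. Qed.

Lemma qorthogonal_e12 : qorthogonal e1 e2.
Proof. by apply: quatP => /=; ring. Qed.

Lemma qsphereN i : qsphere R i -> qsphere R (- i).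
Proof. by rewrite /qsphere /= sqrrN. Qed.

Lemma wfun_zero F t :
  qdet (wcst F) (wdens F) t = 0 <-> exists2 i, qsphere R i & F (t *: i) = 0.
Proof.
have fL1 := qL1_coordL1 (wdens_L1 F).
have [Re Im] := qdet_coord (wcst F) (wdens F) t.
apply: (iff_trans (B := _)); last first.
  apply: (iff_trans (zero_on_sphere (qcos (wcst F) (wdens F) t) (qsin (wcst F) (wdens F) t))).
  by split=> -[i Si e]; exists i => //; move: e; rewrite /wfun (qlaplace_imag _ _ Si fL1).
split=> [D0|[n o]].
  move: Re Im; rewrite D0 /= => Re Im; split.
    by apply/eqP; rewrite -subr_eq0 -Re.
  by apply: (@mulfI R 2); rewrite ?pnatr_eq0 // -Im mulr0.
by apply: complexP; rewrite ?Re ?Im /= ?n ?subrr // o mulr0.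
Qed.

Definition unit_transform c (f : R -> quat R) t :=
  [/\ transform (@q0 R) c f t = 1, transform (@q1 R) c f t = 0,
      transform (@q2 R) c f t = 0 & transform (@q3 R) c f t = 0].

(** Two opposite units suffice: C + i S = 1 and C - i S = 1 force C = 1 and S = 0. The identity on
    imaginary quaternions thus yields the transforms at [t] directly. *)
Lemma wstar_eq1 F G t :
  (forall i, qsphere R i -> wstar F G (t *: i) = 1) <->
  unit_transform (wcst F * wcst G) (star_dens F G) t.
Proof.
have [fL1 _] := transform_star F G.
have lap i (Si : qsphere R i) : wstar F G (t *: i) =
    qcos (wcst F * wcst G) (star_dens F G) t + i * qsin (wcst F * wcst G) (star_dens F G) t.
  exact: qlaplace_imag.
split=> [inv|[T0 T1 T2 T3] i Si]; last first.
  rewrite lap // /qcos /qsin T0 T1 T2 T3 /=.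
  by apply: quatP => /=; ring.
have := inv _ (qsphereN qsphere_e1); have := inv _ qsphere_e1.
rewrite (lap _ qsphere_e1) (lap _ (qsphereN qsphere_e1)) /qcos /qsin /unit_transform.
move: (transform (@q0 R) _ _ _) (transform (@q1 R) _ _ _) (transform (@q2 R) _ _ _)
  (transform (@q3 R) _ _ _) => [a a'] [b b'] [d d'] [e e'] /=.
move=> [h0 h1 h2 h3] [k0 k1 k2 k3].
by split; apply: complexP => /=; lra.
Qed.

Lemma winvertible_transform F : winvertible F <-> exists G, forall t,
  unit_transform (wcst F * wcst G) (star_dens F G) t /\
  unit_transform (wcst G * wcst F) (star_dens G F) t.
Proof.
split=> -[G inv]; exists G.
  move=> t; split; apply/wstar_eq1 => i Si; have [] // := inv (t *: i).
  - by exists t; exists i.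
  - by exists t; exists i.
move=> _ [t [i Si ->]]; have [U V] := inv t.
by split; [move/wstar_eq1: U|move/wstar_eq1: V]; apply.
Qed.

(** Euler's four-square identity over the complex numbers. *)
Lemma qdet_star F G t : qdet (wcst F * wcst G) (star_dens F G) t =
  qdet (wcst F) (wdens F) t * qdet (wcst G) (wdens G) t.
Proof.
have [_ /(_ t)[T0 T1 T2 T3]] := transform_star F G.
by rewrite /qdet T0 T1 T2 T3; ring.
Qed.

Lemma winvertible_qdet F : winvertible F -> forall t, qdet (wcst F) (wdens F) t != 0.
Proof.
move=> /winvertible_transform[G inv] t; have [[T0 T1 T2 T3] _] := inv t.
have := qdet_star F G t; rewrite {1}/qdet T0 T1 T2 T3 => e.
apply/eqP => D0; move: e; rewrite D0 mul0r => /eqP.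
by rewrite expr1n !expr0n !addr0 oner_eq0.
Qed.

(** A value at infinity: if the constant of [F] vanished, so would that of the product, and by
    Riemann-Lebesgue its real coordinate could not be 1 for large [t]. *)
Lemma winvertible_wcst F : winvertible F -> wcst F != 0.
Proof.
move=> /winvertible_transform[G inv]; have [[L0 _ _ _] _] := transform_star F G.
apply/eqP => c0.
have half0 : 0 < (2^-1 : R) by lra.
have [T T0 small] := riemann_lebesgue L0 half0.
have := small T; rewrite ger0_norm ?(ltW T0) // => /(_ (lexx _)).
have [[+ _ _ _] _] := inv T.
rewrite /transform c0 mul0r /= add0r => ->; rewrite cnorm1; lra.
Qed.

Lemma qdet_winvertible F : wcst F != 0 -> (forall t, qdet (wcst F) (wdens F) t != 0) ->
  winvertible F.
Proof.
move=> c0 D0; apply/winvertible_transform.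
have [F0 F1 F2 F3] := qL1_coordL1 (wdens_L1 F).
set c := wcst F in c0 D0 *; set f := wdens F in D0 F0 F1 F2 F3 *.
(* Pairing [F] with itself, all signs positive, exhibits [qdet] as a real constant |c|^2 plus the
   transform of a real density, as [wiener_lemma] requires. *)
have [K e] := hat_star (q0 c) (q1 c) (q2 c) (q3 c) (q0 c) (q1 c) (q2 c) (q3 c)
  F0 F1 F2 F3 F0 F1 F2 F3.
set k := (X in L1 X) in K.
set d := _ + _ + _ + _ in e.
have De t : qdet c f t = d%:C + hat k t by rewrite e /qdet /transform; ring.
have d0 : d != 0.
  rewrite /d -!expr2 !paddr_eq0 ?addr_ge0 ?sqr_ge0 // !sqrf_eq0.
  by apply: contraNN c0 => /andP[/andP[/andP[/eqP ? /eqP ?] /eqP ?] /eqP ?]; apply/eqP/quatP.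
have [|x [h [Lh inv]]] := wiener_lemma K d0; first by move=> t; rewrite -De.
pose Psi t := x%:C + hat h t.
have mul (pi : quat R -> R) : L1 (fun u => pi (f u)) ->
    exists y g, L1 g /\ forall t, y%:C + hat g t = transform pi c f t * Psi t.
  move=> Lpi.
  have W1 : rwiener (transform pi c f) (`|pi c| + norm1 (fun u => pi (f u))).
    by exists (pi c), (fun u => pi (f u)).
  have W2 : rwiener Psi (`|x| + norm1 h) by exists x, h.
  have [y [g [Lg eg _]]] := rwienerM W1 W2.
  by exists y, g; split => // t; rewrite eg.
have [y0 [g0 [Lg0 eg0]]] := mul _ F0; have [y1 [g1 [Lg1 eg1]]] := mul _ F1.
have [y2 [g2 [Lg2 eg2]]] := mul _ F2; have [y3 [g3 [Lg3 eg3]]] := mul _ F3.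
have gL1 : qL1 (fun u => Quat (g0 u) (- g1 u) (- g2 u) (- g3 u)).
  by apply: coordL1_qL1; split => //=; exact: L1N.
pose G := Wiener (Quat y0 (- y1) (- y2) (- y3)) gL1.
have G0 t : transform (@q0 R) (wcst G) (wdens G) t = transform (@q0 R) c f t * Psi t.
  by rewrite -eg0.
have G1 t : transform (@q1 R) (wcst G) (wdens G) t = - (transform (@q1 R) c f t * Psi t).
  by rewrite -eg1 /transform /= hatN // rmorphN opprD.
have G2 t : transform (@q2 R) (wcst G) (wdens G) t = - (transform (@q2 R) c f t * Psi t).
  by rewrite -eg2 /transform /= hatN // rmorphN opprD.
have G3 t : transform (@q3 R) (wcst G) (wdens G) t = - (transform (@q3 R) c f t * Psi t).
  by rewrite -eg3 /transform /= hatN // rmorphN opprD.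
have unit t : qdet c f t * Psi t = 1 by rewrite De inv.
exists G => t.
have [_ /(_ t)[T0 T1 T2 T3]] := transform_star F G.
have [_ /(_ t)[S0 S1 S2 S3]] := transform_star G F.
split; split.
- by rewrite T0 G0 G1 G2 G3 -(unit t) /qdet; ring.
- by rewrite T1 G0 G1 G2 G3; ring.
- by rewrite T2 G0 G1 G2 G3; ring.
- by rewrite T3 G0 G1 G2 G3; ring.
- by rewrite S0 G0 G1 G2 G3 -(unit t) /qdet; ring.
- by rewrite S1 G0 G1 G2 G3; ring.
- by rewrite S2 G0 G1 G2 G3; ring.
- by rewrite S3 G0 G1 G2 G3; ring.
Qed.

End Invertibility.

(* The condition [wcst F != 0] (no zero at infinity) concerns only statement (i):
   it is necessary for (i), and (ii)-(iv) do not imply it. *)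
Theorem theorem4p3 (R : realType) (F : wiener R) :
  let st1 := winvertible F in
  let st2 := forall i, qsphere R i ->
    forall j, qsphere R j -> qorthogonal i j ->
    forall t : R, \det (womega i j F t) != 0 in
  let st3 := exists i, qsphere R i /\
    exists j, [/\ qsphere R j, qorthogonal i j &
    forall t : R, \det (womega i j F t) != 0] in
  let st4 := forall p, qimag R p -> F p != 0 in
  [/\ wcst F != 0 -> [<-> st1; st2; st3; st4],
      [<-> st2; st3; st4] &
      st1 -> wcst F != 0].
Proof.
move=> st1 st2 st3 st4.
have nz2 : (forall t, qdet (wcst F) (wdens F) t != 0) -> st2.
  by move=> nz i Si j Sj ij t; rewrite det_womega.
have st23 : st2 -> st3.
  move=> h; exists (Quat 0 1 0 0); split; first exact: qsphere_e1.
  exists (Quat 0 0 1 0); split; [exact: qsphere_e2|exact: qorthogonal_e12|].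
  exact: h qsphere_e1 _ qsphere_e2 qorthogonal_e12.
have st34 : st3 -> st4.
  (* The zero may occur at a unit [k] unrelated to [i]; [det_womega] removes the dependence on the
     units. *)
  move=> [i [Si [j [Sj ij nz]]]] _ [t [k Sk ->]]; apply/eqP => F0.
  have := nz t; rewrite det_womega // => /eqP; apply.
  by apply/wfun_zero; exists k.
have st4nz : st4 -> forall t, qdet (wcst F) (wdens F) t != 0.
  move=> h t; apply/eqP => /wfun_zero[i Si]; apply/eqP/h.
  by exists t; exists i.
split; last exact: winvertible_wcst.
(* With [c0] the cycle closes through (i); the other cycle returns from (iv) directly to (ii). *)
- move=> c0; tfae => //.
  + by move=> /winvertible_qdet.
  + by move=> /st4nz; exact: qdet_winvertible.
- by tfae => // /st4nz.
Qed.
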